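(* Let $\mu\in\mathscr{P}(\mathbb{R}^d)$ satisfy $\sup_{i}\int\exp(c|x_i|)\,d\mu<\infty$ for some $c>0$. Let $S\subset\mathbb{R}^d\times\mathbb{R}^{d(d+1)/2}$ be the parameter set defined in the context, and assume that $S$ is compact with nonempty interior and that the quadratic module $Q(g,q)$ defined in the context is Archimedean. Consider $$(\mathrm{OT})\qquad\tau=\inf_{\phi\in\mathscr{P}(S),\,\lambda\in\mathscr{P}(\mathbb{R}^{2d})}\Big\{\int\|\mathbf{x}-\mathbf{y}\|^2\,d\lambda(\mathbf{x},\mathbf{y}):\ \lambda_{\mathbf{x}}=\mu,\ \lambda_{\mathbf{y}}=\nu_\phi\Big\},$$ $$(\mathrm{MOM})\qquad\inf_{\phi\in\mathscr{P}(S),\,\lambda\in\mathscr{P}(\mathbb{R}^{2d})}\Big\{\int\|\mathbf{x}-\mathbf{y}\|^2\,d\lambda:\ \int\mathbf{x}^{\alpha}d\lambda=\int \mathbf{x}^\alpha d\mu,\ \int\mathbf{y}^{\alpha}d\lambda=\int_Sp_\alpha\,d\phi,\ \forall\alpha\in\mathbb{N}^d\Big\}.$$ Then: (i) The optimal transport problem (OT) has an optimal solution $(\phi^*,\lambda^* )\in\mathscr{P}(S)\times\mathscr{P}(\mathbb{R}^{2d})$, which is also an optimal solution of (MOM). Moreover both measures $\lambda^*\in\mathscr{P}(\mathbb{R}^{2d})$ and $\nu_{\phi^*}\in\mathscr{P}(\mathbb{R}^d)$ are moment determinate. (ii) Moreover, $\tau=0$ if and only if $\lambda^*=\mu\otimes\mu$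 and $\mu=\nu_{\phi^*}$, i.e., $\mu$ is a Gaussian mixture with $\phi^*$ a mixing measure of parameters $(\mathbf{m},\mathbf{\Sigma})\in S$.
   Context: $\mathscr{P}(\mathcal{X})$ is the set of Borel probability measures on $\mathcal{X}$; $\lambda_{\mathbf{x}},\lambda_{\mathbf{y}}$ denote the marginals of $\lambda\in\mathscr{P}(\mathbb{R}^{2d})$ with respect to $\mathbf{x},\mathbf{y}\in\mathbb{R}^d$; $\mu\otimes\mu$ denotes the product measure of $\mu$ with itself on $\mathbb{R}^{2d}$. A symmetric matrix $\mathbf{\Sigma}=(\sigma_{ij})_{i,j\le d}$ is identified with the vector $\boldsymbol{\sigma}\in\mathbb{R}^{d(d+1)/2}$ of its entries $\sigma_{ij}$, $i\le j$. Parameter set: fix scalars $0<a<b$. The condition $a\mathbf{I}\preceq\mathbf{\Sigma}\preceq b\mathbf{I}$ is expressed (via determinants) by $2d$ polynomial inequalities $q_k(\boldsymbol{\sigma})\ge0$, $k=1,\dots,2d$. With polynomials $g_j\in\mathbb{R}[\mathbf{m}]$, set $$S=\{(\mathbf{m},\boldsymbol{\sigma}):\ g_j\ge0,\ j=1,\dots,s;\ q_k(\boldsymbol{\sigma})\ge0,\ k=1,\dots,2d\},$$ where one of the constraints, relabelled $g_1$, is the redundant constraint $g_1(\mathbf{m},\boldsymbol{\sigma})=R^2-\|\mathbf{m}\|^2-\|\boldsymbol{\sigma}\|^2\ge0$ for a scalar $R>0$ such that it holds on $S$. The quadratic module is $$Q(g,q)=\Big\{\sum_{j=0}^s\theta_jg_j+\sum_{k=1}^{2d}\theta'_kq_k:\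 \theta_j,\theta'_k\ \text{sums of squares in}\ \mathbb{R}[\mathbf{m},\boldsymbol{\sigma}]\Big\},\quad g_0=1;$$ it is Archimedean if it contains $N-\|\mathbf{m}\|^2-\|\boldsymbol{\sigma}\|^2$ for some $N$. For $(\mathbf{m},\mathbf{\Sigma})$ with $\mathbf{\Sigma}\succ0$, $\mathcal{N}(\mathbf{m},\mathbf{\Sigma})$ is the Gaussian measure on $\mathbb{R}^d$ with mean $\mathbf{m}$ and covariance $\mathbf{\Sigma}$. For $\phi\in\mathscr{P}(S)$, $\nu_\phi(B)=\int_S\mathcal{N}(\mathbf{m},\mathbf{\Sigma})(B)\,d\phi(\mathbf{m},\mathbf{\Sigma})$ for Borel $B\subset\mathbb{R}^d$; it is the Gaussian mixture with mixing measure $\phi$. For $\alpha\in\mathbb{N}^d$, $p_\alpha\in\mathbb{R}[\mathbf{m},\boldsymbol{\sigma}]$ is the polynomial $p_\alpha(\mathbf{m},\boldsymbol{\sigma})=\int\mathbf{x}^\alpha\,d\mathcal{N}(\mathbf{m},\mathbf{\Sigma})(\mathbf{x})$, of total degree at most $|\alpha|$. In (MOM) the moments of $\lambda$ appearing are understood to be finite. A Borel measure with all moments finite is moment determinate if there is no other measure with the same moments.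
   Formalization: In (ii), ''λ* = μ⊗μ'' (product measure) is replaced by ''λ* is the image of μ under x ↦ (x,x)'' (diagonal coupling); as written (ii) fails, e.g. for μ = N(m,Σ) with (m,Σ) in S: τ = 0 but μ⊗μ has cost 2 tr Σ > 0. *)

(* Defs.v *)
From HB Require Import structures.
From mathcomp Require Import all_boot all_order all_algebra.
From mathcomp Require Import -(notations) mpoly.
From mathcomp Require Import all_classical all_reals all_analysis.
From mathcomp Require Import measurable_realfun.

Set Implicit Arguments.
Unset Strict Implicit.
Unset Printing Implicit Defensive.

Import Order.TTheory GRing.Theory Num.Theory.
Import numFieldNormedType.Exports.

Local Open Scope classical_set_scope.
Local Open Scope ring_scope.

Fact borel_display : measure_display. Proof. by []. Qed.

(* R^n is 'rV[R]_n, and every matrix space carries the sigma-algebra generated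
   by its open sets. *)
Section borel_matrix_structure.
Context (R : realType) (m n : nat).

HB.instance Definition _ := @isMeasurable.Build borel_display 'M[R]_(m, n)
  <<s @open 'M[R]_(m, n) >> (@sigma_algebra0 _ setT _) (@sigma_algebraC _ _)
  (@sigma_algebra_bigcup _ setT _).

End borel_matrix_structure.

Section borel_matrix.
Context (R : realType) (m n : nat).

Lemma open_measurable_mx (U : set 'M[R]_(m, n)) : open U -> measurable U.
Proof. by move=> oU; exact: sub_sigma_algebra. Qed.

Lemma measurable_coord (i : 'I_m) (j : 'I_n) :
  measurable_fun [set: 'M[R]_(m, n)] (fun M : 'M[R]_(m, n) => M i j).
Proof.
apply: (measurability (@RGenOpens.G R)).
  exact: RGenOpens.measurableE.
move=> _ [_ [x [y ->]] <-].
rewrite setTI; apply: open_measurable_mx.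
apply: open_comp; last exact: interval_open.
by move=> M _; exact: coord_continuous.
Qed.

Lemma measurable_mxP d (T : measurableType d) (f : T -> 'M[R]_(m, n)) :
  (forall i j, measurable_fun setT (fun t => f t i j)) -> measurable_fun setT f.
Proof.
move=> mf; apply: (measurability (@open 'M[R]_(m, n))) => //.
move=> _ [U oU <-]; rewrite setTI.
pose qR (M : 'M[rat]_(m, n)) : 'M[R]_(m, n) := map_mx ratr M.
pose box (c : 'M[rat]_(m, n)) (e : rat) : set 'M[R]_(m, n) :=
  [set M | forall i j, ball (qR c i j) (ratr e : R) (M i j)].
pose P (c : 'M[rat]_(m, n) * rat) := box c.1 c.2 `<=` U.
have UE : U = \bigcup_(c in P) box c.1 c.2.
  apply/seteqP; split => [M UM|M [c Pc cM]]; last exact: Pc cM.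
  have : nbhs M U by exact: open_nbhs_nbhs.
  move=> /nbhs_ballP[e /= e0 eU].
  have /rat_in_itvoo[r] : (0 : R) < e / 2 by rewrite divr_gt0.
  rewrite in_itv/= => /andP[r0 re].
  have cex i j : exists q : rat, `|M i j - ratr q| < ratr r.
    have /rat_in_itvoo[q] : M i j - ratr r < M i j + ratr r.
      by rewrite ltrD2l gtrN.
    rewrite in_itv/= => /andP[q1 q2]; exists q.
    by rewrite ltr_distlC ltrBlDr q2 -ltrBlDr q1.
  have [c cP] : {c : 'I_m -> 'I_n -> rat |
      forall i j, `|M i j - ratr (c i j)| < ratr r}.
    exists (fun i j => projT1 (cid (cex i j))) => i j.
    exact: (projT2 (cid (cex i j))).
  exists (\matrix_(i, j) c i j, r); last first.
    by move=> i j /=; rewrite /ball/= !mxE distrC cP.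
  move=> N /= cN; apply: eU; split => // i j.
  have := cN i j; rewrite /ball/= !mxE => h.
  rewrite (splitr e); apply: le_lt_trans (ler_distD (ratr (c i j)) _ _) _.
  by rewrite ltrD// (lt_trans _ re).
rewrite UE preimage_bigcup bigcup_mkcond.
apply: countable_bigcupT_measurable; first exact: countableP.
move=> c; case: ifPn => // _.
rewrite [X in measurable X](_ : _ = \big[setI/setT]_(i < m)
   \big[setI/setT]_(j < n) ((fun t => f t i j) @^-1` ball (qR c.1 i j) (ratr c.2))).
  apply: bigsetI_measurable => i _; apply: bigsetI_measurable => j _.
  rewrite -[X in measurable X]setTI; apply: mf => //.
  exact: measurable_ball.
apply/seteqP; split => [t /= bt|t].
  by rewrite -bigcap_seq => i _ /=; rewrite -bigcap_seq => j _; exact: bt.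
rewrite -bigcap_seq => bt i j.
by have := bt i; rewrite /= mem_index_enum -bigcap_seq => /(_ isT) /(_ j); rewrite /= mem_index_enum; apply.
Qed.

End borel_matrix.

Lemma sigma_finite_product d1 d2 (T1 : measurableType d1)
    (T2 : measurableType d2) (R : realType)
    (m1 : {sigma_finite_measure set T1 -> \bar R})
    (m2 : {sigma_finite_measure set T2 -> \bar R}) :
  sigma_finite setT (m1 \x m2)%E.
Proof.
have /sigma_finiteP[F [TF ndF Foo]] := sigma_finiteT m1.
have /sigma_finiteP[G [TG ndG Goo]] := sigma_finiteT m2.
exists (fun n => F n `*` G n).
  rewrite -setXTT TF TG predeqE => -[x y]; split.
    move=> [/= [n _ Fnx] [k _ Gky]]; exists (maxn n k) => //; split.
    - by move: x Fnx; exact/subsetPset/ndF/leq_maxl.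
    - by move: y Gky; exact/subsetPset/ndG/leq_maxr.
  by move=> [n _ []/= ? ?]; split; exists n.
move=> k; have [? ?] := Foo k; have [? ?] := Goo k.
split; first exact: measurableX.
by rewrite product_measure1E// lte_mul_pinfty// ge0_fin_numE.
Qed.

Section lebesgue_rV.
Context (R : realType).

Definition cons_rV n (p : measurableTypeR R * 'rV[R]_n) : 'rV[R]_(1 + n) :=
  row_mx (p.1%:M : 'rV_1) p.2.

Definition behead_rV n (v : 'rV[R]_(1 + n)) : measurableTypeR R * 'rV[R]_n :=
  (v ord0 (lshift n ord0), rsubmx v).

Lemma cons_rVK n : cancel (@cons_rV n) (@behead_rV n).
Proof.
move=> [x v]; rewrite /behead_rV /cons_rV row_mxKr; congr pair.
by rewrite row_mxEl mxE eqxx mulr1n.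
Qed.

Lemma measurable_cons_rV n : measurable_fun setT (@cons_rV n).
Proof.
apply: measurable_mxP => i j; rewrite /cons_rV.
case: (split_ordP j) => k ->.
  under eq_fun do rewrite row_mxEl mxE.
  rewrite !ord1 eqxx; exact: measurable_fst.
under eq_fun do rewrite row_mxEr.
exact: (measurableT_comp (measurable_coord _ _) measurable_snd).
Qed.

Lemma measurable_behead_rV n : measurable_fun setT (@behead_rV n).
Proof.
apply: measurable_fun_pair; first exact: measurable_coord.
apply: measurable_mxP => i j; under eq_fun do rewrite mxE.
exact: measurable_coord.
Qed.

Section step.
Context (n : nat)  (mu : {sigma_finite_measure set 'rV[R]_n -> \bar R}).

Definition lebesgue_step : set 'rV[R]_(1 + n) -> \bar R :=
  pushforward (@lebesgue_measure R \x mu)%E (@cons_rV n).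

Let lebesgue_step0 : lebesgue_step set0 = 0%E.
Proof. by rewrite /lebesgue_step /pushforward preimage_set0 measure0. Qed.

Let mpre A : measurable A -> measurable (@cons_rV n @^-1` A).
Proof. by move=> mA; rewrite -[X in measurable X]setTI; apply: measurable_cons_rV. Qed.

Let lebesgue_step_ge0 A : (0 <= lebesgue_step A)%E.
Proof. exact: integral_ge0. Qed.

Let lebesgue_step_sigma_additive : semi_sigma_additive lebesgue_step.
Proof.
move=> F mF tF mUF; rewrite /lebesgue_step /pushforward preimage_bigcup.
apply: measure_semi_sigma_additive => //.
- by move=> k; exact: mpre.
- by apply/trivIsetP => /= i j _ _ ij; rewrite -preimage_setI;
    move/trivIsetP : tF => /(_ _ _ _ _ ij) ->//; rewrite preimage_set0.
- by rewrite -preimage_bigcup; exact: mpre.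
Qed.

HB.instance Definition _ := isMeasure.Build _ _ _ lebesgue_step
  lebesgue_step0 lebesgue_step_ge0 lebesgue_step_sigma_additive.

Let lebesgue_step_sigma_finite : sigma_finite setT lebesgue_step.
Proof.
have [F TF Foo] := sigma_finite_product (@lebesgue_measure R) mu.
exists (fun k => (@behead_rV n) @^-1` F k).
  by rewrite -preimage_bigcup -TF preimage_setT.
move=> k; have [mF Fk] := Foo k; split.
  by rewrite -[X in measurable X]setTI; apply: measurable_behead_rV.
rewrite /lebesgue_step /pushforward -comp_preimage.
rewrite (_ : _ \o _ = id) //; apply/funext => x /=; exact: cons_rVK.
Qed.

HB.instance Definition _ := Measure_isSigmaFinite.Build _ _ _ lebesgue_step
  lebesgue_step_sigma_finite.

End step.

(* Lebesgue measure on R^n as the n-fold product of the one-dimensional one. *)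
Fixpoint lebesgue_rV n : {sigma_finite_measure set 'rV[R]_n -> \bar R} :=
  match n with
  | 0 => dirac (0 : 'rV[R]_0)
  | n'.+1 => lebesgue_step (lebesgue_rV n')
  end.

End lebesgue_rV.

Section measurable_matrix_operations.
Context d (T : measurableType d) (R : realType).

Lemma measurable_inv (f : T -> R) :
  measurable_fun setT f -> measurable_fun setT (fun t => (f t)^-1).
Proof.
move=> mf; apply: (measurableT_comp (f := (@GRing.inv R))) => //.
have -> : [set: R] = [set x | x != 0] `|` [set 0].
  by apply/seteqP; split => // x _; have [->|x0] := eqVneq x 0; [right|left].
have o0 : open [set x : R | x != 0].
  rewrite (_ : [set x | x != 0] = ~` [set 0]); last first.
    by apply/seteqP; split => x /= /eqP.
  exact/closed_openC/closed_eq.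
apply/measurable_funU; [exact: open_measurable|exact: measurable_set1|split].
  apply: open_continuous_measurable_fun => // x; rewrite inE/= => x0.
  exact: inv_continuous.
exact: measurable_fun_set1.
Qed.

Lemma measurable_mulmx m n p (A : T -> 'M[R]_(m, n)) (B : T -> 'M[R]_(n, p)) :
  (forall i j, measurable_fun setT (fun t => A t i j)) ->
  (forall i j, measurable_fun setT (fun t => B t i j)) ->
  forall i j, measurable_fun setT (fun t => (A t *m B t) i j).
Proof.
move=> mA mB i j; under eq_fun do rewrite mxE.
by apply: measurable_sum => k; exact: measurable_funM.
Qed.

Lemma measurable_det n (A : T -> 'M[R]_n) :
  (forall i j, measurable_fun setT (fun t => A t i j)) ->
  measurable_fun setT (fun t => \det (A t)).
Proof.
move=> mA; apply: measurable_sum => s; apply: measurable_funM => //.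
by apply: measurable_prod => i _.
Qed.

Lemma measurable_invmx n (A : T -> 'M[R]_n) :
  (forall i j, measurable_fun setT (fun t => A t i j)) ->
  forall i j, measurable_fun setT (fun t => invmx (A t) i j).
Proof.
move=> mA i j.
rewrite (_ : (fun t => _) = fun t => if \det (A t) == 0 then A t i j
    else (\det (A t))^-1 * ((-1) ^+ (j + i) * \det (row' j (col' i (A t))))).
  apply: measurable_fun_ifT => //.
    by apply: measurable_fun_eqr => //; exact: measurable_det.
  apply: measurable_funM; first by apply: measurable_inv; exact: measurable_det.
  apply: measurable_funM => //; apply: measurable_det => k l.
  by under eq_fun do rewrite !mxE; exact: mA.
apply/funext => t; rewrite /invmx unitmxE unitfE.
by case: eqP => //= _; rewrite !mxE.
Qed.

End measurable_matrix_operations.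

Section gaussian.
Context (R : realType) (d : nat).
Implicit Types (m x : 'rV[R]_d) (Sigma : 'M[R]_d).

(* This is the density of N(m, Sigma) only when Sigma is positive definite;
   otherwise the expression is total but meaningless. *)
Definition gaussian_pdf m Sigma x : R :=
  (Num.sqrt ((pi *+ 2) ^+ d * \det Sigma))^-1 *
  expR (- ((x - m) *m invmx Sigma *m (x - m)^T) ord0 ord0 / 2).

Lemma gaussian_pdf_ge0 m Sigma x : 0 <= gaussian_pdf m Sigma x.
Proof. by rewrite mulr_ge0 ?expR_ge0// invr_ge0. Qed.

Lemma measurable_gaussian_pdf d' (T : measurableType d')
    (m x : T -> 'rV[R]_d) (Sigma : T -> 'M[R]_d) :
  (forall i j, measurable_fun setT (fun t => m t i j)) ->
  (forall i j, measurable_fun setT (fun t => x t i j)) ->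
  (forall i j, measurable_fun setT (fun t => Sigma t i j)) ->
  measurable_fun setT (fun t => gaussian_pdf (m t) (Sigma t) (x t)).
Proof.
move=> mm mx mS; apply: measurable_funM.
  apply: measurable_inv.
  apply: (measurableT_comp (f := @Num.sqrt R)).
    by apply: continuous_measurable_fun; exact: sqrt_continuous.
  by apply: measurable_funM => //; exact: measurable_det.
apply: (measurableT_comp (f := @expR R)) => //.
apply: measurable_funM => //; apply: measurable_funN.
have mxm i j : measurable_fun setT (fun t => (x t - m t) i j).
  by under eq_fun do rewrite !mxE; exact: measurable_funB.
apply: measurable_mulmx => [i j|i j].
  by apply: measurable_mulmx => // k l; exact: measurable_invmx.
by under eq_fun do rewrite mxE; exact: mxm.
Qed.

Definition gaussian m Sigma (B : set 'rV[R]_d) : \bar R :=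
  (\int[lebesgue_rV R d]_(x in B) (gaussian_pdf m Sigma x)%:E)%E.

Section gaussian_measure.
Context m Sigma.

Let mpdf D : measurable_fun D (fun x => (gaussian_pdf m Sigma x)%:E).
Proof.
apply: measurable_funTS; apply/measurable_EFinP.
by apply: measurable_gaussian_pdf => // i j; exact: measurable_coord.
Qed.

Let gaussian0 : gaussian m Sigma set0 = 0%E.
Proof. by rewrite /gaussian integral_set0. Qed.

Let gaussian_ge0 B : (0 <= gaussian m Sigma B)%E.
Proof. by apply: integral_ge0 => x _; rewrite lee_fin gaussian_pdf_ge0. Qed.

Let gaussian_sigma_additive : semi_sigma_additive (gaussian m Sigma).
Proof.
move=> F mF tF mUF; rewrite /gaussian ge0_integral_bigcup//; last first.
  by move=> x _; rewrite lee_fin gaussian_pdf_ge0.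
apply: is_cvg_ereal_nneg_natsum_cond => n _ _.
by apply: integral_ge0 => x _; rewrite lee_fin gaussian_pdf_ge0.
Qed.

HB.instance Definition _ := isMeasure.Build _ _ _ (gaussian m Sigma)
  gaussian0 gaussian_ge0 gaussian_sigma_additive.

End gaussian_measure.

Lemma measurable_gaussian d' (T : measurableType d')
    (m : T -> 'rV[R]_d) (Sigma : T -> 'M[R]_d) (B : set 'rV[R]_d) :
  (forall i j, measurable_fun setT (fun t => m t i j)) ->
  (forall i j, measurable_fun setT (fun t => Sigma t i j)) ->
  measurable B -> measurable_fun setT (fun t => gaussian (m t) (Sigma t) B).
Proof.
move=> mm mS mB.
pose f (p : T * 'rV[R]_d) : \bar R :=
  (gaussian_pdf (m p.1) (Sigma p.1) p.2 * \1_B p.2)%:E.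
have mf : measurable_fun setT f.
  apply/measurable_EFinP/measurable_funM.
    apply: measurable_gaussian_pdf => i j.
    - exact: (measurableT_comp (mm i j) measurable_fst).
    - exact: (measurableT_comp (measurable_coord _ _) measurable_snd).
    - exact: (measurableT_comp (mS i j) measurable_fst).
  exact: (measurableT_comp (measurable_indic mB) measurable_snd).
have f0 p : (0 <= f p)%E by rewrite lee_fin mulr_ge0// gaussian_pdf_ge0.
have := measurable_fun_fubini_tonelli_F (m2 := lebesgue_rV R d) f mf f0.
congr (measurable_fun _ _).
apply/funext => t; rewrite /fubini_F /gaussian [RHS]integral_mkcond.
apply: eq_integral => x _; rewrite /f/= patchE indicE.
by case: (x \in B); rewrite ?mulr1 ?mulr0.
Qed.

End gaussian.

Section parameters.
Context (d : nat).

Definition upper_pair := {ij : 'I_d * 'I_d | (ij.1 <= ij.2)%N}.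

(* d(d+1)/2, see symdimE: the coordinates of sigma are indexed by the pairs
   i <= j, through the enumeration of this finite type. *)
Definition symdim : nat := #|{: upper_pair}|.

Lemma symdimE : symdim = (d * d.+1)./2.
Proof.
rewrite /symdim card_sig mulnC -bin2 -triangular_sum big_mkord.
rewrite -sum1_card (eq_bigl (fun p : 'I_d * 'I_d => true && (p.1 <= p.2)%N)) //.
rewrite -(pair_big_dep xpredT (fun i j : 'I_d => (i <= j)%N) (fun _ _ => 1%N)) /=.
rewrite (exchange_big_dep xpredT)//= big_ord_recl add0n.
apply: eq_bigr => j _; rewrite -(big_ord_widen d (fun=> 1%N) (ltn_ord j)).
by rewrite sum1_card card_ord.
Qed.

Fact sorted_pair_subproof (i j : 'I_d) :
  ((if (i <= j)%N then (i, j) else (j, i)).1 <=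
   (if (i <= j)%N then (i, j) else (j, i)).2)%N.
Proof. by case: (leqP i j) => [//|/ltnW]. Qed.

Definition sorted_pair (i j : 'I_d) : upper_pair :=
  exist _ (if (i <= j)%N then (i, j) else (j, i)) (sorted_pair_subproof i j).

Context (R : realType).

Definition symmx (sigma : 'rV[R]_symdim) : 'M[R]_d :=
  \matrix_(i, j) sigma ord0 (enum_rank (sorted_pair i j)).

(* A parameter theta is the concatenation of m and sigma. *)
Definition mean (theta : 'rV[R]_(d + symdim)) : 'rV[R]_d := lsubmx theta.

Definition cov (theta : 'rV[R]_(d + symdim)) : 'M[R]_d := symmx (rsubmx theta).

End parameters.

Section matrix_order.
Context (R : realType) (d : nat).
Implicit Types A B : 'M[R]_d.

Definition psd A : Prop :=
  A^T = A /\ forall v : 'rV[R]_d, 0 <= (v *m A *m v^T) ord0 ord0.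

Definition pd A : Prop :=
  A^T = A /\ forall v : 'rV[R]_d, v != 0 -> 0 < (v *m A *m v^T) ord0 ord0.

Definition loewner_le A B : Prop := psd (B - A).

End matrix_order.

Section polynomials.
Context (R : realType).

Definition peval n (p : mpoly n R) (v : 'rV[R]_n) : R :=
  meval (fun i => v ord0 i) p.

Definition var n (i : 'I_n) : mpoly n R := mpolyX R (mnm1 i).

(* The polynomial p(X_0, ..., X_{n-1}) read as p(X_{f 0}, ..., X_{f (n-1)}). *)
Definition rename n k (f : 'I_n -> 'I_k) (p : mpoly n R) :
    mpoly k R :=
  comp_mpoly [tuple var (f i) | i < n] p.

Definition sqnorm n (v : 'rV[R]_n) : R := \sum_i v ord0 i ^+ 2.

(* r - ||X||^2 *)
Definition ball_poly n (r : R) : mpoly n R :=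
  mpolyC n r - \sum_i var i ^+ 2.

Definition sos n (p : mpoly n R) : Prop :=
  exists s : seq (mpoly n R), p = \sum_(h <- s) h ^+ 2.

Lemma measurable_peval n (p : mpoly n R) : measurable_fun setT (peval p).
Proof.
rewrite /peval; under eq_fun do rewrite mevalE.
apply: measurable_sum => m; apply: measurable_funM => //.
apply: measurable_prod => i _; apply: measurable_funX.
exact: measurable_coord.
Qed.

Lemma peval_ball_poly n r (v : 'rV[R]_n) : peval (ball_poly n r) v = r - sqnorm v.
Proof.
rewrite /peval /ball_poly /var.
rewrite rmorphB /= mevalC; congr (_ - _).
by rewrite rmorph_sum; apply: eq_bigr => i _; rewrite rmorphXn /= mevalXU.
Qed.

Lemma peval_rename n k (f : 'I_n -> 'I_k) p (v : 'rV[R]_k) :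
  peval (rename f p) v = peval p (\row_i v ord0 (f i)).
Proof.
rewrite /peval /rename comp_mpoly_meval.
apply: meval_eq => i; rewrite !mxE tnth_map tnth_ord_tuple.
exact: mevalXU.
Qed.

End polynomials.

Section parameter_set.
Context (R : realType) (d s : nat).
Variables (g : 'I_s -> mpoly d R)
  (q : 'I_(2 * d) -> mpoly (symdim d) R) (rad : R).

(* g lists the constraints on m only; the redundant constraint
   rad^2 - ||m||^2 - ||sigma||^2 >= 0 is put at index 0. *)
Definition all_g (j : 'I_s.+1) : mpoly (d + symdim d) R :=
  if unlift ord0 j is Some i then rename (lshift (symdim d)) (g i)
  else ball_poly (d + symdim d) (rad ^+ 2).

Definition all_q (k : 'I_(2 * d)) : mpoly (d + symdim d) R :=
  rename (@rshift d (symdim d)) (q k).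

Definition param_set : set 'rV[R]_(d + symdim d) :=
  [set theta | (forall j, 0 <= peval (all_g j) theta) /\
               (forall k, 0 <= peval (all_q k) theta)].

Lemma measurable_param_set : measurable param_set.
Proof.
have mge p : measurable [set t : 'rV[R]_(d + symdim d) | 0 <= peval p t].
  rewrite (_ : [set _ | _] = peval p @^-1` `[0, +oo[%classic); last first.
    by apply/seteqP; split => t /=; rewrite in_itv/= andbT.
  by rewrite -[X in measurable X]setTI; exact: measurable_peval.
rewrite (_ : param_set =
    (\bigcap_(j in [set: 'I_s.+1]) [set t | 0 <= peval (all_g j) t]) `&`
    (\bigcap_(k in [set: 'I_(2 * d)]) [set t | 0 <= peval (all_q k) t])).
  by apply: measurableI; apply: fin_bigcap_measurable => // *; exact: mge.
apply/seteqP; split => t /=.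
  by move=> [h1 h2]; split => i _; [exact: h1|exact: h2].
by move=> [h1 h2]; split => i; [exact: h1|exact: h2].
Qed.

Lemma param_setP theta : param_set theta <->
  [/\ forall j, 0 <= peval (g j) (mean theta),
      forall k, 0 <= peval (q k) (rsubmx theta) &
      sqnorm theta <= rad ^+ 2].
Proof.
have lE : \row_i theta ord0 (lshift (symdim d) i) = mean theta.
  by apply/rowP => i; rewrite !mxE; congr (theta _ _); exact/val_inj.
have rE : \row_i theta ord0 (rshift d i) = rsubmx theta.
  by apply/rowP => i; rewrite !mxE; congr (theta _ _); exact/val_inj.
split=> [[Hg Hq]|[Hg Hq Hr]].
  split => [j|k|].
  - by have := Hg (lift ord0 j); rewrite /all_g liftK peval_rename lE.
  - by have := Hq k; rewrite /all_q peval_rename rE.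
  - have := Hg ord0.
    by rewrite /all_g unlift_none peval_ball_poly subr_ge0.
split => [j|k].
  rewrite /all_g; case: unliftP => [i _|_]; first by rewrite peval_rename lE.
  by rewrite peval_ball_poly subr_ge0.
by rewrite /all_q peval_rename rE.
Qed.

Definition quadratic_module (p : mpoly (d + symdim d) R) : Prop :=
  exists (theta0 : mpoly (d + symdim d) R)
         (theta : 'I_s.+1 -> mpoly (d + symdim d) R)
         (theta' : 'I_(2 * d) -> mpoly (d + symdim d) R),
    [/\ sos theta0, forall j, sos (theta j), forall k, sos (theta' k) &
        p = theta0 + \sum_j theta j * all_g j + \sum_k theta' k * all_q k].

Definition archimedean : Prop :=
  exists N : R, quadratic_module (ball_poly (d + symdim d) N).

End parameter_set.

Section moments.
Context (R : realType) (n : nat).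
Implicit Types (alpha : 'I_n -> nat) (nu : {measure set 'rV[R]_n -> \bar R}).

Definition monomial alpha (x : 'rV[R]_n) : R := \prod_i x ord0 i ^+ alpha i.

Definition finite_moments nu : Prop :=
  forall alpha, nu.-integrable setT (EFin \o monomial alpha).

Definition moment_determinate nu : Prop :=
  finite_moments nu /\
  forall nu' : {measure set 'rV[R]_n -> \bar R}, finite_moments nu' ->
    (forall alpha, \int[nu']_x (monomial alpha x)%:E =
                   \int[nu]_x (monomial alpha x)%:E)%E ->
    forall B, measurable B -> nu' B = nu B.

End moments.

(* p is the polynomial p_alpha(m, sigma) = \int x^alpha dN(m, Sigma), of total
   degree at most |alpha|; it is determined by its values on the open set
   Sigma > 0. mmeasure mdeg p is 1 + the total degree of p. *)
Definition gaussian_moment_poly (R : realType) (d : nat) (alpha : 'I_d -> nat)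
    (p : mpoly (d + symdim d) R) : Prop :=
  (mmeasure mdeg p <= (\sum_i alpha i).+1)%N /\
  forall theta, pd (cov theta) ->
    (peval p theta)%:E =
    (\int[gaussian (mean theta) (cov theta)]_x (monomial alpha x)%:E)%E.

Section mixture.
Context (R : realType) (d : nat) (S : set 'rV[R]_(d + symdim d))
  (mS : measurable S) (phi : probability 'rV[R]_(d + symdim d) R).

(* The measurability of S is an argument so that mixture mS is a measure. *)
Definition mixture of measurable S := fun B : set 'rV[R]_d =>
  (\int[phi]_(theta in S) gaussian (mean theta) (cov theta) B)%E.

Let mg B : measurable B -> measurable_fun S
  (fun theta : 'rV[R]_(d + symdim d) => gaussian (mean theta) (cov theta) B).
Proof.
move=> mB; apply: measurable_funTS; apply: measurable_gaussian => // i j.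
  by under eq_fun do rewrite mxE; exact: measurable_coord.
by under eq_fun do rewrite !mxE; exact: measurable_coord.
Qed.

Let mixture0 : mixture mS set0 = 0%E.
Proof. by apply: integral0_eq => theta _; rewrite measure0. Qed.

Let mixture_ge0 B : (0 <= mixture mS B)%E.
Proof. by apply: integral_ge0 => theta _; exact: measure_ge0. Qed.

Let mixture_sigma_additive : semi_sigma_additive (mixture mS).
Proof.
move=> F mF tF mUF; rewrite /mixture.
rewrite (_ : (\int[phi]_(theta in S) _)%E = (\sum_(i <oo)
    \int[phi]_(theta in S) gaussian (mean theta) (cov theta) (F i))%E).
  apply: is_cvg_ereal_nneg_natsum_cond => n _ _.
  by apply: integral_ge0 => theta _; exact: measure_ge0.
rewrite -integral_nneseries//; last by move=> n; exact: mg.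
apply: eq_integral => theta _; apply/esym/cvg_lim => //.
exact: measure_semi_sigma_additive.
Qed.

HB.instance Definition _ := isMeasure.Build _ _ _ (mixture mS)
  mixture0 mixture_ge0 mixture_sigma_additive.

End mixture.

Section transport.
Context (R : realType) (d : nat).
Local Notation mixing := (probability 'rV[R]_(d + symdim d) R).
Local Notation coupling := (probability 'rV[R]_(d + d) R).
Variables (mu : probability 'rV[R]_d R) (S : set 'rV[R]_(d + symdim d)) (mS : measurable S).

(* A point of R^2d is z = (x, y), with x = lsubmx z and y = rsubmx z. An element
   of P(S) is a Borel probability measure on the whole parameter space that
   gives mass 1 to S. *)
Definition cost (lambda : coupling) : \bar R :=
  (\int[lambda]_z (sqnorm (lsubmx z - rsubmx z))%:E)%E.

Definition OT_feasible (phi : mixing) (lambda : coupling) : Prop :=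
  [/\ phi S = 1%E,
      forall B, measurable B ->
        pushforward lambda (@lsubmx R 1 d d) B = mu B &
      forall B, measurable B ->
        pushforward lambda (@rsubmx R 1 d d) B = mixture phi mS B].

Definition MOM_feasible (p : ('I_d -> nat) -> mpoly (d + symdim d) R)
    (phi : mixing) (lambda : coupling) : Prop :=
  phi S = 1%E /\ forall alpha,
  [/\ lambda.-integrable setT (fun z => (monomial alpha (lsubmx z))%:E),
      lambda.-integrable setT (fun z => (monomial alpha (rsubmx z))%:E),
      (\int[lambda]_z (monomial alpha (lsubmx z))%:E =
       \int[mu]_x (monomial alpha x)%:E)%E &
      (\int[lambda]_z (monomial alpha (rsubmx z))%:E =
       \int[phi]_(theta in S) (peval (p alpha) theta)%:E)%E].

Definition value (F : mixing -> coupling -> Prop) : \bar R :=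
  ereal_inf [set c | exists phi lambda, F phi lambda /\ c = cost lambda].

Definition optimal (F : mixing -> coupling -> Prop) (phi : mixing)
    (lambda : coupling) : Prop :=
  F phi lambda /\ cost lambda = value F.

End transport.

(* Main.v *)
(* Existence. Along a minimising sequence of couplings the exponential moments
   are bounded uniformly, because the parameters stay in a compact set, so the
   couplings are tight. No weak compactness theorem is used: each point x of R^n
   is coded by the bits [x_i <= q], q rational; along an ultrafilter the
   probabilities of the words of bits of length N converge to a weight that is
   additive in N, and this weight is realised on [0, 1) with Lebesgue measure by
   cutting the unit interval into subintervals indexed by words. Every point of
   [0, 1) then picks a nested family of words, i.e. a point of a compact cube
   into which R^n has been squashed, and the law of that point is the limit.
   The marginals of the limit are identified by testing against ramps, using the
   continuity of theta |-> \int f dN(theta) on S. The cost is lower semicontinuous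
   since it is the pointwise limit of smaller costs that are continuous on the
   squashed cube (Fatou).

   Determinacy. Two measures with the same moments, one of which has exponential
   moments, give the same value to all the integrals of monomials times
   cos(t.x) and sin(t.x): this propagates from t to t + s for a small step s by
   the Taylor expansion in s.x, whose terms are dominated by exp(k|x|). Functions
   generated by cosines and sines under linear combinations and bounded pointwise
   limits form an algebra that contains the indicators of orthants, so the
   measures agree.

   Consequently the moment constraints of (MOM) force the marginals to be mu and
   the mixture, so that (MOM) and (OT) have the same feasible pairs. *)

Require Import Defs.
From HB Require Import structures.
From mathcomp Require Import all_boot all_order all_algebra.
From mathcomp Require Import -(notations) mpoly.
From mathcomp Require Import all_classical all_reals all_analysis.
From mathcomp Require Import measurable_realfun.
From mathcomp Require Import ring lra.

Set Implicit Arguments.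
Unset Strict Implicit.
Unset Printing Implicit Defensive.

Import Order.TTheory GRing.Theory Num.Theory.
Import numFieldNormedType.Exports.

Local Open Scope classical_set_scope.
Local Open Scope ring_scope.

(** Convergence is tested only on functions continuous up to the boundary of the closed cube,
    because the limit is built on a compact space. The cost has no such extension, hence its
    regularisation; and mass might escape to the faces of the cube, which tightness excludes. A
    single ultrafilter makes the weights of all words converge at once, for mixing measures and
    couplings alike, in place of diagonal extractions. In the determinacy argument the competitor is
    known through its moments alone, so its exponential moments must be derived before anything can
    be dominated: they come from the series of cosh, whose terms are nonnegative monomials. The two
    matrix bounds act separately: [a] keeps the covariances invertible, so that densities are
    continuous in the parameter; [b] gives the common envelope exp(-|x|^2/(4b)). That N(m, Sigma)
    has mass one involves no change of variables: p_0 has degree zero, so it is constant, and it is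
    one at the standard Gaussian. A coupling of zero cost lives on the diagonal; the coupling in
    (ii) is therefore the image of mu under x -> (x, x). *)

Section nonnegative_measurable.
Context d (T : measurableType d) (R : realType).
Local Open Scope ereal_scope.
Import HBNNSimple.

(** The standard machine, for an arbitrary predicate so that it serves both densities and mixtures.
    The zero function has no clause of its own: it is the indicator of the empty set. *)
Lemma ge0_measurable_ind (P : (T -> \bar R) -> Prop) :
  (forall A, measurable A -> P (fun x => (\1_A x)%:E)) ->
  (forall k f, (0 <= k)%R -> measurable_fun setT f -> (forall x, 0 <= f x) ->
    P f -> P (fun x => k%:E * f x)) ->
  (forall f g, measurable_fun setT f -> (forall x, 0 <= f x) ->
    measurable_fun setT g -> (forall x, 0 <= g x) ->
    P f -> P g -> P (fun x => f x + g x)) ->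
  (forall g : nat -> T -> \bar R, (forall n, measurable_fun setT (g n)) ->
    (forall n x, 0 <= g n x) -> (forall x, nondecreasing_seq (g ^~ x)) ->
    (forall n, P (g n)) -> P (fun x => limn (g ^~ x))) ->
  forall f, measurable_fun setT f -> (forall x, 0 <= f x) -> P f.
Proof.
move=> P1 PZ PD Plim f mf f0.
pose g := nnsfun_approx measurableT mf.
have -> : f = fun x => limn (fun n => (g n x)%:E).
  by apply/funext => x; apply/esym/cvg_lim => //; exact: cvg_nnsfun_approx.
apply: (Plim (fun n x => (g n x)%:E)).
- by move=> n; exact/measurable_EFinP.
- by move=> n x; rewrite lee_fin.
- by move=> x m n mn; rewrite lee_fin; exact/lefP/nd_nnsfun_approx.
move=> n.
have -> : (fun x => (g n x)%:E) = fun x => \sum_(k <- finmap.enum_fset (fset_set (range (g n))))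
    ((k%:E * (\1_(g n @^-1` [set k]) x)%:E)).
  apply/funext => x; rewrite fimfunE fsbig_finite//= sumEFin.
  by apply: congr1; apply: eq_bigr.
have ge0 k : k \in finmap.enum_fset (fset_set (range (g n))) -> (0 <= k)%R.
  by rewrite in_fset_set// inE/= => -[x _ <-].
elim: (finmap.enum_fset _) ge0 => [_|k s ih ks].
  rewrite (_ : (fun _ => _) = fun x : T => (\1_(@set0 T) x)%:E); last first.
    by apply/funext => x; rewrite big_nil indic0.
  exact: P1.
rewrite (_ : (fun _ => _) = fun x : T => k%:E * (\1_(g n @^-1` [set k]) x)%:E +
   \sum_(k <- s) k%:E * (\1_(g n @^-1` [set k]) x)%:E); last first.
  by apply/funext => x; rewrite big_cons.
have mk r : measurable_fun setT (fun x => r%:E * (\1_(g n @^-1` [set r]) x)%:E).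
  by apply: measurable_funeM; exact/measurable_EFinP/measurable_indic.
have k0 : (0 <= k)%R by apply: ks; rewrite mem_head.
have s0 r : r \in s -> (0 <= r)%R by move=> rs; apply: ks; rewrite in_cons rs orbT.
apply: PD.
- exact: mk.
- by move=> x; rewrite mule_ge0// lee_fin.
- exact: emeasurable_sum.
- move=> x; rewrite big_seq; apply: sume_ge0 => r rs.
  by rewrite mule_ge0 ?lee_fin// s0.
- apply: PZ => //; first exact/measurable_EFinP/measurable_indic.
  by apply: P1; exact: measurable_funPTI.
- exact: ih.
Qed.

(** Gaussian measures are defined by their values on sets; this carries integrals against them over
    to Lebesgue measure. *)
Lemma ge0_integral_density (m m' : {measure set T -> \bar R}) (h : T -> R) :
  measurable_fun setT h -> (forall x, (0 <= h x)%R) ->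
  (forall B, measurable B -> m' B = \int[m]_(x in B) (h x)%:E) ->
  forall f, measurable_fun setT f -> (forall x, 0 <= f x) ->
  \int[m']_x f x = \int[m]_x (f x * (h x)%:E).
Proof.
move=> mh h0 m'E; have mhE : measurable_fun setT (EFin \o h) by exact/measurable_EFinP.
apply: ge0_measurable_ind.
- move=> A mA; rewrite integral_indic// setIT m'E// [LHS]integral_mkcond.
  apply: eq_integral => x _; rewrite patchE indicE.
  by case: (x \in A); rewrite ?mul1e ?mul0e.
- move=> k f k0 mf f0 fE; rewrite ge0_integralZl// fE -ge0_integralZl//.
  + by apply: eq_integral => x _; rewrite muleA.
  + exact: emeasurable_funM.
  + by move=> x _; rewrite mule_ge0 ?lee_fin.
- move=> f g mf f0 mg g0 fE gE; rewrite ge0_integralD// fE gE -ge0_integralD//.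
  + by apply: eq_integral => x _; rewrite ge0_muleDl.
  + by move=> x _; rewrite mule_ge0 ?lee_fin.
  + exact: emeasurable_funM.
  + by move=> x _; rewrite mule_ge0 ?lee_fin.
  + exact: emeasurable_funM.
- move=> g mg g0 ndg gE; rewrite monotone_convergence//.
  under eq_fun do rewrite gE.
  rewrite -monotone_convergence//.
  + apply: eq_integral => x _.
    rewrite muleC -limeMl//; last exact: ereal_nondecreasing_is_cvgn.
    by congr (limn _); apply/funext => n; rewrite muleC.
  + by move=> n; exact: emeasurable_funM.
  + by move=> n x _; rewrite mule_ge0 ?lee_fin.
  + by move=> x _ a b ab; rewrite lee_wpmul2r ?lee_fin//; exact: ndg.
Qed.

End nonnegative_measurable.

Lemma integral_lincomb d (T : measurableType d) (R : realType)
    (m : {measure set T -> \bar R}) D (I : Type) (r : seq I) (c : I -> R) (h : I -> T -> R) :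
  measurable D -> (forall i, m.-integrable D (EFin \o h i)) ->
  (\int[m]_(x in D) (\sum_(i <- r) c i * h i x)%:E =
   \sum_(i <- r) (c i)%:E * \int[m]_(x in D) (h i x)%:E)%E.
Proof.
move=> mD im; under eq_integral do rewrite -sumEFin.
rewrite integral_sum//.
  by apply: eq_bigr => i _; rewrite -integralZl//; exact: im.
move=> i; rewrite (_ : (fun _ => _) = (fun x => (c i)%:E * (EFin \o h i) x)%E)//.
exact: integrableZl.
Qed.

Section finite_measure_integrals.
Context d (T : measurableType d) (R : realType) (m : {measure set T -> \bar R}).
Hypothesis moo : (m setT < +oo)%E.

Lemma bounded_integrable (f : T -> R) M : measurable_fun setT f ->
  (forall x, `|f x| <= M) -> m.-integrable setT (EFin \o f).
Proof.
move=> mf fM; apply: measurable_bounded_integrable => //.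
exists M; split; first by rewrite num_real.
by move=> M' MM' x _; exact: le_trans (fM x) (ltW MM').
Qed.

Lemma bounded_cvg_integral (f_ : nat -> T -> R) (f : T -> R) M :
  (forall n, measurable_fun setT (f_ n)) -> (forall n x, `|f_ n x| <= M) ->
  (forall x, f_ ^~ x @ \oo --> f x) ->
  (\int[m]_x (f_ n x)%:E @[n --> \oo] --> \int[m]_x (f x)%:E)%E.
Proof.
move=> mf_ fM ff.
apply: (@dominated_cvg _ _ _ m setT measurableT (fun n x => (f_ n x)%:E)
  (EFin \o f) (fun=> M%:E)).
- by move=> n; exact/measurable_EFinP.
- by move=> x _; apply: cvg_EFin; [exact: nearW|exact: ff].
- by [].
- apply: (@bounded_integrable (cst M) `|M|); first exact: measurable_cst.
  by move=> x /=.
- by move=> n x _; rewrite lee_fin.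
Qed.

End finite_measure_integrals.

(** * Orthants as a determining class for Borel measures *)

Section orthants.
Context (R : realType) (n : nat).

Definition orthant (t : 'rV[R]_n) : set 'rV[R]_n := [set x | forall i, x ord0 i <= t ord0 i].

Lemma measurable_orthant t : measurable (orthant t).
Proof.
rewrite (_ : orthant t = \bigcap_(i in [set: 'I_n]) ((fun x : 'rV[R]_n => x ord0 i) @^-1` `]-oo, t ord0 i])).
  apply: fin_bigcap_measurable => // i _; rewrite -[X in measurable X]setTI.
  exact: measurable_coord.
by apply/seteqP; split => [x h i _|x h i]; [|have := h i Logic.I];
  rewrite /= in_itv/=.
Qed.

(** For the hard inclusion it suffices that the identity be measurable from the sigma-algebra of
    orthants, which can be checked one coordinate at a time. *)
Lemma borel_orthants : @measurable _ 'rV[R]_n = <<s range orthant >>.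
Proof.
apply/seteqP; split; last first.
  apply: smallest_sub; first exact: sigma_algebra_measurable.
  by move=> _ [t _ <-]; exact: measurable_orthant.
move=> A mA.
pose T := g_sigma_algebraType (range orthant).
have mid : measurable_fun [set: T] (fun x : T => x : 'rV[R]_n).
  apply: measurable_mxP => i j; rewrite ord1.
  apply: (measurability (@RGenOInfty.G R)); first exact: RGenOInfty.measurableE.
  move=> _ [_ [r ->] <-]; rewrite setTI.
  (* The half-space x_j <= r is the union over k of the orthants with threshold r in coordinate j
     and k in the others. *)
  rewrite (_ : _ @^-1` _ = ~` \bigcup_k
      orthant (\row_l if l == j then r else k%:R)); last first.
    apply/seteqP; split => [x /=|x /=].
      rewrite in_itv/= andbT ltNge => /negP xr [k _ /(_ j)].
      by rewrite mxE eqxx.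
    move=> xk; rewrite in_itv/= andbT ltNge; apply/negP => xr; apply: xk.
    exists (\max_(l < n) Num.bound `|x ord0 l|)%N => // l; rewrite mxE.
    case: eqP => [->//|_].
    apply: (le_trans (ler_norm _)); apply: (le_trans (ltW (archi_boundP _))) => //.
    by rewrite ler_nat (@leq_bigmax _ (fun l => Num.bound `|x ord0 l|) l).
  apply: measurableC; apply: bigcupT_measurable => k.
  by apply: sub_sigma_algebra; exists (\row_l if l == j then r else k%:R).
by have := mid measurableT A mA; rewrite setTI.
Qed.

Lemma eq_measure_orthants (m1 m2 : {measure set 'rV[R]_n -> \bar R}) :
  (m1 setT < +oo)%E -> (forall t, m1 (orthant t) = m2 (orthant t)) ->
  forall B, measurable B -> m1 B = m2 B.
Proof.
move=> m1oo m12; apply: (measure_unique (range orthant)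
    (fun k => orthant (const_mx k%:R))).
- exact: borel_orthants.
- move=> _ _ [t _ <-] [t' _ <-].
  exists (\row_i Order.min (t ord0 i) (t' ord0 i)) => //.
  apply/seteqP; split => [x h|x [h1 h2] i].
    by split => i; have := h i; rewrite mxE le_min => /andP[].
  by rewrite mxE le_min h1 h2.
- by move=> k; exists (const_mx k%:R).
- apply/seteqP; split => // x _.
  exists (\max_(l < n) Num.bound `|x ord0 l|)%N => // l; rewrite mxE.
  apply: (le_trans (ler_norm _)); apply: (le_trans (ltW (archi_boundP _))) => //.
  by rewrite ler_nat (@leq_bigmax _ (fun l => Num.bound `|x ord0 l|) l).
- by move=> _ [t _ <-]; exact: m12.
- move=> k; apply: le_lt_trans m1oo.
  by apply: le_measure; rewrite ?inE//; exact: measurable_orthant.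
Qed.

End orthants.

Lemma cvg_sumr (R : realType) (T : Type) (F : set_system T) (FF : Filter F) (I : Type)
    (r : seq I) (f : I -> T -> R) (l : I -> R) : (forall i, f i t @[t --> F] --> l i) ->
  \sum_(i <- r) f i t @[t --> F] --> \sum_(i <- r) l i.
Proof.
move=> fl; elim: r => [|i r ih].
  by rewrite big_nil; under eq_fun do rewrite big_nil; exact: cvg_cst.
by rewrite big_cons; under eq_fun do rewrite big_cons; apply: cvgD; [exact: fl|exact: ih].
Qed.

Lemma cvg_prodr (R : realType) (T : Type) (F : set_system T) (FF : Filter F) (I : Type)
    (r : seq I) (f : I -> T -> R) (l : I -> R) : (forall i, f i t @[t --> F] --> l i) ->
  \prod_(i <- r) f i t @[t --> F] --> \prod_(i <- r) l i.
Proof.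
move=> fl; elim: r => [|i r ih].
  by rewrite big_nil; under eq_fun do rewrite big_nil; exact: cvg_cst.
by rewrite big_cons; under eq_fun do rewrite big_cons; apply: cvgM; [exact: fl|exact: ih].
Qed.

(** * Measures determined by trigonometric integrals *)

Lemma bernoulli_ineq (R : realDomainType) (x : R) n : -1 <= x -> 1 + n%:R * x <= (1 + x) ^+ n.
Proof.
move=> x1; elim: n => [|n ih]; first by rewrite mul0r addr0 expr0.
have x10 : 0 <= 1 + x by lra.
rewrite exprS; apply: le_trans (ler_wpM2l x10 ih).
have : 0 <= n%:R * x ^+ 2 by rewrite mulr_ge0// sqr_ge0.
rewrite -[n.+1]addn1 natrD; nra.
Qed.

Section step_polynomials.
Context (R : realType).

(* Powers of z <= 1/2 are beaten by 4^m, powers of z > 1/2 beat it; the factor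
   1/(m+1) makes the borderline value z = 1/2 converge as well. *)
Definition step_poly m (z : R) : R := (1 - z ^+ m.*2 / m.+1%:R) ^+ (4 ^ m).

Lemma step_poly_arg m (z : R) : 0 <= z <= 1 -> 0 <= z ^+ m.*2 / m.+1%:R <= 1.
Proof.
move=> /andP[z0 z1]; rewrite divr_ge0 ?exprn_ge0//= ler_pdivrMr// mul1r.
by rewrite (le_trans (exprn_ile1 _ z0 z1))// ler1n.
Qed.

Lemma step_poly01 m (z : R) : 0 <= z <= 1 -> 0 <= step_poly m z <= 1.
Proof.
move=> /(step_poly_arg m) /andP[u0 u1]; rewrite /step_poly.
by rewrite exprn_ge0 ?subr_ge0//= exprn_ile1 ?subr_ge0// gerBl.
Qed.

(** This product of the exponent and the perturbation decides the limit: it is all that Bernoulli's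
    inequality sees, and it is governed by whether 2z exceeds 1. *)
Lemma step_polyN m (z : R) :
  (4 ^ m)%:R * (z ^+ m.*2 / m.+1%:R) = (z *+ 2) ^+ m.*2 / m.+1%:R :> R.
Proof.
rewrite mulrA -[z *+ 2]mulr_natl exprMn; congr (_ * _ / _).
by rewrite -[4%N]/(2 ^ 2)%N -expnM mul2n natrX.
Qed.

Lemma cvg_step_poly_le (z : R) : 0 <= z <= 1 / 2 -> step_poly m z @[m --> \oo] --> (1 : R).
Proof.
move=> /andP[z0 z12]; have z1 : 0 <= z <= 1 by apply/andP; split; lra.
apply: (@squeeze_cvgr _ _ _ _ (fun m => 1 - harmonic m) (cst 1)); last 2 first.
- by rewrite -[X in _ --> X]subr0; apply: cvgB; [exact: cvg_cst|exact: cvg_harmonic].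
- exact: cvg_cst.
apply: nearW => m; have /andP[_ ->] := step_poly01 m z1; rewrite andbT.
have /andP[u0 u1] := step_poly_arg m z1.
apply: le_trans (bernoulli_ineq _ _); last by rewrite lerN2.
rewrite mulrN lerD2l lerN2 step_polyN /harmonic/= -[leRHS]mul1r ler_wpM2r//.
by rewrite exprn_ile1// -mulr_natl; lra.
Qed.

(** Since (1 - u)(1 + u) <= 1, the value is at most (1 + u)^-N <= 1/(N u). With h = 2z - 1 <= 1,
    Bernoulli gives (1 + h)^m >= h(m + 1); squaring and dividing by m + 1 leaves N u >= h^2 (m +
    1). *)
Lemma cvg_step_poly_gt (z : R) : 1 / 2 < z <= 1 -> step_poly m z @[m --> \oo] --> (0 : R).
Proof.
move=> /andP[z12 zle1]; have z1 : 0 <= z <= 1 by apply/andP; split; lra.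
pose h := z *+ 2 - 1; have h0 : 0 < h by rewrite /h -mulr_natl; lra.
have hle1 : h <= 1 by rewrite /h -mulr_natl; lra.
apply: (@squeeze_cvgr _ _ _ _ (cst 0) (fun m => (h ^+ 2)^-1 * harmonic m)); last 2 first.
- exact: cvg_cst.
- by rewrite -[X in _ --> X](mulr0 (h ^+ 2)^-1); apply: cvgM; [exact: cvg_cst|exact: cvg_harmonic].
apply: nearW => m; have /andP[-> _] := step_poly01 m z1; rewrite andTb.
have /andP[u0 u1] := step_poly_arg m z1; rewrite /step_poly.
set u := _ / _ in u0 u1 *; set N := (4 ^ m)%N.
have Nu : h ^+ 2 * m.+1%:R <= N%:R * u.
  have hm : h * m.+1%:R <= (z *+ 2) ^+ m.
    rewrite [z *+ 2](_ : _ = 1 + h); last by rewrite /h addrC subrK.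
    apply: (@le_trans _ _ (1 + m%:R * h)); last first.
      by apply: bernoulli_ineq; lra.
    by rewrite -addn1 natrD mulrDr mulr1 addrC [h * _]mulrC lerD2r.
  rewrite step_polyN ler_pdivlMr// -mulrA -expr2 -exprMn -[m.*2]muln2 exprM.
  by apply: ler_pM => //; rewrite mulr_ge0// ltW.
have hm0 : 0 < h ^+ 2 * m.+1%:R by rewrite mulr_gt0// exprn_gt0.
rewrite -invfM; apply: (@le_trans _ _ ((1 + u) ^+ N)^-1).
  have u10 : 0 < 1 + u by lra.
  rewrite -[leRHS]div1r ler_pdivlMr ?exprn_gt0// -exprMn.
  by apply: exprn_ile1; nra.
rewrite lef_pV2 ?posrE// ?exprn_gt0//; last by lra.
apply: (le_trans Nu); apply: le_trans (bernoulli_ineq _ _); last by lra.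
by rewrite lerDr.
Qed.

End step_polynomials.

Section trigonometric_class.
Context (R : realType) (n : nat).
Implicit Types t x : 'rV[R]_n.

Definition dot t x : R := \sum_i t ord0 i * x ord0 i.

Lemma dotDl t u x : dot (t + u) x = dot t x + dot u x.
Proof. by rewrite -big_split; apply: eq_bigr => i _ /=; rewrite mxE mulrDl. Qed.

Lemma dotZl k t x : dot (k *: t) x = k * dot t x.
Proof. by rewrite mulr_sumr; apply: eq_bigr => i _; rewrite mxE mulrA. Qed.

Lemma dotBl t u x : dot (t - u) x = dot t x - dot u x.
Proof. by rewrite -scaleN1r dotDl dotZl mulN1r. Qed.

Lemma dot_delta k (i : 'I_n) x : dot (k *: delta_mx ord0 i) x = k * x ord0 i.
Proof.
rewrite dotZl; congr (_ * _).
rewrite /dot (bigD1 i)//= mxE !eqxx mul1r big1 ?addr0// => j ji.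
by rewrite mxE (negbTE ji) andbF mul0r.
Qed.

Lemma measurable_dot t : measurable_fun setT (dot t).
Proof.
apply: measurable_sum => i; apply: measurable_funM => //.
exact: measurable_coord.
Qed.

(** Each constructor preserves equality of integrals against two finite measures, [trig_lim] by
    dominated convergence. Products are deliberately not a constructor, since such an equality does
    not pass to products; closure under them is proved below. *)
Inductive trig_class : ('rV[R]_n -> R) -> Prop :=
| trig_cos t : trig_class (fun x => cos (dot t x))
| trig_sin t : trig_class (fun x => sin (dot t x))
| trig_add f g : trig_class f -> trig_class g -> trig_class (fun x => f x + g x)
| trig_scale k f : trig_class f -> trig_class (fun x => k * f x)
| trig_lim (f_ : nat -> 'rV[R]_n -> R) f M : (forall k, trig_class (f_ k)) ->
    (forall k x, `|f_ k x| <= M) -> (forall x, f_ ^~ x @ \oo --> f x) ->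
    trig_class f.

Lemma trig_ext f g : trig_class f -> f =1 g -> trig_class g.
Proof. by move=> Tf /funext <-. Qed.

Lemma trig_measurable f : trig_class f -> measurable_fun setT f.
Proof.
elim=> {f} [t|t|f g _ mf _ mg|k f _ mf|f_ f M _ mf _ ff].
- apply: (measurableT_comp (f := @cos R)) (measurable_dot t).
  by apply: continuous_measurable_fun; exact: continuous_cos.
- apply: (measurableT_comp (f := @sin R)) (measurable_dot t).
  by apply: continuous_measurable_fun; exact: continuous_sin.
- exact: measurable_funD.
- exact: measurable_funM.
- by apply: (measurable_fun_cvg mf) => x _; exact: ff.
Qed.

Lemma trig_bounded f : trig_class f -> exists M, forall x, `|f x| <= M.
Proof.
elim=> {f} [t|t|f g _ [M fM] _ [N gN]|k f _ [M fM]|f_ f M _ _ fM ff].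
- by exists 1 => x; rewrite ler_norml cos_geN1 cos_le1.
- by exists 1 => x; rewrite ler_norml sin_geN1 sin_le1.
- by exists (M + N) => x; rewrite (le_trans (ler_normD _ _))// lerD.
- by exists (`|k| * M) => x; rewrite normrM ler_wpM2l.
- exists M => x.
  have nf : `|f_ k x| @[k --> \oo] --> `|f x| by apply: cvg_norm; exact: ff.
  rewrite -(cvg_lim _ nf)//; apply: limr_le; last by apply: nearW => k; exact: fM.
  by apply/cvg_ex; exists `|f x|.
Qed.

(** Product-to-sum formulas settle the generators. The limit case survives because cosine and sine
    are bounded by 1, so the bound M is kept. *)
Lemma trig_basic_mul t f : trig_class f ->
  trig_class (fun x => cos (dot t x) * f x) /\
  trig_class (fun x => sin (dot t x) * f x).
Proof.
elim=> {f} [u|u|f g _ [cf sf] _ [cg sg]|k f _ [cf sf]|f_ f M _ csf fM ff].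
- split; [apply: trig_ext (trig_scale (1 / 2)
      (trig_add (trig_cos (t + u)) (trig_cos (t - u)))) _ => x|
    apply: trig_ext (trig_scale (1 / 2)
      (trig_add (trig_sin (t + u)) (trig_sin (t - u)))) _ => x];
  rewrite /= dotBl dotDl ?cosD ?sinD cosN sinN; by field.
- split; [apply: trig_ext (trig_scale (1 / 2)
      (trig_add (trig_sin (t + u)) (trig_scale (-1) (trig_sin (t - u))))) _ => x|
    apply: trig_ext (trig_scale (1 / 2)
      (trig_add (trig_cos (t - u)) (trig_scale (-1) (trig_cos (t + u))))) _ => x];
  rewrite /= dotBl dotDl ?cosD ?sinD cosN sinN; by field.
- by split; [apply: trig_ext (trig_add cf cg) _|apply: trig_ext (trig_add sf sg) _];
    move=> x; rewrite mulrDr.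
- by split; [apply: trig_ext (trig_scale k cf) _|apply: trig_ext (trig_scale k sf) _];
    move=> x; rewrite mulrCA.
- have M0 : 0 <= M by apply: le_trans (fM 0%N 0).
  split; [apply: (@trig_lim (fun k x => cos (dot t x) * f_ k x) _ M)|
          apply: (@trig_lim (fun k x => sin (dot t x) * f_ k x) _ M)].
  + by move=> k; have [] := csf k.
  + move=> k x; rewrite normrM -[leRHS]mul1r ler_pM//.
    by rewrite ler_norml cos_geN1 cos_le1.
  + by move=> x; apply: cvgM; [exact: cvg_cst|exact: ff].
  + by move=> k; have [] := csf k.
  + move=> k x; rewrite normrM -[leRHS]mul1r ler_pM//.
    by rewrite ler_norml sin_geN1 sin_le1.
  + by move=> x; apply: cvgM; [exact: cvg_cst|exact: ff].
Qed.

Lemma trig_mul f g : trig_class f -> trig_class g -> trig_class (fun x => f x * g x).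
Proof.
move=> + Tg; have [N gN] := trig_bounded Tg.
elim=> {f} [t|t|f f' _ Tfg _ Tfg'|k f _ Tfg|f_ f M _ Tfg fM ff].
- by have [] := trig_basic_mul t Tg.
- by have [] := trig_basic_mul t Tg.
- by apply: trig_ext (trig_add Tfg Tfg') _ => x; rewrite mulrDl.
- by apply: trig_ext (trig_scale k Tfg) _ => x; rewrite mulrA.
- apply: (@trig_lim (fun k x => f_ k x * g x) _ (M * N)) => //.
  + by move=> k x; rewrite normrM ler_pM.
  + by move=> x; apply: cvgM; [exact: ff|exact: cvg_cst].
Qed.

Lemma trig_cst c : trig_class (fun=> c).
Proof.
apply: trig_ext (trig_scale c (trig_cos 0)) _ => x.
by rewrite -[0](scale0r 0) dotZl mul0r cos0 mulr1.
Qed.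

Lemma trig_exp f k : trig_class f -> trig_class (fun x => f x ^+ k).
Proof.
move=> Tf; elim: k => [|k ih]; first by apply: trig_ext (trig_cst 1) _.
by apply: trig_ext (trig_mul Tf ih) _ => x; rewrite exprS.
Qed.

Lemma trig_step f (s : R) : trig_class f -> (forall x, -1 <= f x <= 1) -> -1 <= s <= 1 ->
  trig_class (fun x => (f x <= s)%R%:R).
Proof.
(* As |f - s| <= 2, this affine map sends f into [0, 1], with f <= s exactly when z <= 1/2, the
   threshold of the step polynomials. *)
move=> Tf f1 s1; pose z x := 1 / 2 + (f x - s) / 4.
have z01 x : 0 <= z x <= 1.
  by have /andP[? ?] := f1 x; case/andP: s1 => ? ?; apply/andP; rewrite /z; lra.
apply: (@trig_lim (fun m x => step_poly m (z x)) _ 1).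
- move=> m; apply: trig_exp.
  apply: trig_ext (trig_add (trig_cst 1) (trig_scale (- m.+1%:R^-1)
    (trig_exp m.*2 (trig_add (trig_cst (1 / 2 - s / 4)) (trig_scale (4^-1) Tf))))) _.
  move=> x; rewrite mulNr [_ * (_ ^+ _)]mulrC /z; congr (1 - _ ^+ _ / _); by field.
- by move=> m x; have /andP[? ?] := step_poly01 m (z01 x); rewrite ger0_norm.
- move=> x; have /andP[z0 z1] := z01 x; case: (leP (f x) s) => fs.
    by apply: cvg_step_poly_le; rewrite z0/= /z; lra.
  by apply: cvg_step_poly_gt; rewrite z1 andbT /z; lra.
Qed.

(** A coordinate is unbounded, so it is compared through sin(x_i / (k+1)). Once k is large, both x_i
    / (k+1) and c / (k+1) lie in [-1, 1], where sine is increasing, and the comparison is the right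
    one from then on. *)
Lemma trig_halfspace (i : 'I_n) (c : R) : trig_class (fun x => (x ord0 i <= c)%R%:R).
Proof.
apply: (@trig_lim (fun k x => (sin (k.+1%:R^-1 * x ord0 i) <= sin (k.+1%:R^-1 * c))%R%:R) _ 1).
- move=> k; apply: trig_step; last by rewrite sin_geN1 sin_le1.
    by apply: trig_ext (trig_sin (k.+1%:R^-1 *: delta_mx ord0 i)) _ => x; rewrite dot_delta.
  by move=> x; rewrite sin_geN1 sin_le1.
- by move=> k x; rewrite normr_nat lern1 leq_b1.
- move=> x; apply: cvg_near_cst; pose K := Num.bound (`|x ord0 i| + `|c|).
  exists K => // k /= Kk.
  have b : `|x ord0 i| + `|c| <= k.+1%:R.
    apply: le_trans (ltW (archi_boundP _)) _; first by rewrite addr_ge0.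
    by rewrite ler_nat leqW.
  have hyp (y : R) : `|y| <= k.+1%:R -> k.+1%:R^-1 * y \in `[- (pi / 2), pi / 2].
    move=> yk; have : `|k.+1%:R^-1 * y| <= 1.
      by rewrite normrM gtr0_norm ?invr_gt0// mulrC ler_pdivrMr// mul1r.
    have := pi_ge2 R.
    move: (_ * y) => u.
    by rewrite ler_norml in_itv/= => ? /andP[? ?]; apply/andP; split; lra.
  rewrite leNgt ltr_sin ?hyp//.
  - by rewrite -leNgt ler_pM2l// invr_gt0.
  - by apply: le_trans b; rewrite ?lerDl ?lerDr.
  - by apply: le_trans b; rewrite ?lerDl ?lerDr.
Qed.

Lemma trig_orthant t : trig_class (\1_(orthant t)).
Proof.
have T s : trig_class (fun x => \prod_(i <- s) (x ord0 i <= t ord0 i)%R%:R).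
  elim: s => [|i s ih]; first by apply: trig_ext (trig_cst 1) _ => x; rewrite big_nil.
  by apply: trig_ext (trig_mul (trig_halfspace i (t ord0 i)) ih) _ => x; rewrite big_cons.
apply: trig_ext (T (index_enum 'I_n)) _ => x; rewrite indicE.
have [|] := boolP (x \in orthant t); rewrite ?inE ?notin_setE => h.
  by rewrite big1// => i _; rewrite h.
have /existsNP[i /negP xi] : ~ forall i, x ord0 i <= t ord0 i by [].
by rewrite (bigD1 i)//= (negbTE xi) mul0r.
Qed.

Variables (m1 m2 : {measure set 'rV[R]_n -> \bar R}).
Hypotheses (m1oo : (m1 setT < +oo)%E) (m2oo : (m2 setT < +oo)%E).
Hypothesis eq_cos : forall t,
  (\int[m1]_x (cos (dot t x))%:E = \int[m2]_x (cos (dot t x))%:E)%E.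
Hypothesis eq_sin : forall t,
  (\int[m1]_x (sin (dot t x))%:E = \int[m2]_x (sin (dot t x))%:E)%E.

Lemma trig_class_integral f : trig_class f ->
  (\int[m1]_x (f x)%:E = \int[m2]_x (f x)%:E)%E.
Proof.
have int (m : {measure set 'rV[R]_n -> \bar R}) f' : (m setT < +oo)%E -> trig_class f' ->
    m.-integrable setT (EFin \o f').
  move=> moo Tf'; have [M fM] := trig_bounded Tf'.
  exact: (bounded_integrable moo (trig_measurable Tf') fM).
elim=> {f} [t|t|f g Tf Ef Tg Eg|k f Tf Ef|f_ f M Tf Ef fM ff].
- exact: eq_cos.
- exact: eq_sin.
- under eq_integral do rewrite EFinD; under [RHS]eq_integral do rewrite EFinD.
  by rewrite !integralD ?Ef ?Eg//; exact: int.
- under eq_integral do rewrite EFinM; under [RHS]eq_integral do rewrite EFinM.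
  by rewrite !integralZl ?Ef//; exact: int.
- have mf k := trig_measurable (Tf k).
  have /cvg_lim <-// := bounded_cvg_integral m1oo mf fM ff.
  have /cvg_lim <-// := bounded_cvg_integral m2oo mf fM ff.
  by congr (limn _); apply/funext => k; exact: Ef.
Qed.

Lemma trig_measure_unique B : measurable B -> m1 B = m2 B.
Proof.
apply: eq_measure_orthants => // t.
have mt := @measurable_orthant R n t.
by have := trig_class_integral (trig_orthant t); rewrite !integral_indic// !setIT.
Qed.

End trigonometric_class.

(** * Exponential moments and determinacy *)

Section exponential_moments.
Context (R : realType) (n : nat).
Implicit Types (x : 'rV[R]_n) (nu : {measure set 'rV[R]_n -> \bar R}).

Definition l1norm x : R := \sum_i `|x ord0 i|.

Lemma l1norm_ge0 x : 0 <= l1norm x.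
Proof. by apply: sumr_ge0. Qed.

Lemma measurable_l1norm : measurable_fun setT l1norm.
Proof.
apply: measurable_sum => i; apply: (measurableT_comp (f := @Num.norm _ R)) => //.
exact: measurable_coord.
Qed.

Lemma measurable_exp_l1norm (k : R) : measurable_fun setT (fun x => expR (k * l1norm x)).
Proof.
apply: (measurableT_comp (f := @expR R)) => //.
by apply: measurable_funM => //; exact: measurable_l1norm.
Qed.

Lemma measurable_monomial (alpha : 'I_n -> nat) : measurable_fun setT (@monomial R n alpha).
Proof.
apply: measurable_prod => i _; apply: measurable_funX.
exact: measurable_coord.
Qed.

(** Some coordinate carries at least the fraction 1/(n+1) of the norm, unless the norm is zero; the
    summand 1 covers that case. Taking n+1 instead of n keeps the quotient meaningful when n = 0. *)
Lemma expR_l1norm_le (c : R) x : 0 <= c ->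
  expR (c / n.+1%:R * l1norm x) <= 1 + \sum_i expR (c * `|x ord0 i|).
Proof.
move=> c0.
have [/existsP[i xi]|/existsPn xi] := boolP [exists i : 'I_n, l1norm x <= n.+1%:R * `|x ord0 i|].
  rewrite (bigD1 i)//= addrCA -[leLHS]addr0; apply: lerD.
    by rewrite ler_expR -mulrA ler_wpM2l// ler_pdivrMl.
  by rewrite addr_ge0// sumr_ge0// => j _; exact: expR_ge0.
have l0 : l1norm x = 0.
  apply/eqP; rewrite eq_le l1norm_ge0 andbT.
  have : \sum_(i < n) n.+1%:R * `|x ord0 i| <= \sum_(i < n) l1norm x.
    by apply: ler_sum => i _; rewrite ltW// ltNge.
  rewrite -mulr_sumr sumr_const card_ord -[leRHS]mulr_natl -/(l1norm x).
  by rewrite -natr1 mulrDl mul1r -[leRHS]addr0 lerD2l.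
rewrite l0 mulr0 expR0 lerDl sumr_ge0// => i _; exact: expR_ge0.
Qed.

Lemma normr_exp_le (y : R) k : `|y| ^+ k <= k`!%:R * expR `|y|.
Proof.
have kf0 : 0 < k`!%:R :> R by rewrite ltr0n fact_gt0.
case: k kf0 => [|k] kf0.
  by rewrite expr0 fact0 mul1r -expR0 ler_expR.
rewrite mulrC -ler_pdivrMr//; apply: le_trans (expR_ge1Dxn k (normr_ge0 y)).
by rewrite lerDr.
Qed.

Lemma monomial_le (alpha : 'I_n -> nat) (k : R) : 0 < k ->
  exists2 C, 0 <= C & forall x, `|monomial alpha x| <= C * expR (k * l1norm x).
Proof.
move=> k0; exists (\prod_i ((alpha i)`!%:R / k ^+ alpha i)).
  by apply: prodr_ge0 => i _; rewrite divr_ge0// exprn_ge0// ltW.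
move=> x; rewrite /monomial normr_prod /l1norm mulr_sumr expR_sum -big_split/=.
apply: ler_prod => i _; rewrite normr_ge0/= normrX.
rewrite mulrAC ler_pdivlMr ?exprn_gt0// -exprMn mulrC.
rewrite -(gtr0_norm k0) -normrM.
exact: normr_exp_le.
Qed.

Definition exp_moments (c : R) nu :=
  forall i : 'I_n, (\int[nu]_x (expR (c * `|x ord0 i|))%:E < +oo)%E.

Lemma measurable_exp_coord (c : R) (i : 'I_n) :
  measurable_fun setT (fun x => expR (c * `|x ord0 i|)).
Proof.
apply: (measurableT_comp (f := @expR R)) => //.
apply: measurable_funM => //; apply: (measurableT_comp (f := @Num.norm _ R)) => //.
exact: measurable_coord.
Qed.

Lemma exp_moments_integrable c nu : 0 <= c -> (nu setT < +oo)%E -> exp_moments c nu ->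
  nu.-integrable setT (fun x => (expR (c / n.+1%:R * l1norm x))%:E).
Proof.
move=> c0 nuoo nuc.
apply: (@le_integrable _ _ _ nu setT measurableT _
  (fun x => 1%:E + \sum_(i < n) (expR (c * `|x ord0 i|))%:E)%E).
- by apply/measurable_EFinP; exact: measurable_exp_l1norm.
- move=> x _; rewrite /= sumEFin -EFinD !lee_fin !ger0_norm ?expR_ge0//.
    exact: expR_l1norm_le.
  by rewrite addr_ge0// sumr_ge0// => i _; exact: expR_ge0.
apply: integrableD => //.
  by apply: (@bounded_integrable _ _ _ nu nuoo (cst 1) 1) => // x; rewrite normr1.
apply: integrable_sum => // i _; apply/integrableP; split.
  by apply/measurable_EFinP; exact: measurable_exp_coord.
under eq_integral do rewrite /= ger0_norm ?expR_ge0//.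
exact: nuc.
Qed.

Lemma monomial_integrable k nu (alpha : 'I_n -> nat) : 0 < k ->
  nu.-integrable setT (fun x => (expR (k * l1norm x))%:E) ->
  nu.-integrable setT (EFin \o monomial alpha).
Proof.
move=> k0 ik; have [C C0 aC] := monomial_le alpha k0.
apply: (@le_integrable _ _ _ nu setT measurableT _
  (fun x => C%:E * (expR (k * l1norm x))%:E)%E).
- by apply/measurable_EFinP; exact: measurable_monomial.
- move=> x _; rewrite /= lee_fin (le_trans (aC x))//.
  by rewrite [leRHS]ger0_norm// mulr_ge0// expR_ge0.
- exact: integrableZl.
Qed.

End exponential_moments.

Section same_moments.
Context (R : realType) (n : nat) (m1 m2 : {measure set 'rV[R]_n -> \bar R}).
Implicit Types x s t : 'rV[R]_n.
Variable k : R.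
Hypothesis k_gt0 : 0 < k.
Hypothesis int1 : m1.-integrable setT (fun x => (expR (k * l1norm x) * expR (k * l1norm x))%:E).
Hypothesis int2 : m2.-integrable setT (fun x => (expR (k * l1norm x) * expR (k * l1norm x))%:E).
Hypothesis eq_moments : forall alpha,
  (\int[m1]_x (monomial alpha x)%:E = \int[m2]_x (monomial alpha x)%:E)%E.

(** The square of [E] is assumed integrable because one factor dominates the monomial and the other
    the Taylor partial sums in [dot s x]. *)
Let E x := expR (k * l1norm x).

Let dominated (f : 'rV[R]_n -> R) := measurable_fun setT f /\
  exists2 C, 0 <= C & forall x, `|f x| <= C * (E x * E x).

Let dominated_integrable f : dominated f ->
  m1.-integrable setT (EFin \o f) /\ m2.-integrable setT (EFin \o f).
Proof.
move=> [mf [C C0 fC]]; have dom (m : {measure set 'rV[R]_n -> \bar R}) :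
  m.-integrable setT (fun x => (E x * E x)%:E) -> m.-integrable setT (EFin \o f).
  move=> im; apply: (@le_integrable _ _ _ m setT measurableT _
    (fun x => C%:E * (E x * E x)%:E)%E).
  - exact/measurable_EFinP.
  - move=> x _; rewrite /= lee_fin (le_trans (fC x))//.
    by rewrite [leRHS]ger0_norm// !mulr_ge0// expR_ge0.
  - exact: integrableZl.
by split; apply: dom.
Qed.

(** Quantifying over all monomials makes this stable under multiplication by [dot s x]: the product
    is a linear combination of monomials with one exponent raised by one. *)
Let same (f : 'rV[R]_n -> R) := forall alpha,
  (\int[m1]_x (monomial alpha x * f x)%:E = \int[m2]_x (monomial alpha x * f x)%:E)%E.

Let E_ge1 x : 1 <= E x.
Proof. by rewrite -expR0 ler_expR mulr_ge0 ?l1norm_ge0// ltW. Qed.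

Let dominated_bounded alpha (f g : 'rV[R]_n -> R) (C : R) : 0 <= C ->
  measurable_fun setT f -> measurable_fun setT g ->
  (forall x, `|f x| <= 1) -> (forall x, `|g x| <= C * E x) ->
  dominated (fun x => monomial alpha x * (f x * g x)).
Proof.
move=> C0 mf mg f1 gE; have [D D0 aD] := monomial_le (R := R) alpha k_gt0.
split; first by apply: measurable_funM; [exact: measurable_monomial|exact: measurable_funM].
exists (D * C) => [|x]; first exact: mulr_ge0.
rewrite !normrM mulrACA; apply: ler_pM; rewrite ?mulr_ge0//.
by rewrite -[leRHS]mul1r ler_pM.
Qed.

Let same_lincomb (I : Type) (r : seq I) (c : I -> R) (h : I -> 'rV[R]_n -> R) :
  (forall i, dominated (h i)) ->
  (forall i, \int[m1]_x (h i x)%:E = \int[m2]_x (h i x)%:E)%E ->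
  (\int[m1]_x (\sum_(i <- r) c i * h i x)%:E =
   \int[m2]_x (\sum_(i <- r) c i * h i x)%:E)%E.
Proof.
move=> dh eh.
rewrite !integral_lincomb//.
- by apply: eq_bigr => i _; rewrite eh.
- by move=> i; have [] := dominated_integrable (dh i).
- by move=> i; have [] := dominated_integrable (dh i).
Qed.

Section step.
Variables (f : 'rV[R]_n -> R) (s : 'rV[R]_n).
Hypothesis mf : measurable_fun setT f.
Hypothesis f1 : forall x, `|f x| <= 1.
Hypothesis sk : forall x, `|dot s x| <= k * l1norm x.

Let dotX_le j x : `|dot s x ^+ j| <= j`!%:R * E x.
Proof.
rewrite normrX (le_trans (normr_exp_le _ _))// ler_wpM2l// ler_expR.
exact: sk.
Qed.

Let mdotX j : measurable_fun setT (fun x => dot s x ^+ j).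
Proof. by apply: measurable_funX; exact: measurable_dot. Qed.

Let dom_dotX alpha j : dominated (fun x => monomial alpha x * (f x * dot s x ^+ j)).
Proof. exact: dominated_bounded (dotX_le j). Qed.

Lemma same_dotX : same f -> forall j, same (fun x => f x * dot s x ^+ j).
Proof.
move=> sf; elim=> [|j ih] alpha.
  under eq_integral do rewrite expr0 mulr1.
  by under [RHS]eq_integral do rewrite expr0 mulr1.
pose alphaS i := fun l => (alpha l + (l == i))%N.
have aS x : monomial alpha x * (f x * dot s x ^+ j.+1) =
    \sum_i s ord0 i * (monomial (alphaS i) x * (f x * dot s x ^+ j)).
  rewrite exprS {1}/dot mulrCA mulrA mulrC !mulr_suml; apply: eq_bigr => i _.
  have -> : monomial (alphaS i) x = monomial alpha x * x ord0 i.
    rewrite /monomial (bigD1 i)//= [in RHS](bigD1 i)//= /alphaS eqxx exprD expr1.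
    rewrite -!mulrA [x ord0 i * _]mulrC; congr (_ * (_ * _)); apply: eq_bigr => l li.
    by rewrite (negbTE li) addn0.
  ring.
under eq_integral do rewrite aS; under [RHS]eq_integral do rewrite aS.
by apply: same_lincomb => i; [exact: dom_dotX|exact: ih].
Qed.

Variables (a : nat -> R) (g : R -> R).
Hypothesis a_le : forall j, `|a j| <= (j`!%:R)^-1.
Hypothesis ag : forall y, series (fun j => a j * y ^+ j) N @[N --> \oo] --> g y.

(** The bound on [a] keeps every partial sum below exp |dot s x| <= E, so dominated convergence
    applies. The bounded factor [f] holds the phase already reached, and [g] the next increment. *)
Lemma same_series : same f -> same (fun x => f x * g (dot s x)).
Proof.
move=> sf alpha; pose G N x := \sum_(0 <= j < N) a j * dot s x ^+ j.
have mG N : measurable_fun setT (G N).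
  by apply: measurable_sum => j; apply: measurable_funM.
have GE N x : `|G N x| <= 1 * E x.
  rewrite mul1r; apply: (le_trans (ler_norm_sum _ _ _)).
  apply: (@le_trans _ _ (series (exp_coeff `|dot s x|) N)).
    rewrite /series/=; apply: ler_sum => j _; rewrite normrM normrX mulrC.
    by rewrite ler_wpM2l// exprn_ge0.
  apply: (@le_trans _ _ (expR `|dot s x|)); last by rewrite ler_expR.
  apply: nondecreasing_cvgn_le; last exact: is_cvg_series_exp_coeff.
  by apply: nondecreasing_series => j _ _; exact: exp_coeff_ge0.
have dG N : dominated (fun x => monomial alpha x * (f x * G N x)).
  by apply: (@dominated_bounded alpha f (G N) 1).
have eqG N : (\int[m1]_x (monomial alpha x * (f x * G N x))%:E =
    \int[m2]_x (monomial alpha x * (f x * G N x))%:E)%E.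
  have aS x : monomial alpha x * (f x * G N x) =
      \sum_(0 <= j < N) a j * (monomial alpha x * (f x * dot s x ^+ j)).
    by rewrite !mulr_sumr; apply: eq_bigr => j _; ring.
  under eq_integral do rewrite aS; under [RHS]eq_integral do rewrite aS.
  by apply: same_lincomb => j; [exact: dom_dotX|exact: same_dotX].
have [D D0 aD] := monomial_le (R := R) alpha k_gt0.
have cvgG (m : {measure set 'rV[R]_n -> \bar R}) :
    m.-integrable setT (fun x => (E x * E x)%:E) ->
    (\int[m]_x (monomial alpha x * (f x * G N x))%:E @[N --> \oo] -->
     \int[m]_x (monomial alpha x * (f x * g (dot s x)))%:E)%E.
  move=> im; apply: (@dominated_cvg _ _ _ m setT measurableT
      (fun N x => (monomial alpha x * (f x * G N x))%:E)
      (fun x => (monomial alpha x * (f x * g (dot s x)))%:E)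
      (fun x => D%:E * (E x * E x)%:E)%E).
  - by move=> N; apply/measurable_EFinP; have [] := dG N.
  - move=> x _; apply: cvg_EFin; first exact: nearW.
    apply: cvgM; first exact: cvg_cst.
    by apply: cvgM; [exact: cvg_cst|exact: ag].
  - by [].
  - exact: integrableZl.
  - move=> N x _; rewrite lee_fin !normrM.
    rewrite (_ : D * (E x * E x) = D * E x * (1 * E x)); last by ring.
    apply: ler_pM; rewrite ?mulr_ge0//.
    by rewrite -[leRHS]mul1r; apply: ler_pM.
have /cvg_lim <-// := cvgG m1 int1; have /cvg_lim <-// := cvgG m2 int2.
by congr (limn _); apply/funext.
Qed.

End step.

(** Domination limits the size of one phase increment [dot s x], but not the number of increments.
    Cosine and sine are carried together because the addition formulas mix them. *)
Lemma same_dot_trig s : (forall x, `|dot s x| <= k * l1norm x) -> forall N : nat,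
  same (fun x => cos (N%:R * dot s x)) /\ same (fun x => sin (N%:R * dot s x)).
Proof.
move=> sk; elim=> [|N [sc ss]].
  split=> alpha.
    under eq_integral do rewrite mul0r cos0 mulr1.
    by under [RHS]eq_integral do rewrite mul0r cos0 mulr1.
  under eq_integral do rewrite mul0r sin0 mulr0.
  by under [RHS]eq_integral do rewrite mul0r sin0 mulr0; rewrite !integral0.
have mcos : measurable_fun setT (fun x : 'rV[R]_n => cos (N%:R * dot s x)).
  apply: (measurableT_comp (f := @cos R)).
    by apply: continuous_measurable_fun; exact: continuous_cos.
  by apply: measurable_funM => //; exact: measurable_dot.
have msin : measurable_fun setT (fun x : 'rV[R]_n => sin (N%:R * dot s x)).
  apply: (measurableT_comp (f := @sin R)).
    by apply: continuous_measurable_fun; exact: continuous_sin.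
  by apply: measurable_funM => //; exact: measurable_dot.
have c1 (y : R) : `|cos y| <= 1 by rewrite ler_norml cos_geN1 cos_le1.
have s1 (y : R) : `|sin y| <= 1 by rewrite ler_norml sin_geN1 sin_le1.
pose ac j : R := (~~ odd j)%:R * (-1) ^+ j./2 / j`!%:R.
pose as_ j : R := (odd j)%:R * (-1) ^+ j.-1./2 / j`!%:R.
have le_ac j : `|ac j| <= (j`!%:R)^-1.
  rewrite !normrM normfV !normr_nat normrX normrN normr1 expr1n mulr1.
  by case: odd; rewrite /= ?mul0r ?mul1r.
have le_as j : `|as_ j| <= (j`!%:R)^-1.
  rewrite !normrM normfV !normr_nat normrX normrN normr1 expr1n mulr1.
  by case: odd; rewrite /= ?mul0r ?mul1r.
have cvg_ac y : series (fun j => ac j * y ^+ j) J @[J --> \oo] --> cos y.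
  have -> : (fun j => ac j * y ^+ j) = cos_coeff y.
    by apply/funext => j; rewrite /ac mulrAC.
  by rewrite unlock; exact: is_cvg_series_cos_coeff.
have cvg_as y : series (fun j => as_ j * y ^+ j) J @[J --> \oo] --> sin y.
  have -> : (fun j => as_ j * y ^+ j) = sin_coeff y.
    by apply/funext => j; rewrite /as_ mulrAC.
  by rewrite unlock; exact: is_cvg_series_sin_coeff.
have cc := @same_series _ s mcos (fun x => c1 _) sk ac _ le_ac cvg_ac sc.
have cs := @same_series _ s mcos (fun x => c1 _) sk as_ _ le_as cvg_as sc.
have sc' := @same_series _ s msin (fun x => s1 _) sk ac _ le_ac cvg_ac ss.
have ss' := @same_series _ s msin (fun x => s1 _) sk as_ _ le_as cvg_as ss.
have E1 x : 1 <= 1 * E x by rewrite mul1r.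
have mc : measurable_fun setT (fun x : 'rV[R]_n => cos (dot s x)).
  apply: (measurableT_comp (f := @cos R)) (measurable_dot s).
  by apply: continuous_measurable_fun; exact: continuous_cos.
have ms : measurable_fun setT (fun x : 'rV[R]_n => sin (dot s x)).
  apply: (measurableT_comp (f := @sin R)) (measurable_dot s).
  by apply: continuous_measurable_fun; exact: continuous_sin.
have domi (u v : 'rV[R]_n -> R) alpha : measurable_fun setT u -> measurable_fun setT v ->
    (forall x, `|u x| <= 1) -> (forall x, `|v x| <= 1) ->
    m1.-integrable setT (EFin \o (fun x => monomial alpha x * (u x * v x))) /\
    m2.-integrable setT (EFin \o (fun x => monomial alpha x * (u x * v x))).
  move=> mu mv u1 v1; apply: dominated_integrable.
  by apply: (@dominated_bounded alpha u v 1) => // x; exact: le_trans (E1 x).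
split=> alpha.
  have Ec x : monomial alpha x * cos (N.+1%:R * dot s x) =
      monomial alpha x * (cos (N%:R * dot s x) * cos (dot s x)) -
      monomial alpha x * (sin (N%:R * dot s x) * sin (dot s x)).
    by rewrite -natr1 mulrDl mul1r cosD mulrBr.
  under eq_integral do rewrite Ec EFinB; under [RHS]eq_integral do rewrite Ec EFinB.
  have [i1 i2] := domi _ _ alpha mcos mc (fun=> c1 _) (fun=> c1 _).
  have [i3 i4] := domi _ _ alpha msin ms (fun=> s1 _) (fun=> s1 _).
  by rewrite !integralB// cc ss'.
have Ec x : monomial alpha x * sin (N.+1%:R * dot s x) =
    monomial alpha x * (sin (N%:R * dot s x) * cos (dot s x)) +
    monomial alpha x * (cos (N%:R * dot s x) * sin (dot s x)).
  by rewrite -natr1 mulrDl mul1r sinD mulrDr.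
under eq_integral do rewrite Ec EFinD; under [RHS]eq_integral do rewrite Ec EFinD.
have [i1 i2] := domi _ _ alpha msin mc (fun=> s1 _) (fun=> c1 _).
have [i3 i4] := domi _ _ alpha mcos ms (fun=> c1 _) (fun=> s1 _).
by rewrite !integralD// sc' cs.
Qed.

Lemma same_moments_trig t :
  (\int[m1]_x (cos (dot t x))%:E = \int[m2]_x (cos (dot t x))%:E)%E /\
  (\int[m1]_x (sin (dot t x))%:E = \int[m2]_x (sin (dot t x))%:E)%E.
Proof.
(* Enough increments for t / (N+1) to satisfy the smallness condition, since |dot t x| <= l1norm t *
   l1norm x. *)
pose N := Num.bound (l1norm t / k).
have tN : l1norm t <= k * N.+1%:R.
  rewrite mulrC -ler_pdivrMr//; apply: (le_trans (ltW (archi_boundP _))).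
    by rewrite divr_ge0// ?l1norm_ge0// ltW.
  by rewrite ler_nat.
pose s := N.+1%:R^-1 *: t.
have tE x : N.+1%:R * dot s x = dot t x by rewrite dotZl mulrA mulfV// mul1r.
have sk x : `|dot s x| <= k * l1norm x.
  rewrite dotZl normrM gtr0_norm ?invr_gt0// mulrC ler_pdivrMr// mulrAC mulrC.
  apply: (@le_trans _ _ (l1norm x * l1norm t)); last by rewrite ler_wpM2l// ?l1norm_ge0.
  apply: (le_trans (ler_norm_sum _ _ _)); rewrite mulrC /l1norm mulr_sumr.
  apply: ler_sum => i _; rewrite normrM ler_wpM2r//.
  by rewrite (bigD1 i)//= lerDl sumr_ge0.
have mon0 x : monomial (fun=> 0%N) x = 1 :> R by rewrite /monomial big1.
have [c0 s0] := same_dot_trig sk N.+1; split.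
  have := c0 (fun=> 0%N).
  by under eq_integral do rewrite mon0 mul1r tE; under [X in _ = X -> _]eq_integral do rewrite mon0 mul1r tE.
have := s0 (fun=> 0%N).
by under eq_integral do rewrite mon0 mul1r tE; under [X in _ = X -> _]eq_integral do rewrite mon0 mul1r tE.
Qed.

End same_moments.

Section determinacy.
Context (R : realType) (n : nat).
Implicit Types nu : {measure set 'rV[R]_n -> \bar R}.

(** [A] is the partial sum of the series of 2 cosh(c x_i): a polynomial, so it has the same integral
    for both measures, and with nonnegative terms, so monotone convergence applies. The bounds
    exp(c|x_i|) <= 2 cosh(c x_i) <= 2 exp(c|x_i|) link it to the exponential moments on either
    side. *)
Lemma exp_moments_transfer (c : R) nu nu' : 0 <= c ->
  finite_moments nu -> finite_moments nu' ->
  (forall alpha, \int[nu']_x (monomial alpha x)%:E = \int[nu]_x (monomial alpha x)%:E)%E ->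
  exp_moments c nu -> exp_moments c nu'.
Proof.
move=> c0 fnu fnu' enu nuc i.
pose A N (x : 'rV[R]_n) := \sum_(0 <= k < N)
  (c ^+ k * (1 + (-1) ^+ k) / k`!%:R) * monomial (fun l => (k * (l == i))%N) x.
have monE k (x : 'rV[R]_n) : monomial (fun l => (k * (l == i))%N) x = x ord0 i ^+ k.
  rewrite /monomial (bigD1 i)//= eqxx muln1 big1 ?mulr1// => l li.
  by rewrite (negbTE li) muln0 expr0.
have AE N x : A N x = series (exp_coeff (c * x ord0 i)) N + series (exp_coeff (- (c * x ord0 i))) N.
  rewrite /series/= -big_split/=; apply: eq_bigr => k _.
  by rewrite monE /exp_coeff/= -[- (c * _)]mulN1r !exprMn; ring.
have sgn k : 0 <= 1 + (-1) ^+ k :> R.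
  by rewrite -signr_odd; case: (odd k); rewrite ?expr1 ?expr0 ?subrr// addr_ge0.
have tE k (x : 'rV[R]_n) : (c ^+ k * (1 + (-1) ^+ k) / k`!%:R) * monomial (fun l => (k * (l == i))%N) x =
    ((1 + (-1) ^+ k) / k`!%:R) * (c * x ord0 i) ^+ k by rewrite monE exprMn; ring.
have t0 k (x : 'rV[R]_n) :
    0 <= (c ^+ k * (1 + (-1) ^+ k) / k`!%:R) * monomial (fun l => (k * (l == i))%N) x.
  rewrite tE; have [ko|ke] := boolP (odd k).
    by rewrite -signr_odd ko expr1 subrr !mul0r.
  by rewrite mulr_ge0 ?divr_ge0// exprn_even_ge0.
have mA N : measurable_fun setT (A N).
  by apply: measurable_sum => k; apply: measurable_funM => //; exact: measurable_monomial.
have ndA x : nondecreasing_seq (A ^~ x).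
  by apply: nondecreasing_series => k _ _; exact: t0.
have A0 N x : 0 <= A N x by apply: sumr_ge0 => k _; exact: t0.
have cvgA x : A N x @[N --> \oo] --> expR (c * x ord0 i) + expR (- (c * x ord0 i)).
  under eq_fun do rewrite AE.
  by apply: cvgD; exact: is_cvg_series_exp_coeff.
have expE (u : R) : expR u + expR (- u) = expR `|u| + expR (- `|u|).
  by case: (ler0P u) => _ //; rewrite opprK addrC.
have A_le N x : A N x <= expR (c * `|x ord0 i|) * 2.
  apply: (@le_trans _ _ (expR (c * x ord0 i) + expR (- (c * x ord0 i)))).
    rewrite -(cvg_lim _ (cvgA x))//; apply: nondecreasing_cvgn_le => //.
    by apply/cvg_ex; eexists; exact: cvgA.
  rewrite expE normrM (ger0_norm c0) mulr_natr mulr2n lerD2l ler_expR.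
  by rewrite (@le_trans _ _ 0) ?oppr_le0 ?mulr_ge0.
have intA N : (\int[nu']_x (A N x)%:E = \int[nu]_x (A N x)%:E)%E.
  by rewrite !integral_lincomb//; apply: eq_bigr => k _; rewrite enu.
have mexp := measurable_exp_coord c i.
apply: (@le_lt_trans _ _ (\int[nu']_x limn (fun N => (A N x)%:E)))%E.
  apply: ge0_le_integral => //.
  - by apply/measurable_EFinP.
  - apply: (emeasurable_fun_cvg (fun N x => (A N x)%:E)) => [N|x _].
      exact/measurable_EFinP.
    apply: ereal_nondecreasing_is_cvgn => a b ab; rewrite lee_fin; exact: ndA.
  - move=> x _; rewrite (cvg_lim _ (cvg_EFin _ (cvgA x)))//; last exact: nearW.
    by rewrite lee_fin expE normrM (ger0_norm c0) lerDl expR_ge0.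
rewrite monotone_convergence//; last 3 first.
- by move=> N; exact/measurable_EFinP.
- by move=> N x _; rewrite lee_fin.
- by move=> x _ a b ab; rewrite lee_fin; exact: ndA.
apply: (@le_lt_trans _ _ (\int[nu]_x ((expR (c * `|x ord0 i|))%:E * 2%:E)))%E; last first.
  rewrite ge0_integralZr//; first by rewrite muleC lte_mul_pinfty//; exact: nuc.
  exact/measurable_EFinP.
apply: lime_le.
  apply: ereal_nondecreasing_is_cvgn => a b ab; apply: ge0_le_integral => //.
  - by move=> x _; rewrite lee_fin.
  - exact/measurable_EFinP.
  - exact/measurable_EFinP.
  - by move=> x _; rewrite lee_fin; exact: ndA.
apply: nearW => N; rewrite intA; apply: ge0_le_integral => //.
- by move=> x _; rewrite lee_fin.
- exact/measurable_EFinP.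
- by apply: emeasurable_funM => //; exact/measurable_EFinP.
- by move=> x _; rewrite -EFinM lee_fin.
Qed.

Lemma finite_moments_lty nu : finite_moments nu -> (nu setT < +oo)%E.
Proof.
move=> /(_ (fun=> 0%N)) /integrableP[_]; rewrite (eq_integral (cst 1%E)).
  by rewrite integral_cst// mul1e.
by move=> x _; rewrite /monomial/= big1// normr1.
Qed.

Lemma exp_moments_finite_moments c nu : 0 < c -> (nu setT < +oo)%E -> exp_moments c nu ->
  finite_moments nu.
Proof.
move=> c0 nuoo /(exp_moments_integrable (ltW c0) nuoo) ic alpha.
by apply: monomial_integrable ic; rewrite divr_gt0.
Qed.

Theorem exp_moments_determinate c nu : 0 < c -> (nu setT < +oo)%E -> exp_moments c nu ->
  moment_determinate nu.
Proof.
move=> c0 nuoo nuc; have fnu := exp_moments_finite_moments c0 nuoo nuc.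
split=> // nu' fnu' enu B mB.
have nu'oo := finite_moments_lty fnu'.
have nu'c := exp_moments_transfer (ltW c0) fnu fnu' enu nuc.
(* Halved because the common-moments argument consumes the square of exp(k * l1norm x). *)
pose k := c / n.+1%:R / 2; have k0 : 0 < k by rewrite !divr_gt0.
have kE : (fun x : 'rV[R]_n => (expR (c / n.+1%:R * l1norm x))%:E) =
    (fun x => (expR (k * l1norm x) * expR (k * l1norm x))%:E).
  by apply/funext => x; rewrite -expRD -mulrDl -splitr.
have := exp_moments_integrable (ltW c0) nuoo nuc.
have := exp_moments_integrable (ltW c0) nu'oo nu'c.
rewrite kE => i1 i2.
have T t := same_moments_trig k0 i1 i2 enu t.
by apply: trig_measure_unique => // t; have [] := T t.
Qed.

End determinacy.

(** * Consistent weights on words *)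

Section discrete_integrals.
Context d (T : measurableType d) (R : realType) (P : probability T R).
Variables (D : set T) (mD : measurable D).

Lemma Rintegral_close (f g : T -> R) e :
  P.-integrable D (EFin \o f) -> P.-integrable D (EFin \o g) -> 0 <= e ->
  (forall x, D x -> `|f x - g x| <= e) ->
  `|\int[P]_(x in D) f x - \int[P]_(x in D) g x| <= e.
Proof.
move=> fi gi e0 fg; rewrite -RintegralB//.
have fgi : P.-integrable D (EFin \o (fun x => f x - g x)).
  rewrite (_ : _ \o _ = (EFin \o f) \- (EFin \o g))%E; last by apply/funext => x; rewrite /= EFinB.
  exact: integrableB.
apply: (le_trans (le_normr_Rintegral mD fgi)).
apply: (@le_trans _ _ (\int[P]_(x in D) (cst e x))).
  apply: le_Rintegral => //; first exact: (integrable_norm fgi).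
  exact: finite_measure_integrable_cst.
rewrite Rintegral_cst// -[leRHS]mulr1 ler_wpM2l//.
by rewrite -lee_fin fineK ?fin_num_measure// probability_le1.
Qed.

Variables (N : nat) (g : T -> seq bool).
Hypothesis size_g : forall x, size (g x) = N.
Hypothesis mg : forall s, measurable [set x | g x = s].

Lemma discreteE (h : seq bool -> R) x :
  h (g x) = \sum_(s : N.-tuple bool) h s * \1_[set x | g x = s] x.
Proof.
have gs : size (g x) == N by rewrite size_g.
rewrite (bigD1 (Tuple gs))//= indicE mem_set//= mulr1 big1 ?addr0// => s sg.
rewrite indicE memNset ?mulr0//= => gxs; case/eqP: sg.
by apply: val_inj; rewrite /= gxs.
Qed.

Lemma measurable_discrete (h : seq bool -> R) : measurable_fun setT (h \o g).
Proof.
rewrite (_ : h \o g = fun x => \sum_(s : N.-tuple bool) h s * \1_[set x | g x = s] x).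
  by apply: measurable_sum => s; apply: measurable_funM => //; exact: measurable_indic.
by apply/funext => x; exact: discreteE.
Qed.

Let integrable_indicD s : P.-integrable D (EFin \o (\1_[set x | g x = s] : T -> R)).
Proof. by apply: (@integrableS _ _ _ P setT) => //; exact: integrable_indic. Qed.

Lemma integrable_discrete (h : seq bool -> R) : P.-integrable D (EFin \o (h \o g)).
Proof.
rewrite (_ : _ \o _ = fun x => \sum_(s : N.-tuple bool)
    ((h s)%:E * (EFin \o \1_[set x | g x = s]) x)%E).
  by apply: integrable_sum => // s _; exact: integrableZl.
by apply/funext => x; rewrite /= discreteE -sumEFin.
Qed.

Lemma Rintegral_discrete (h : seq bool -> R) :
  \int[P]_(x in D) h (g x) =
  \sum_(s : N.-tuple bool) h s * fine (P (D `&` [set x | g x = s])).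
Proof.
rewrite /Rintegral; under eq_integral do rewrite discreteE.
rewrite integral_lincomb// -[RHS]/(fine (_%:E)) -sumEFin; congr fine.
apply: eq_bigr => s _; rewrite integral_indic// EFinM fineK ?fin_num_measure//.
  by rewrite setIC.
exact: measurableI.
Qed.

End discrete_integrals.

Lemma probability_full d (T : measurableType d) (R : realType) (P : probability T R)
    (A D : set T) : measurable A -> measurable D -> P D = 1%E -> P A = P (A `&` D).
Proof.
move=> mA mD PD; rewrite (measureDI P mA mD) [X in (X + _)%E](_ : _ = 0%E) ?add0e//.
apply/eqP; rewrite eq_le measure_ge0 andbT.
apply: (@le_trans _ _ (P (~` D))).
  by apply: le_measure; rewrite ?inE//; [exact: measurableD|exact: measurableC].
by rewrite probability_setC// PD subee.
Qed.

Section digit_realization.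
Context (R : realType) (w : seq bool -> R).
Hypotheses (w_ge0 : forall s, 0 <= w s) (w_nil : w [::] = 1).
Hypothesis w_split : forall s, w s = w (false :: s) + w (true :: s).

(* Words are read with the most recent digit first. The words of length N cut
   [0, 1) into consecutive intervals [left_end s, left_end s + w s). *)
Fixpoint left_end (s : seq bool) : R :=
  if s is b :: s' then left_end s' + (if b then w (false :: s') else 0) else 0.

Fixpoint digits N (u : R) : seq bool :=
  if N is N'.+1 then
    let s := digits N' u in (left_end s + w (false :: s) <= u) :: s
  else [::].

Lemma size_digits N u : size (digits N u) = N.
Proof. by elim: N => //= N ->. Qed.

Lemma digitsP N u : 0 <= u < 1 ->
  left_end (digits N u) <= u < left_end (digits N u) + w (digits N u).
Proof.
move=> u01; elim: N => [|N] /=; first by rewrite add0r w_nil.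
set s := digits N u; rewrite w_split => /andP[su us].
by case: (leP (left_end s + w (false :: s)) u) => h /=; [rewrite h -addrA|rewrite addr0 su].
Qed.

Lemma digits_uniq s u : left_end s <= u < left_end s + w s -> digits (size s) u = s.
Proof.
elim: s => //= b s ih /andP[su us].
have sE : digits (size s) u = s.
  apply: ih; rewrite w_split; case: b su us => su us; apply/andP; split.
  - by rewrite (le_trans _ su)// lerDl.
  - by rewrite addrA.
  - by rewrite (le_trans _ su)// lerDl.
  - rewrite (lt_le_trans us)// addr0 lerD2l lerDl; exact: w_ge0.
rewrite sE; congr (_ :: _); case: b su us => su us; first by rewrite su.
by rewrite leNgt; move: us; rewrite addr0 => ->.
Qed.

Lemma left_end_ge0 s : 0 <= left_end s.
Proof. by elim: s => //= b s ih; rewrite addr_ge0//; case: b. Qed.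

Lemma right_end_le1 s : left_end s + w s <= 1.
Proof.
elim: s => [|b s ih] /=; first by rewrite add0r w_nil.
apply: le_trans ih; rewrite [w s]w_split.
by case: b; rewrite ?addr0 -?addrA// lerD2l lerDl.
Qed.

(** Points outside [0, 1) are sent to 0, so that properties of words hold for every real number and
    not merely almost everywhere. *)
Definition into_unit (u : R) : R := if 0 <= u < 1 then u else 0.

Definition word N u := digits N (into_unit u).

Lemma into_unit01 u : 0 <= into_unit u < 1.
Proof. by rewrite /into_unit; case: ifPn => // _; rewrite lexx ltr01. Qed.

(** The half-open interval attached to the word contains the point, so its length is positive. Hence
    words of weight zero, whose cells may be empty, are never read. *)
Lemma wordP N u : 0 < w (word N u).
Proof.
have /andP[h1 h2] := digitsP N (into_unit01 u).
by have := le_lt_trans h1 h2; rewrite ltrDl.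
Qed.

Lemma word_setE s : [set u | word (size s) u = s] =
  (`[left_end s, left_end s + w s[ `&` `[0, 1[) `|`
  (if digits (size s) 0 == s then ~` `[0, 1[ else set0).
Proof.
apply/seteqP; split => [u /= us|u /=].
  have [u01|nu01] := boolP (0 <= u < 1).
    have ds : digits (size s) u = s by rewrite -[RHS]us /word /into_unit u01.
    left; split; rewrite /= in_itv//=.
    by have := digitsP (size s) u01; rewrite ds.
  right; move: us; rewrite /word /into_unit (negbTE nu01) => ->.
  by rewrite eqxx /= in_itv/=; exact/negP.
move=> [[]|]; rewrite /= ?in_itv/=.
  by move=> us u01; rewrite /word /into_unit u01 digits_uniq.
case: eqP => // s0 /=; rewrite in_itv/= => /negP nu01.
by rewrite /word /into_unit (negbTE nu01).
Qed.

Lemma word_set_size N s : size s <> N -> [set u | word N u = s] = set0.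
Proof.
by move=> sN; apply/seteqP; split => // u /= us; apply: sN; rewrite -us size_digits.
Qed.

Lemma measurable_word N s : measurable [set u : measurableTypeR R | word N u = s].
Proof.
have [<-|sN] := eqVneq (size s) N; last by rewrite word_set_size//; exact/eqP.
rewrite word_setE; apply: measurableU; first exact: measurableI.
by case: ifP => // _; exact: measurableC.
Qed.

Definition unit_prob : probability (measurableTypeR R) R := uniform_prob (@ltr01 R).

Lemma unit_prob_itv (a b : R) : 0 <= a -> a <= b -> b <= 1 ->
  unit_prob `[a, b[%classic = (b - a)%:E.
Proof.
move=> a0 ab b1.
transitivity (\int[lebesgue_measure]_(u in `[a, b[) (uniform_pdf (0 : R) 1 u)%:E)%E; first by [].
rewrite (eq_integral (cst 1%E)); last first.
  move=> u; rewrite inE/= in_itv/= => /andP[au ub].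
  rewrite /uniform_pdf (le_trans a0 au) (le_trans (ltW ub) b1)/=.
  by rewrite subr0 invr1.
rewrite integral_cst//= mul1e lebesgue_measure_itv/= lte_fin.
move: ab; rewrite le_eqVlt => /predU1P[->|->]; last by rewrite -EFinD.
by rewrite ltxx subrr.
Qed.

Lemma unit_prob_word s : unit_prob [set u | word (size s) u = s] = (w s)%:E.
Proof.
have P1 : unit_prob `[0, 1[%classic = 1%E by rewrite unit_prob_itv// subr0.
rewrite (@probability_full _ _ _ unit_prob _ `[0, 1[%classic)//; last exact: measurable_word.
rewrite word_setE setIUl -setIA setIid [X in _ `|` X](_ : _ = set0); last first.
  by case: ifP; rewrite ?set0I// setICl.
rewrite setU0 setIidl.
  rewrite unit_prob_itv ?left_end_ge0 ?lerDl ?right_end_le1//.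
  by rewrite addrAC subrr add0r.
move=> u; rewrite /= !in_itv/= => /andP[h1 h2].
by rewrite (le_trans (left_end_ge0 s) h1) (lt_le_trans h2 (right_end_le1 s)).
Qed.

Lemma drop_word N M u : drop M (word (M + N)%N u) = word N u.
Proof. by rewrite /word; elim: M => [|M ih]; [rewrite drop0|exact: ih]. Qed.

End digit_realization.

(** * Limits of probability measures along an ultrafilter *)

Lemma probability_pushforward d d' (T : measurableType d) (T' : measurableType d')
    (R : realType) (P : probability T R) (f : T -> T') : measurable_fun setT f ->
  exists Q : probability T' R, forall A, Q A = P (f @^-1` A).
Proof.
move=> mf; pose X : {mfun T >-> T'} := HB.pack f (isMeasurableFun.Build _ _ _ _ f mf).
by exists (distribution P X).
Qed.

Lemma ge0_integral_preimage d d' (T : measurableType d) (T' : measurableType d')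
    (R : realType) (P : {measure set T -> \bar R}) (Q : {measure set T' -> \bar R})
    (f : T -> T') (D : set T') (g : T' -> \bar R) : measurable_fun setT f ->
  (forall A, measurable A -> Q A = P (f @^-1` A)) ->
  measurable D -> measurable_fun setT g -> (forall y, (0 <= g y)%E) ->
  (\int[Q]_(y in D) g y = \int[P]_(x in f @^-1` D) g (f x))%E.
Proof.
move=> mf QE mD mg g0; pose X : {mfun T >-> T'} := HB.pack f (isMeasurableFun.Build _ _ _ _ f mf).
rewrite (eq_measure_integral (pushforward P X)); last by move=> A mA _; exact: QE.
by rewrite ge0_integral_pushforward//; exact: measurable_funTS.
Qed.

Lemma integral_preimage d d' (T : measurableType d) (T' : measurableType d')
    (R : realType) (P : {measure set T -> \bar R}) (Q : {measure set T' -> \bar R})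
    (f : T -> T') (D : set T') (g : T' -> \bar R) : measurable_fun setT f ->
  (forall A, measurable A -> Q A = P (f @^-1` A)) ->
  measurable D -> measurable_fun setT g ->
  (\int[Q]_(y in D) g y = \int[P]_(x in f @^-1` D) g (f x))%E.
Proof.
move=> mf QE mD mg; rewrite integralE [RHS]integralE.
rewrite !(ge0_integral_preimage mf QE mD)//.
- by rewrite !funepos.unlock !funeneg.unlock.
- exact: measurable_funeneg.
- exact: measurable_funepos.
Qed.

Lemma integrable_preimage d d' (T : measurableType d) (T' : measurableType d')
    (R : realType) (P : {measure set T -> \bar R}) (Q : {measure set T' -> \bar R})
    (f : T -> T') (g : T' -> \bar R) : measurable_fun setT f ->
  (forall A, measurable A -> Q A = P (f @^-1` A)) -> measurable_fun setT g ->
  Q.-integrable setT g <-> P.-integrable setT (fun x => g (f x)).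
Proof.
move=> mf QE mg.
have E := ge0_integral_preimage mf QE measurableT (measurableT_comp (@abse_measurable R setT) mg)
  (fun y => abse_ge0 (g y)).
rewrite preimage_setT /= in E.
split=> /integrableP[_ gi]; apply/integrableP; split => //.
- exact: (measurableT_comp mg mf).
- by rewrite -E.
- by rewrite E.
Qed.

Lemma ultra_fmap T T' (f : T -> T') (U : set_system T) : UltraFilter U -> UltraFilter (f @ U).
Proof.
move=> UU; apply: Build_UltraFilter => G GP UG.
apply/seteqP; split => // A GA.
have [//|UA] := in_ultra_setVsetC (f @^-1` A) UU.
have GC : G (~` A) by apply: UG.
by have [y []] := @filter_ex _ _ GP _ (filterI GA GC).
Qed.

Lemma compact_ultra_cvg (T : topologicalType) (K : set T) (V : set_system nat) (x_ : nat -> T) :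
  compact K -> UltraFilter V -> (forall N, K (x_ N)) -> exists2 p, K p & x_ @ V --> p.
Proof.
rewrite compact_ultra => cK VU Kx.
have [|p [Kp xp]] := cK (x_ @ V) (ultra_fmap x_ VU); last by exists p.
change (V (x_ @^-1` K)); rewrite (_ : x_ @^-1` K = setT).
  exact: (@filterT _ V).
by apply/seteqP; split => // N _; exact: Kx.
Qed.

(** * Binary coding of points by rational thresholds *)

Section coding.
Context (R : realType) (n : nat).
Implicit Types x y p : 'rV[R]_n.

(** [unpickle] runs through all pairs of a coordinate and a rational; an index that codes no pair
    gives a constant bit. *)
Definition threshold_bit (j : nat) x : bool :=
  if @unpickle ('I_n * rat)%type j is Some (i, q) then x ord0 i <= ratr q else false.

Fixpoint code N x : seq bool :=
  if N is N'.+1 then threshold_bit N' x :: code N' x else [::].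

Lemma size_code N x : size (code N x) = N.
Proof. by elim: N => //= N ->. Qed.

Lemma measurable_code N s : measurable [set x | code N x = s].
Proof.
elim: N s => [|N ih] [|b s] /=.
- by rewrite (_ : mkset _ = setT)//; apply/seteqP.
- by rewrite (_ : mkset _ = set0)//; apply/seteqP; split.
- by rewrite (_ : mkset _ = set0)//; apply/seteqP; split.
rewrite (_ : mkset _ = (threshold_bit N @^-1` [set b]) `&` [set x | code N x = s]); last first.
  by apply/seteqP; split => x /= [-> ->].
apply: measurableI; last exact: ih.
rewrite /threshold_bit; case: unpickle => [[i q]|]; last first.
  by rewrite -[X in measurable X]setTI; exact: measurable_cst.
rewrite -[X in measurable X]setTI; apply: measurable_fun_ler => //.
exact: measurable_coord.
Qed.

Lemma drop_code M N x : drop M (code (M + N)%N x) = code N x.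
Proof. by elim: M => [|M ih]; [rewrite drop0|exact: ih]. Qed.

Lemma code_drop M N x y : (N <= M)%N -> code M x = code M y -> code N x = code N y.
Proof. by move=> /subnK <- xy; rewrite -(drop_code (M - N) N x) xy drop_code. Qed.

Lemma code_bit N j x y : (j < N)%N -> code N x = code N y ->
  threshold_bit j x = threshold_bit j y.
Proof. by move=> jN /(code_drop jN) [-> _]. Qed.

Lemma cvg_coord (V : set_system nat) {FV : Filter V} (x_ : nat -> 'rV[R]_n) p i :
  x_ @ V --> p -> x_ N ord0 i @[N --> V] --> p ord0 i.
Proof.
move=> xp; apply: (cvg_comp x_ (fun x : 'rV[R]_n => x ord0 i) xp).
exact: coord_continuous.
Qed.

(** If the limits differ in a coordinate, a rational strictly between them yields a bit on which the
    two sequences eventually disagree. Strictness matters: the bits are discontinuous, so codes of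
    the limits themselves would say nothing. *)
Lemma code_separates (V : set_system nat) (x_ y_ : nat -> 'rV[R]_n) p q :
  ProperFilter V -> \oo `<=` V -> (forall N, code N (x_ N) = code N (y_ N)) ->
  x_ @ V --> p -> y_ @ V --> q -> p = q.
Proof.
move=> PV ooV xy xp yq; apply/rowP => i.
have sep (u v : nat -> 'rV[R]_n) (a b : 'rV[R]_n) : (forall N, code N (u N) = code N (v N)) ->
    u @ V --> a -> v @ V --> b -> ~ a ord0 i < b ord0 i.
  move=> uv ua vb ab; have [r] := rat_in_itvoo ab; rewrite in_itv/= => /andP[ar rb].
  have : \forall N \near V, u N ord0 i < ratr r.
    exact: (cvgr_lt _ (cvg_coord ua) _ ar).
  have : \forall N \near V, ratr r < v N ord0 i.
    exact: (cvgr_gt _ (cvg_coord vb) _ rb).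
  have : \forall N \near V, (pickle (i, r) < N)%N.
    by apply: ooV; exists (pickle (i, r)).+1.
  move=> h1 h2 h3; have [N [[lN rv] ur]] := filter_ex (filterI (filterI h1 h2) h3).
  have := code_bit lN (uv N); rewrite /threshold_bit pickleK (ltW ur).
  by rewrite leNgt rv.
apply/eqP; rewrite eq_le; apply/andP; split; rewrite leNgt; apply/negP.
  by apply: sep yq xp => // N; rewrite xy.
exact: sep xp yq.
Qed.

Definition continuous_on (K : set 'rV[R]_n) (f : 'rV[R]_n -> R) :=
  forall p, K p -> f @ within K (nbhs p) --> f p.

Lemma continuous_on_cvg K f (V : set_system nat) {FV : Filter V} (x_ : nat -> 'rV[R]_n) p :
  continuous_on K f -> (forall N, K (x_ N)) -> K p -> x_ @ V --> p -> f (x_ N) @[N --> V] --> f p.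
Proof.
move=> cf Kx Kp xp; apply: cvg_trans (cf p Kp).
move=> A wA; have h : V (fun N => K (x_ N) -> A (f (x_ N))) by exact: xp _ wA.
change (V (fun N => A (f (x_ N)))).
by apply: filterS h => N; apply; exact: Kx.
Qed.

Lemma continuous_on_coord K i : continuous_on K (fun x => x ord0 i).
Proof. by move=> p Kp; apply: cvg_within_filter; exact: coord_continuous. Qed.

(** Plays the role of uniform continuity, with cells of long words instead of small balls. Otherwise
    pairs with equal codes of growing length would keep their values apart, while both converge
    along an ultrafilter, to the same point by [code_separates]. *)
Lemma continuous_on_code K f e : compact K -> continuous_on K f -> 0 < e ->
  exists N, forall x y, K x -> K y -> code N x = code N y -> `|f x - f y| <= e.
Proof.
move=> cK cf e0; apply: contrapT => /forallNP no.
have {no} ex N : exists xy : 'rV[R]_n * 'rV[R]_n,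
    [/\ K xy.1, K xy.2, code N xy.1 = code N xy.2 & e < `|f xy.1 - f xy.2|].
  have /existsNP[x /existsNP[y /not_implyP[Kx /not_implyP[Ky /not_implyP[xy ne]]]]] := no N.
  by exists (x, y); split => //=; rewrite ltNge; exact/negP.
pose xy N := projT1 (cid (ex N)).
have xyP N : [/\ K (xy N).1, K (xy N).2, code N (xy N).1 = code N (xy N).2 &
    e < `|f (xy N).1 - f (xy N).2|] := projT2 (cid (ex N)).
have [V [UV ooV]] := @ultraFilterLemma nat \oo _.
have PV : ProperFilter V by exact: ultra_proper.
have Kx N : K (xy N).1 by have [] := xyP N.
have Ky N : K (xy N).2 by have [] := xyP N.
have [p Kp xp] := compact_ultra_cvg cK UV Kx.
have [q Kq yq] := compact_ultra_cvg cK UV Ky.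
have pq : p = q.
  by apply: code_separates xp yq => // N; have [] := xyP N.
have fx := continuous_on_cvg cf Kx Kp xp.
have fy := continuous_on_cvg cf Ky Kq yq.
have : `|f (xy N).1 - f (xy N).2| @[N --> V] --> `|f p - f q|.
  by apply: cvg_norm; apply: cvgB; [exact: fx|exact: fy].
rewrite pq subrr normr0 => cv0.
have near_lt : \forall N \near V, `|f (xy N).1 - f (xy N).2| < e by exact: (cvgr_lt _ cv0 _ e0).
have [N /=] := filter_ex near_lt.
by have [_ _ _ h] := xyP N; rewrite ltNge (ltW h).
Qed.

End coding.

Lemma eq_limits (R : realType) (U : set_system nat) (PU : ProperFilter U)
    (f g : nat -> R) (a b : R) :
  f j @[j --> U] --> a -> g j @[j --> U] --> b -> f =1 g -> a = b.
Proof.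
move=> fa + /funext fg; rewrite -fg => fb.
exact: (@cvg_unique R (@norm_hausdorff _ R) (f @ U) _ _ _ fa fb).
Qed.

Lemma integrable_close d (T : measurableType d) (R : realType) (P : probability T R)
    D (f g : T -> R) (e : R) : measurable D -> measurable_fun D f ->
  P.-integrable D (EFin \o g) -> (forall x, D x -> `|f x - g x| <= e) ->
  P.-integrable D (EFin \o f).
Proof.
move=> mD mf gi fg; apply: (@le_integrable _ _ _ P D mD _ (EFin \o (fun x => `|g x| + e))).
- exact/measurable_EFinP.
- move=> x Dx; rewrite /= lee_fin; apply: le_trans (ler_norm _).
  rewrite -[f x](subrK (g x)); apply: (le_trans (ler_normD _ _)).
  by rewrite addrC lerD2l fg.
- rewrite (_ : _ \o _ = (EFin \o (fun x => `|g x|)%R) \+ (EFin \o cst e))%E; last first.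
    by apply/funext => x; rewrite /= EFinD.
  apply: integrableD => //; first exact: integrable_norm.
  exact: finite_measure_integrable_cst.
Qed.

(** * Limits of probability measures on a compact set *)

Section compact_limit.
Context (R : realType) (n : nat) (K : set 'rV[R]_n).
Hypotheses (mK : measurable K) (cK : compact K).
Variable P_ : nat -> probability 'rV[R]_n R.
Hypothesis P_K : forall j, P_ j K = 1%E.
Variables (U : set_system nat) (UU : UltraFilter U).

Let PU : ProperFilter U. Proof. exact: ultra_proper. Qed.

Let cell s := K `&` [set x : 'rV[R]_n | code (size s) x = s].

Let mcell s : measurable (cell s).
Proof. by apply: measurableI => //; exact: measurable_code. Qed.

Let weight j s : R := fine (P_ j (cell s)).

Let weightE j s : (weight j s)%:E = P_ j (cell s).
Proof. by rewrite fineK// fin_num_measure. Qed.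

Let weight01 j s : 0 <= weight j s <= 1.
Proof.
by rewrite -!lee_fin weightE measure_ge0 probability_le1.
Qed.

Let limit_weight_ex s : exists l : R, weight j s @[j --> U] --> l.
Proof.
have K01 j : `[0, 1]%classic (weight j s) by rewrite /= in_itv/= weight01.
by have [l _ lU] := compact_ultra_cvg (@segment_compact R 0 1) UU K01; exists l.
Qed.

Let w s : R := projT1 (cid (limit_weight_ex s)).

Let cvg_weight s : weight j s @[j --> U] --> w s.
Proof. exact: (projT2 (cid (limit_weight_ex s))). Qed.

Let w_ge0 s : 0 <= w s.
Proof.
rewrite -(cvg_lim _ (@cvg_weight s))//; apply: limr_ge.
  by apply/cvg_ex; exists (w s); exact: cvg_weight.
by apply: nearW => j; have /andP[] := weight01 j s.
Qed.

Let w_nil : w [::] = 1.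
Proof.
apply: (@eq_limits _ U _ (weight ^~ [::]) (cst 1)); [exact: cvg_weight|exact: cvg_cst|move=> j /=].
apply: EFin_inj; rewrite weightE /cell /= (_ : mkset _ = setT) ?setIT ?P_K//.
by apply/seteqP; split.
Qed.

Let w_split s : w s = w (false :: s) + w (true :: s).
Proof.
apply: (@eq_limits _ U _ (weight ^~ s) (fun j => weight j (false :: s) + weight j (true :: s)));
  [exact: cvg_weight|by apply: cvgD; exact: cvg_weight|move=> j /=].
apply: EFin_inj; rewrite EFinD !weightE -measureU//.
- congr (P_ j _); rewrite /cell -setIUr; congr (_ `&` _).
  apply/seteqP; split => x /=.
    by move=> xs; rewrite xs; case: (threshold_bit _ _); [right|left].
  by move=> [[]|[]].
- apply/seteqP; split => x //= [[_ [h1 _]] [_ [h2 _]]].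
  by rewrite h1 in h2.
Qed.

Let point : {x0 : 'rV[R]_n | K x0}.
Proof.
apply: cid; apply: contrapT => /forallNP nK.
have := P_K 0; rewrite (_ : K = set0) ?measure0; last by apply/seteqP; split => // x /nK.
by move=> /eqP; rewrite eqe eq_sym oner_eq0.
Qed.

(** The default value, taken on an empty cell, is never reached by [Y] below: a word of positive
    limit weight has a nonempty cell. *)
Let pick s : 'rV[R]_n := xget (projT1 point) (cell s).

Let pickP s x : cell s x -> cell s (pick s).
Proof. exact: xgetI. Qed.

Let pick_pos s : 0 < w s -> cell s (pick s).
Proof.
move=> ws; apply: xgetPex; apply: contrapT => /forallNP nc.
have cell0 : cell s = set0 by apply/seteqP; split => // x /nc.
suff : w s = 0 by move=> w0; rewrite w0 ltxx in ws.
apply: (@eq_limits _ U _ (weight ^~ s) (cst 0)); [exact: cvg_weight|exact: cvg_cst|move=> j /=].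
by rewrite /weight cell0 measure0.
Qed.

Let Y N (u : measurableTypeR R) : 'rV[R]_n := pick (word w N u).

Let size_word N u : size (word w N u) = N. Proof. exact: size_digits. Qed.

Let Ycell N u : cell (word w N u) (Y N u).
Proof. by apply: pick_pos; exact: wordP. Qed.

Let YK N u : K (Y N u). Proof. by have [] := Ycell N u. Qed.

Let codeY N u : code N (Y N u) = word w N u.
Proof. by have [_ /=] := Ycell N u; rewrite size_word. Qed.

Let codeYM N M u : (N <= M)%N -> code N (Y M u) = code N (Y N u).
Proof.
move=> /subnK NM; rewrite codeY -(drop_code (M - N)) NM codeY.
by have := drop_word w N (M - N) u; rewrite NM.
Qed.

(** Compactness gives a limit along an ultrafilter; since coordinates vary little on cells of long
    words, it is an ordinary limit of the sequence. Measurability of the limit depends on this, as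
    it passes to limits of sequences. *)
Let Ylim_ex : exists Y' : R -> 'rV[R]_n, forall u, K (Y' u) /\ forall i,
   Y N u ord0 i @[N --> \oo] --> Y' u ord0 i.
Proof.
suff H u : exists y, K y /\ forall i, Y N u ord0 i @[N --> \oo] --> y ord0 i.
  by exists (fun u => projT1 (cid (H u))) => u; exact: (projT2 (cid (H u))).
have [V [UV ooV]] := @ultraFilterLemma nat \oo _.
have PV : ProperFilter V by exact: ultra_proper.
have [y Ky Yy] := compact_ultra_cvg cK UV (fun N => YK N u).
exists y; split => // i; apply/cvgrPdist_le => e e0.
have [N HN] := continuous_on_code cK (@continuous_on_coord R n K i) e0.
exists N => // M /= NM.
have Yi := cvg_coord (i := i) Yy.
have cvd : `|Y N' u ord0 i - Y M u ord0 i| @[N' --> V] --> `|y ord0 i - Y M u ord0 i|.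
  by apply: cvg_norm; apply: cvgB; [exact: Yi|exact: cvg_cst].
rewrite -(cvg_lim _ cvd)//; apply: limr_le; first by apply/cvg_ex; eexists; exact: cvd.
apply: ooV; exists N => // N' /= NN'.
by apply: HN => //; rewrite codeYM// codeYM.
Qed.

Let Y_lim := projT1 (cid Ylim_ex).

Let Y_limK u : K (Y_lim u).
Proof. by have [] := projT2 (cid Ylim_ex) u. Qed.

Let cvgY u i : Y N u ord0 i @[N --> \oo] --> Y_lim u ord0 i.
Proof. by have [_] := projT2 (cid Ylim_ex) u; apply. Qed.

Let cvgYV u (V : set_system nat) : UltraFilter V -> \oo `<=` V -> Y N u @[N --> V] --> Y_lim u.
Proof.
move=> UV ooV; have PV : ProperFilter V by exact: ultra_proper.
have [y Ky Yy] := compact_ultra_cvg cK UV (fun N => YK N u).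
suff -> : Y_lim u = y by [].
apply/rowP => i; apply: (@cvg_unique R (@norm_hausdorff _ R) ((fun N => Y N u ord0 i) @ V) _).
  by move=> A /(@cvgY u i) hA; exact: ooV hA.
exact: cvg_coord Yy.
Qed.

Let mY_coord N i : measurable_fun setT (fun u => Y N u ord0 i).
Proof.
apply: (@measurable_discrete _ (measurableTypeR R) R N (word w N) _ _ (fun s => pick s ord0 i)).
  exact: size_word.
by move=> s; exact: measurable_word.
Qed.

Let mY_lim : measurable_fun setT (Y_lim : measurableTypeR R -> 'rV[R]_n).
Proof.
apply: measurable_mxP => i j; rewrite ord1.
by apply: (measurable_fun_cvg (fun N => mY_coord N j)) => u _; exact: cvgY.
Qed.

(** On K the function f is within e/3 of a function of the code of length N. Integrals of the latter
    are finite sums of weights, which converge along [U] to the corresponding integral over the unit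
    interval; replacing f by it costs e/3 on each side. *)
Lemma compact_limit : exists Q : probability 'rV[R]_n R, Q K = 1%E /\
  forall f : 'rV[R]_n -> R, measurable_fun setT f -> continuous_on K f ->
    \int[P_ j]_(x in K) f x @[j --> U] --> \int[Q]_(x in K) f x.
Proof.
pose W := unit_prob R.
have [Q QE] := probability_pushforward W mY_lim.
have YsK : Y_lim @^-1` K = setT by apply/seteqP; split => // u _; exact: Y_limK.
exists Q; split; first by rewrite QE YsK probability_setT.
move=> f mf cf; apply/cvgrPdist_le => e e0.
have e3 : 0 < e / 3 by rewrite divr_gt0.
have [N HN] := continuous_on_code cK cf e3.
pose h s := f (pick s).
have mcode N' s := @measurable_code R n N' s.
have szc N' (x : 'rV[R]_n) : size (code N' x) = N' by exact: size_code.
have mword s : measurable [set u : measurableTypeR R | word w N u = s] by exact: measurable_word.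
have szw u : size (word w N u) = N by exact: size_digits.
have hf x : K x -> `|f x - h (code N x)| <= e / 3.
  move=> Kx; have cx : cell (code N x) x by split => //=; rewrite size_code.
  have [Kp /= cp] := pickP cx; rewrite size_code in cp.
  by apply: HN.
have hY u : `|f (Y_lim u) - h (word w N u)| <= e / 3.
  have [V [UV ooV]] := @ultraFilterLemma nat \oo _.
  have PV : ProperFilter V by exact: ultra_proper.
  have Yf : f (Y M u) @[M --> V] --> f (Y_lim u).
    apply: (continuous_on_cvg cf (fun M => YK M u)) => //; exact: cvgYV.
  have cvd : `|f (Y M u) - h (word w N u)| @[M --> V] --> `|f (Y_lim u) - h (word w N u)|.
    by apply: cvg_norm; apply: cvgB; [exact: Yf|exact: cvg_cst].
  rewrite -(cvg_lim _ cvd)//; apply: limr_le; first by apply/cvg_ex; eexists; exact: cvd.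
  apply: ooV; exists N => // M /= NM.
  by apply: (HN (Y M u) (Y N u)) => //; exact: codeYM.
have intP j : (P_ j).-integrable K (EFin \o (h \o code N)).
  exact: (@integrable_discrete _ _ _ (P_ j) K mK N (code N) (szc N) (mcode N) h).
have intW : W.-integrable setT (EFin \o (h \o word w N)).
  exact: (@integrable_discrete _ _ _ W setT measurableT N (word w N) szw mword h).
have mfY : measurable_fun setT (fun u : measurableTypeR R => f (Y_lim u)).
  exact: (measurableT_comp mf mY_lim).
have ifP j : (P_ j).-integrable K (EFin \o f).
  by apply: (integrable_close mK _ (intP j) hf); exact: measurable_funTS.
have ifW : W.-integrable setT (EFin \o (f \o Y_lim)).
  by apply: (integrable_close measurableT mfY intW (fun u _ => hY u)).
have QW : \int[Q]_(x in K) f x = \int[W]_u f (Y_lim u).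
  rewrite /Rintegral (integral_preimage mY_lim (fun A _ => QE A) mK) ?YsK//.
  exact/measurable_EFinP.
have cP j := Rintegral_close mK (ifP j) (intP j) (ltW e3) hf.
have cW := Rintegral_close measurableT ifW intW (ltW e3) (fun u _ => hY u).
have hP j : \int[P_ j]_(x in K) (h \o code N) x = \sum_(s : N.-tuple bool) h s * weight j s.
  rewrite (@Rintegral_discrete _ _ _ (P_ j) K mK N (code N) (szc N) (mcode N) h); apply: eq_bigr => s _.
  by rewrite /weight /cell size_tuple.
have hW : \int[W]_u (h \o word w N) u = \sum_(s : N.-tuple bool) h s * w s.
  rewrite (@Rintegral_discrete _ _ _ W setT measurableT N (word w N) szw mword h).
  apply: eq_bigr => s _; rewrite setTI.
  by have := unit_prob_word w_ge0 w_nil w_split s; rewrite size_tuple => ->.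
have lim_sum : \sum_(s : N.-tuple bool) h s * weight j s @[j --> U] -->
    \sum_(s : N.-tuple bool) h s * w s.
  by apply: cvg_sumr => s; apply: cvgM; [exact: cvg_cst|exact: cvg_weight].
have near3 : \forall j \near U, `|\sum_(s : N.-tuple bool) h s * w s -
    \sum_(s : N.-tuple bool) h s * weight j s| <= e / 3.
  by move/cvgrPdist_le : lim_sum; exact.
apply: filterS near3 => j nj; rewrite QW.
have := cP j; have := cW; rewrite hP hW => cW' cP'.
rewrite [e](_ : _ = e / 3 + e / 3 + e / 3); last by field.
set a := \int[W]_u _ in cW' *; set b := \int[P_ j]_(x in K) _ in cP' *.
move: nj cW' cP'; set c := \sum_(s : _) _; set d := \sum_(s : _) _ => nj cW' cP'.
have -> : a - b = (a - c) + (c - d) + (d - b) by ring.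
apply: (le_trans (ler_normD _ _)); apply: lerD; last by rewrite distrC.
by apply: (le_trans (ler_normD _ _)); apply: lerD.
Qed.

End compact_limit.

Lemma integral_full d (T : measurableType d) (R : realType) (P : probability T R)
    (D : set T) (f : T -> \bar R) : measurable D -> P D = 1%E -> measurable_fun setT f ->
  (\int[P]_x f x = \int[P]_(x in D) f x)%E.
Proof.
move=> mD PD mf; rewrite [RHS]integral_mkcond; apply: ae_eq_integral => //.
  by apply/(measurable_restrictT _ mD); exact: measurable_funTS.
exists (~` D); split; first exact: measurableC.
  by have := probability_setC P mD; rewrite PD subee.
move=> x /= h Dx; apply: h => _; rewrite patchE mem_set//.
Qed.

(** * Squashing space into a cube, and limits of tight sequences *)

Section cube.
Context (R : realType).

Definition squash (x : R) : R := x / (1 + `|x|).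
(** For |u| = 1 the denominator vanishes and the value is 0. This is harmless: the limit law on the
    cube charges no face, and inside the open cube [unsquash] is a right inverse of [squash]. *)
Definition unsquash (u : R) : R := u / (1 - `|u|).

Lemma normr_squash x : `|squash x| = `|x| / (1 + `|x|).
Proof. by rewrite normrM normfV [X in _ / X]ger0_norm// addr_ge0. Qed.

Lemma squash_lt1 x : `|squash x| < 1.
Proof.
by rewrite normr_squash ltr_pdivrMr ?mul1r ?ltrDr// ltr_pwDl.
Qed.

Lemma unsquashK u : `|u| < 1 -> squash (unsquash u) = u.
Proof.
move=> u1; have u10 : 0 < 1 - `|u| by rewrite subr_gt0.
rewrite /squash /unsquash normrM normfV (gtr0_norm u10).
have -> : 1 + `|u| / (1 - `|u|) = (1 - `|u|)^-1.
  by rewrite -{1}(mulfV (lt0r_neq0 u10)) -mulrDl subrK mul1r.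
by rewrite invrK mulrAC mulfK// gt_eqF.
Qed.

Lemma squash_le x y : (squash x <= squash y) = (x <= y).
Proof.
have p (z : R) : 0 < 1 + `|z| by rewrite ltr_pwDl.
rewrite /squash ler_pdivrMr// mulrAC ler_pdivlMr//.
case: (ger0P x) => x0; case: (ger0P y) => y0; apply/idP/idP; nra.
Qed.

Lemma measurable_squash : measurable_fun setT squash.
Proof.
apply: measurable_funM => //; apply: measurable_inv; apply: measurable_funD => //.
Qed.

Lemma measurable_unsquash : measurable_fun setT unsquash.
Proof.
apply: measurable_funM => //; apply: measurable_inv; apply: measurable_funB => //.
Qed.

End cube.

Section tight_limit.
Context (R : realType) (n : nat).
Implicit Types x u : 'rV[R]_n.

Definition squash_rV x : 'rV[R]_n := \row_i squash (x ord0 i).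
Definition unsquash_rV u : 'rV[R]_n := \row_i unsquash (u ord0 i).

Definition cube : set 'rV[R]_n := [set u | forall i, u ord0 i \in `[-1, 1]].

Lemma compact_cube : compact cube.
Proof.
have := @rV_compact R n (fun=> `[-1, 1]%classic) (fun=> @segment_compact R (-1) 1).
by congr compact.
Qed.

Lemma measurable_allcoord (A : set R) : measurable A ->
  measurable [set u : 'rV[R]_n | forall i, A (u ord0 i)].
Proof.
move=> mA; rewrite (_ : mkset _ = \bigcap_(i in [set: 'I_n]) ((fun u : 'rV[R]_n => u ord0 i) @^-1` A)).
  apply: fin_bigcap_measurable => // i _; rewrite -[X in measurable X]setTI.
  exact: measurable_coord.
by apply/seteqP; split => [u h i _|u h i]; [exact: h|exact: (h i Logic.I)].
Qed.

Lemma measurable_cube : measurable cube.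
Proof. exact: (@measurable_allcoord `[-1, 1]%classic). Qed.

Lemma measurable_squash_rV : measurable_fun setT squash_rV.
Proof.
apply: measurable_mxP => i j; under eq_fun do rewrite mxE.
by apply: (measurableT_comp (@measurable_squash R)); exact: measurable_coord.
Qed.

Lemma measurable_unsquash_rV : measurable_fun setT unsquash_rV.
Proof.
apply: measurable_mxP => i j; under eq_fun do rewrite mxE.
by apply: (measurableT_comp (@measurable_unsquash R)); exact: measurable_coord.
Qed.

Lemma squash_cube x : cube (squash_rV x).
Proof.
move=> i; rewrite mxE in_itv/= -ler_norml; exact/ltW/squash_lt1.
Qed.

Variable P_ : nat -> probability 'rV[R]_n R.
Hypothesis P_tight : forall e : R, 0 < e -> exists k : nat, forall j i,
  (P_ j [set x | (k%:R < `|x ord0 i|)%R] <= e%:E)%E.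
Variables (U : set_system nat) (UU : UltraFilter U).

(** The squashed laws live on a compact cube and have a limit there. Tightness serves to show that
    this limit gives no mass to the faces, so that it can be pulled back to the whole space. *)
Lemma tight_limit : exists Q : probability 'rV[R]_n R,
  forall G : 'rV[R]_n -> R, measurable_fun setT G -> continuous_on cube G ->
    \int[P_ j]_x G (squash_rV x) @[j --> U] --> \int[Q]_x G (squash_rV x).
Proof.
have PU : ProperFilter U by exact: ultra_proper.
have mc := measurable_cube.
pose P' j := projT1 (cid (probability_pushforward (P_ j) measurable_squash_rV)).
have P'E j A : P' j A = P_ j (squash_rV @^-1` A).
  by rewrite /P'; case: cid.
have sq : squash_rV @^-1` cube = setT.
  by apply/seteqP; split => // x _; exact: squash_cube.
have P'K j : P' j cube = 1%E by rewrite P'E sq probability_setT.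
have intP' j G : measurable_fun setT G ->
    \int[P' j]_(u in cube) G u = \int[P_ j]_x G (squash_rV x).
  move=> mG; rewrite /Rintegral (integral_preimage measurable_squash_rV (fun A _ => P'E j A) mc) ?sq//.
  exact/measurable_EFinP.
have [Q' [Q'K Q'lim]] := compact_limit mc compact_cube P'K UU.
pose O : set 'rV[R]_n := [set u | forall i, `]-1, 1[%classic (u ord0 i)].
have mO : measurable O by exact: measurable_allcoord.
have mface i : measurable [set u : 'rV[R]_n | `|u ord0 i| == 1].
  rewrite -[X in measurable X]setTI; apply: measurable_fun_eqr => //.
  by apply: (measurableT_comp (f := @Num.norm _ R)) => //; exact: measurable_coord.
have face0 i : Q' (cube `&` [set u | `|u ord0 i| == 1]) = 0%E.
  have mF : measurable (cube `&` [set u : 'rV[R]_n | `|u ord0 i| == 1]) by exact: measurableI.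
  apply/eqP; rewrite eq_le measure_ge0 andbT; apply/lee_addgt0Pr => e e0; rewrite add0e.
  have [k kP] := P_tight e0.
  (* Equal to 1 on the face and, as |squash x| - 1 = -1/(1 + |x|), zero at squashed points with
     |x_i| <= k. So it majorises the indicator of the face within the cube and, after squashing, is
     majorised by that of the tail. *)
  pose rho (u : 'rV[R]_n) : R := Order.max 0 (k.+1%:R * (`|u ord0 i| - 1) + 1).
  have mrho : measurable_fun setT rho.
    apply: measurable_maxr => //; apply: measurable_funD => //; apply: measurable_funM => //.
    apply: measurable_funB => //; apply: (measurableT_comp (f := @Num.norm _ R)) => //.
    exact: measurable_coord.
  have crho : continuous_on cube rho.
    move=> u _; apply: cvg_within_filter.
    apply: (@cvg_comp _ _ _ (fun u : 'rV[R]_n => u ord0 i)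
      (fun t : R => Order.max 0 (k.+1%:R * (`|t| - 1) + 1)) _ (nbhs (u ord0 i))).
      exact: coord_continuous.
    apply: (@continuous_max R R (cst 0) (fun t : R => k.+1%:R * (`|t| - 1) + 1)).
      exact: cst_continuous.
    apply: cvgD; last exact: cvg_cst.
    apply: cvgM; first exact: cvg_cst.
    by apply: cvgB; [exact: cvg_norm|exact: cvg_cst].
  have rho0 u : 0 <= rho u by rewrite le_max lexx.
  have rho1 u : cube u -> rho u <= 1.
    move=> /(_ i); rewrite in_itv/= -ler_norml => u1.
    rewrite ge_max ler01/= gerDr mulr_ge0_le0// subr_le0//.
  have irho (P : probability 'rV[R]_n R) : P.-integrable cube (EFin \o rho).
    apply: (@measurable_bounded_integrable _ _ _ P) => //.
    - by rewrite (le_lt_trans (probability_le1 _ _))// ltry.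
    - exact: measurable_funTS.
    - exists 1; split; first by rewrite num_real.
      by move=> M M1 u cu /=; rewrite ger0_norm// (le_trans (rho1 _ cu) (ltW M1)).
  have le_e j : \int[P' j]_(u in cube) rho u <= e.
    rewrite intP'// /Rintegral -lee_fin fineK; last first.
      rewrite ge0_fin_numE; last by apply: integral_ge0 => x _; rewrite lee_fin.
      apply: (@le_lt_trans _ _ (\int[P_ j]_x (cst 1%E x))%E).
        apply: ge0_le_integral => //.
        - by move=> x _; rewrite lee_fin.
        - by apply/measurable_EFinP; exact: (measurableT_comp mrho measurable_squash_rV).
        - by move=> x _; rewrite lee_fin rho1//; exact: squash_cube.
      by rewrite integral_cst// mul1e (le_lt_trans (probability_le1 _ _))// ltry.
    apply: le_trans (kP j i).
    have mA : measurable [set x : 'rV[R]_n | k%:R < `|x ord0 i| ].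
      rewrite -[X in measurable X]setTI; apply: measurable_fun_ltr => //.
      by apply: (measurableT_comp (f := @Num.norm _ R)) => //; exact: measurable_coord.
    set A := [set x : 'rV[R]_n | k%:R < `|x ord0 i| ] in mA *.
    have <- : (\int[P_ j]_x (\1_A x)%:E = P_ j A)%E by rewrite integral_indic// setIT.
    apply: ge0_le_integral => //.
    - by move=> x _; rewrite lee_fin.
    - by apply/measurable_EFinP; exact: (measurableT_comp mrho measurable_squash_rV).
    - by apply/measurable_EFinP; exact: measurable_indic.
    - move=> x _; rewrite lee_fin indicE.
      have [xA|xA] := boolP (x \in _); first by rewrite rho1//; exact: squash_cube.
      move: xA; rewrite notin_setE/= => /negP; rewrite -leNgt => xk.
      rewrite ge_max lexx/= /squash_rV mxE normr_squash.
      have p : 0 < 1 + `|x ord0 i| by rewrite ltr_pwDl.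
      have -> : `|x ord0 i| / (1 + `|x ord0 i|) - 1 = - (1 + `|x ord0 i|)^-1.
        by field; rewrite gt_eqF.
      rewrite mulrN addrC subr_le0 ler_pdivlMr// mul1r -natr1 addrC.
      by rewrite lerD2r.
  have le_Q : \int[Q']_(u in cube) rho u <= e.
    rewrite -(cvg_lim _ (Q'lim rho mrho crho))//; apply: limr_le; last exact: nearW.
    by apply/cvg_ex; eexists; exact: (Q'lim rho mrho crho).
  apply: (@le_trans _ _ (\int[Q']_(u in cube) (rho u)%:E)%E); last first.
    by rewrite -[X in (X <= _)%E]fineK ?lee_fin//; exact: (integrable_fin_num mc (irho Q')).
  rewrite setIC -integral_indic//; last exact: mface.
  apply: ge0_le_integral => //.
  - by apply/measurable_EFinP; apply: measurable_indic; exact: mface.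
  - by apply/measurable_EFinP; exact: measurable_funTS.
  - move=> u _; rewrite lee_fin indicE; have [|uA] := boolP (u \in _); last exact: rho0.
    by rewrite inE/= => /eqP u1; rewrite /rho u1 subrr mulr0 add0r le_max lexx orbT.
have Q'O : Q' O = 1%E.
  rewrite -Q'K; apply/eqP; rewrite eq_le; apply/andP; split.
    apply: le_measure; rewrite ?inE//.
    by move=> u Ou i; have := Ou i; rewrite /= !in_itv/= => /andP[/ltW -> /ltW ->].
  rewrite (measureDI Q' mc mO) [X in (X + _)%E](_ : _ = 0%E) ?add0e.
    by apply: le_measure; rewrite ?inE//; exact: measurableI.
  apply/eqP; rewrite eq_le measure_ge0 andbT.
  pose F i := cube `&` [set u : 'rV[R]_n | `|u ord0 i| == 1].
  have mF i : measurable (F i) by exact: measurableI.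
  have F0 (r : seq 'I_n) : Q' (\big[setU/set0]_(i <- r) F i) = 0%E.
    elim: r => [|i r ih]; first by rewrite big_nil measure0.
    rewrite big_cons null_set_setU//; first exact: bigsetU_measurable.
    exact: face0.
  rewrite -(F0 (index_enum 'I_n)); apply: le_measure; rewrite ?inE//.
  - exact: measurableD.
  - exact: bigsetU_measurable.
  move=> u [cu]; rewrite -bigcup_seq => /existsNP[i ui]; exists i; rewrite /= ?mem_index_enum//.
  split => //; have := cu i; rewrite in_itv/= -ler_norml => u1.
  rewrite /= eq_le u1/= leNgt; apply/negP => ul; apply: ui.
  by rewrite /= in_itv/= -ltr_norml.
have [Q QE] := probability_pushforward Q' measurable_unsquash_rV.
exists Q => G mG cG.
have mGs : measurable_fun setT (fun x => (G (squash_rV x))%:E).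
  by apply/measurable_EFinP; exact: (measurableT_comp mG measurable_squash_rV).
have -> : \int[Q]_x G (squash_rV x) = \int[Q']_(u in cube) G u.
  rewrite /Rintegral; congr fine.
  rewrite (integral_preimage measurable_unsquash_rV (fun A _ => QE A)) ?preimage_setT//.
  have mG' : measurable_fun setT (fun u => (G u)%:E) by exact/measurable_EFinP.
  rewrite -(integral_full mc Q'K mG').
  rewrite (integral_full mO Q'O (measurableT_comp mGs measurable_unsquash_rV)).
  rewrite (integral_full mO Q'O mG').
  apply: eq_integral => u; rewrite inE => Ou; congr (G _)%:E.
  apply/rowP => i; rewrite !mxE unsquashK//.
  by have := Ou i; rewrite /= in_itv/= -ltr_norml.
by under eq_fun do rewrite -intP'//; exact: Q'lim.
Qed.

End tight_limit.

(** * Gaussian measures *)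

Section entrywise_convergence.
Context (R : realType) (T : Type) (F : set_system T) (FF : Filter F).

Lemma cvg_mulmx m n p (A_ : T -> 'M[R]_(m, n)) (B_ : T -> 'M[R]_(n, p))
    (A : 'M[R]_(m, n)) (B : 'M[R]_(n, p)) :
  (forall i j, A_ t i j @[t --> F] --> A i j) ->
  (forall i j, B_ t i j @[t --> F] --> B i j) ->
  forall i j, (A_ t *m B_ t) i j @[t --> F] --> (A *m B) i j.
Proof.
move=> cA cB i j; rewrite mxE; under eq_fun do rewrite mxE.
by apply: cvg_sumr => k; apply: cvgM.
Qed.

Lemma cvg_det n (A_ : T -> 'M[R]_n) (A : 'M[R]_n) :
  (forall i j, A_ t i j @[t --> F] --> A i j) -> \det (A_ t) @[t --> F] --> \det A.
Proof.
move=> cA; apply: cvg_sumr => s; apply: cvgM; first exact: cvg_cst.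
by apply: cvg_prodr.
Qed.

Lemma cvg_invmx n (A_ : T -> 'M[R]_n) (A : 'M[R]_n) :
  (forall i j, A_ t i j @[t --> F] --> A i j) ->
  (forall t, \det (A_ t) != 0) -> \det A != 0 ->
  forall i j, invmx (A_ t) i j @[t --> F] --> invmx A i j.
Proof.
move=> cA dA_ dA i j.
have invE (B : 'M[R]_n) : \det B != 0 ->
    invmx B i j = (\det B)^-1 * ((-1) ^+ (j + i) * \det (row' j (col' i B))).
  by move=> dB; rewrite /invmx unitmxE unitfE dB !mxE.
rewrite invE//; under eq_fun do rewrite invE//.
apply: cvgM; first by apply: cvgV => //; exact: cvg_det.
apply: cvgM; first exact: cvg_cst.
by apply: cvg_det => k l; rewrite !mxE; under eq_fun do rewrite !mxE; exact: cA.
Qed.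

End entrywise_convergence.

Section positive_definite.
Context (R : realType) (d : nat).
Implicit Types (A B : 'M[R]_d) (v w : 'rV[R]_d).

Lemma sqnormE v : sqnorm v = (v *m v^T) ord0 ord0.
Proof. by rewrite mxE; apply: eq_bigr => i _; rewrite mxE expr2. Qed.

Lemma sqnorm_ge0 v : 0 <= sqnorm v.
Proof. by apply: sumr_ge0 => i _; exact: sqr_ge0. Qed.

Lemma sqnorm_gt0 v : v != 0 -> 0 < sqnorm v.
Proof.
move=> v0; rewrite lt_def sqnorm_ge0 andbT; apply: contra v0 => /eqP s0.
apply/eqP/rowP => i; rewrite mxE; apply/eqP; rewrite -sqrf_eq0; apply/eqP.
by apply: (psumr_eq0P _ s0) => // j _; exact: sqr_ge0.
Qed.

Lemma scalar_quad (c : R) v : (v *m c%:M *m v^T) ord0 ord0 = c * sqnorm v.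
Proof. by rewrite mul_mx_scalar -scalemxAl mxE -sqnormE. Qed.

Lemma loewner_quad A B v : loewner_le A B ->
  (v *m A *m v^T) ord0 ord0 <= (v *m B *m v^T) ord0 ord0.
Proof.
move=> [_ /(_ v)]; rewrite mulmxBr mulmxBl.
by rewrite [X in 0 <= X]mxE [X in _ + X]mxE subr_ge0.
Qed.

Lemma pd_scalar (c : R) : 0 < c -> pd (c%:M : 'M[R]_d).
Proof.
move=> c0; split; first by rewrite tr_scalar_mx.
by move=> v v0; rewrite scalar_quad mulr_gt0// sqnorm_gt0.
Qed.

Lemma pd_loewner (a : R) A : A^T = A -> 0 < a -> loewner_le a%:M A -> pd A.
Proof.
move=> sA a0 aA; split => // v v0; apply: lt_le_trans (loewner_quad v aA).
by rewrite scalar_quad mulr_gt0// sqnorm_gt0.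
Qed.

Lemma pd_det_neq0 A : pd A -> \det A != 0.
Proof.
move=> [_ pA]; apply/det0P => -[v v0 vA].
by have := pA v v0; rewrite vA mul0mx mxE ltxx.
Qed.

(* The segment from the identity to A stays positive definite. *)
Lemma pd_det_gt0 A : pd A -> 0 < \det A.
Proof.
move=> pA; rewrite ltNge; apply/negP => dA.
pose f (t : R) := \det ((1 - t) *: 1%:M + t *: A).
have cf : continuous f.
  move=> t; apply: cvg_det => i j; rewrite !mxE; under eq_fun do rewrite !mxE.
  apply: cvgD; apply: cvgM; try exact: cvg_cst; last exact: cvg_id.
  by apply: cvgB; [exact: cvg_cst|exact: cvg_id].
have [|t t01 ft] := @IVT R f 0 1 0 ler01 (continuous_subspaceT cf).
  rewrite /f subr0 scale0r addr0 scale1r det1 subrr scale0r add0r scale1r.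
  by rewrite ge_min dA orbT le_max ler01.
have : pd ((1 - t) *: 1%:M + t *: A).
  split; first by rewrite linearD /= !linearZ /= tr_scalar_mx (proj1 pA).
  move=> v v0; move: t01; rewrite in_itv/= => /andP[t0 t1].
  rewrite mulmxDr mulmxDl -!scalemxAr -!scalemxAl mulmx1.
  rewrite [X in 0 < X]mxE [X in 0 < X + _]mxE [X in 0 < _ + X]mxE -sqnormE.
  have := sqnorm_gt0 v0; have := (proj2 pA) v v0.
  move: t0; rewrite le_eqVlt => /predU1P[<-|t0] h1 h2.
    by rewrite subr0 mul1r mul0r addr0.
  by rewrite ltr_wpDl// ?mulr_gt0// mulr_ge0 ?subr_ge0// ltW.
by move=> /pd_det_neq0; rewrite -/(f t) ft eqxx.
Qed.

(** Expand z A z^T >= 0 for z = v A^-1 - v/b: this gives v A^-1 v^T - 2|v|^2/b + v A v^T / b^2 >= 0,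
    and v A v^T <= b|v|^2. No diagonalisation is involved. *)
Lemma pd_inv_quad A (b : R) v : pd A -> 0 < b -> loewner_le A b%:M ->
  sqnorm v / b <= (v *m invmx A *m v^T) ord0 ord0.
Proof.
move=> pA b0 Ab; have uA : A \in unitmx by rewrite unitmxE unitfE pd_det_neq0.
have [w vE wE] : exists2 w, v = w *m A & v *m invmx A = w.
  by exists (v *m invmx A); rewrite ?mulmxKV.
pose z := w - b^-1 *: v.
have z0 : 0 <= (z *m A *m z^T) ord0 ord0.
  have [->|zn] := eqVneq z 0; first by rewrite !mul0mx mxE.
  by rewrite ltW//; exact: (proj2 pA).
have wA : w *m A = v by rewrite -vE.
have Aw : A *m w^T = v^T by rewrite vE trmx_mul (proj1 pA).
have qv : (v *m A *m v^T) ord0 ord0 <= b * sqnorm v.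
  by rewrite -scalar_quad; exact: loewner_quad.
have zE : (z *m A *m z^T) ord0 ord0 = (w *m v^T) ord0 ord0 - b^-1 * sqnorm v *+ 2
    + b^-1 ^+ 2 * (v *m A *m v^T) ord0 ord0.
  have zA : z *m A = v - b^-1 *: (v *m A) by rewrite /z mulmxBl -scalemxAl wA.
  have zT : z^T = w^T - b^-1 *: v^T by rewrite /z linearB linearZ.
  rewrite zA zT mulmxBr !mulmxBl.
  rewrite -!scalemxAl -!scalemxAr -[v *m A *m w^T]mulmxA Aw.
  have -> : v *m w^T = w *m v^T.
    by rewrite [in RHS]vE trmx_mul (proj1 pA) mulmxA -vE.
  have eB (X Y : 'M[R]_1) : (X - Y) ord0 ord0 = X ord0 ord0 - Y ord0 ord0 by rewrite !mxE.
  have eZ k (X : 'M[R]_1) : (k *: X) ord0 ord0 = k * X ord0 ord0 by rewrite !mxE.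
  by rewrite !(eB, eZ) sqnormE; ring.
rewrite zE in z0.
have : b^-1 ^+ 2 * (v *m A *m v^T) ord0 ord0 <= b^-1 * sqnorm v.
  rewrite expr2 -mulrA ler_pM2l ?invr_gt0// mulrC ler_pdivrMr// mulrC.
  exact: qv.
rewrite wE mulrC; move: z0; rewrite mulr2n; lra.
Qed.

End positive_definite.

(** * Lebesgue integrals of products and Gaussian envelopes *)

Section lebesgue_rV_products.
Context (R : realType).
Implicit Types f : R -> R.

Lemma prod_cons_rV f n (p : measurableTypeR R * 'rV[R]_n) :
  \prod_(i < 1 + n) f (cons_rV p ord0 i) = f p.1 * \prod_(i < n) f (p.2 ord0 i).
Proof.
rewrite big_split_ord/= big_ord1; congr (f _ * _).
  by rewrite /cons_rV row_mxEl mxE eqxx mulr1n.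
by apply: eq_bigr => i _; rewrite /cons_rV row_mxEr.
Qed.

Lemma measurable_prod_coord f n : measurable_fun setT f ->
  measurable_fun setT (fun x : 'rV[R]_n => \prod_i f (x ord0 i)).
Proof.
move=> mf; apply: measurable_prod => i _.
by apply: (measurableT_comp mf); exact: measurable_coord.
Qed.

(** Tonelli, one coordinate at a time, along the recursive construction of the measure. In dimension
    0 it is a Dirac mass and the product is empty, so both sides are 1. *)
Lemma integral_lebesgue_rV_prod f (r : R) n : measurable_fun setT f -> (forall t, 0 <= f t) ->
  (\int[lebesgue_measure]_t (f t)%:E = r%:E)%E ->
  (\int[lebesgue_rV R n]_x (\prod_i f (x ord0 i))%:E = (r ^+ n)%:E)%E.
Proof.
move=> mf f0 fr.
have r0 : 0 <= r by rewrite -lee_fin -fr; apply: integral_ge0 => t _; rewrite lee_fin.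
elim: n => [|n ih].
  rewrite /= integral_dirac//; first by rewrite big_ord0 diracT mul1e.
  by apply/measurable_EFinP; exact: measurable_prod_coord.
rewrite (@ge0_integral_preimage _ _ _ _ _ (@lebesgue_measure R \x lebesgue_rV R n)%E
  (lebesgue_rV R n.+1) _ _ (fun x => (\prod_i f (x ord0 i))%:E) (@measurable_cons_rV R n))//.
- rewrite preimage_setT.
  under eq_integral do rewrite prod_cons_rV.
  rewrite fubini_tonelli1.
  + rewrite /fubini_F /=.
    under eq_integral => t _.
      under eq_integral do rewrite EFinM.
      rewrite ge0_integralZl//; last 3 first.
      * by apply/measurable_EFinP; exact: measurable_prod_coord.
      * by move=> x _; rewrite lee_fin prodr_ge0.
      * by rewrite lee_fin.
      rewrite ih.
      over.
    rewrite ge0_integralZr//.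
    * by rewrite fr -EFinM exprS.
    * exact/measurable_EFinP.
    * by move=> t _; rewrite lee_fin.
    * by rewrite lee_fin exprn_ge0.
  + apply/measurable_EFinP; apply: measurable_funM.
      exact: (measurableT_comp mf measurable_fst).
    exact: (measurableT_comp (measurable_prod_coord mf) measurable_snd).
  + by move=> p; rewrite lee_fin mulr_ge0// prodr_ge0.
- by apply/measurable_EFinP; exact: measurable_prod_coord.
- by move=> x; rewrite lee_fin prodr_ge0.
Qed.

Lemma integral_gauss1 (k : R) : 0 < k ->
  exists r : R, (\int[lebesgue_measure]_t (expR (- (k * t ^+ 2)))%:E = r%:E)%E.
Proof.
(* The standard deviation for which t^2/(2 s^2) = k t^2; the integrand is then a multiple of a
   normal density. *)
move=> k0; pose s := Num.sqrt (k *+ 2)^-1.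
have s2 : s ^+ 2 = (k *+ 2)^-1 by rewrite sqr_sqrtr// invr_ge0 mulrn_wge0// ltW.
have s0 : s != 0 by rewrite -sqrf_eq0 s2 invr_eq0 mulrn_eq0/= gt_eqF.
have pk : normal_peak s != 0 by rewrite gt_eqF// normal_peak_gt0.
exists (normal_peak s)^-1.
have fE t : (expR (- (k * t ^+ 2)))%:E = ((normal_peak s)^-1%:E * (normal_pdf 0 s t)%:E)%E.
  rewrite -EFinM /normal_pdf (negbTE s0) mulKf// /normal_fun subr0 s2.
  by congr (expR _)%:E; field; rewrite gt_eqF.
under eq_integral do rewrite fE.
rewrite ge0_integralZl//.
- by rewrite integral_normal_pdf mule1.
- by apply/measurable_EFinP; exact: measurable_normal_pdf.
- by move=> t _; rewrite lee_fin normal_pdf_ge0.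
- by rewrite lee_fin invr_ge0 normal_peak_ge0.
Qed.

Definition gauss_envelope n (k : R) (x : 'rV[R]_n) : R := expR (- (k * sqnorm x)).

Lemma gauss_envelopeE n k (x : 'rV[R]_n) :
  gauss_envelope k x = \prod_i expR (- (k * x ord0 i ^+ 2)).
Proof. by rewrite /gauss_envelope /sqnorm mulr_sumr -sumrN expR_sum. Qed.

Lemma measurable_gauss1 (k : R) : measurable_fun setT (fun t : R => expR (- (k * t ^+ 2))).
Proof.
by apply: (measurableT_comp (f := @expR R)) => //; apply: measurable_funN;
  apply: measurable_funM => //; exact: measurable_funX.
Qed.

Lemma measurable_gauss_envelope n k : measurable_fun setT (@gauss_envelope n k).
Proof.
rewrite (_ : gauss_envelope k = fun x => \prod_i expR (- (k * x ord0 i ^+ 2))).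
  exact: (@measurable_prod_coord (fun t => expR (- (k * t ^+ 2))) n (measurable_gauss1 k)).
by apply/funext => x; exact: gauss_envelopeE.
Qed.

Lemma integrable_gauss_envelope n k : 0 < k ->
  (lebesgue_rV R n).-integrable setT (EFin \o @gauss_envelope n k).
Proof.
move=> k0; apply/integrableP; split.
  by apply/measurable_EFinP; exact: measurable_gauss_envelope.
have [r fr] := integral_gauss1 k0.
under eq_integral do rewrite /= ger0_norm ?expR_ge0// gauss_envelopeE.
rewrite (@integral_lebesgue_rV_prod (fun t => expR (- (k * t ^+ 2))) r n) ?ltry//.
exact: measurable_gauss1.
Qed.

Lemma gaussian_standard n : gaussian (0 : 'rV[R]_n) 1%:M setT = 1%E.
Proof.
rewrite /gaussian.
have fE (x : 'rV[R]_n) : gaussian_pdf 0 1%:M x = \prod_i normal_pdf 0 1 (x ord0 i).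
  rewrite /gaussian_pdf subr0 det1 mulr1 invmx1 mulmx1 -sqnormE.
  under [RHS]eq_bigr do rewrite /normal_pdf oner_eq0.
  rewrite big_split/= prodr_const card_ord; congr (_ * _).
    rewrite /normal_peak expr1n mul1r exprVn; congr (_^-1).
    by elim: n {x} => [|n ih]; rewrite ?expr0 ?sqrtr1// !exprS sqrtrM ?ih// mulrn_wge0// pi_ge0.
  rewrite /normal_fun -expR_sum; congr expR.
  rewrite /sqnorm mulNr mulr_suml -sumrN; apply: eq_bigr => i _.
  by rewrite subr0 expr1n mulNr.
under eq_integral do rewrite fE.
rewrite (@integral_lebesgue_rV_prod _ 1 n) ?expr1n//.
- exact: measurable_normal_pdf.
- by move=> t; exact: normal_pdf_ge0.
- by rewrite integral_normal_pdf.
Qed.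

End lebesgue_rV_products.

Section continuity_on_sets.
Context (R : realType) (n : nat) (K : set 'rV[R]_n).

(** Reduces continuity of parameter integrals to sequences, for which dominated convergence is
    available. *)
Lemma continuous_on_seq (f : 'rV[R]_n -> R) :
  (forall p (x_ : nat -> 'rV[R]_n), K p -> (forall N, K (x_ N)) ->
    x_ @ \oo --> p -> f (x_ N) @[N --> \oo] --> f p) ->
  continuous_on K f.
Proof.
move=> fseq p Kp; apply/cvgrPdist_le => e e0; apply: contrapT => nnear.
have ex N : exists x, [/\ K x, ball p N.+1%:R^-1 x & e < `|f p - f x|].
  apply: contrapT => /forallNP no; apply: nnear.
  apply/nbhs_ballP; exists N.+1%:R^-1; first by rewrite /= invr_gt0.
  move=> x bx Kx; rewrite leNgt; apply/negP => fx.
  by apply: (no x).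
pose x_ N := projT1 (cid (ex N)).
have xP N : [/\ K (x_ N), ball p N.+1%:R^-1 (x_ N) & e < `|f p - f (x_ N)|].
  exact: (projT2 (cid (ex N))).
have xp : x_ @ \oo --> p.
  apply/cvg_ballP => r r0; exists (Num.bound r^-1) => // N /= bN.
  have [_ bx _] := xP N; apply: le_ball bx.
  rewrite -[leRHS]invrK lef_pV2 ?posrE ?invr_gt0//.
  apply: (le_trans (ltW (archi_boundP _))); first by rewrite invr_ge0 ltW.
  by rewrite ler_nat (leq_trans bN).
have Kx N : K (x_ N) by have [] := xP N.
have /cvgrPdist_lt /(_ e e0) [N _ /(_ N (leqnn N)) /=] := fseq p x_ Kp Kx xp.
by have [_ _ h] := xP N; rewrite ltNge (ltW h).
Qed.

Lemma continuous_on_bounded (f : 'rV[R]_n -> R) : compact K -> continuous_on K f ->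
  exists2 C, 0 <= C & forall x, K x -> `|f x| <= C.
Proof.
move=> cK cf; apply: contrapT => /forall2NP no.
have ex (N : nat) : exists x, K x /\ N%:R < `|f x|.
  have [//|/existsNP[x /not_implyP[Kx fx]]] := no N%:R.
  by exists x; split => //; rewrite ltNge; exact/negP.
pose x_ N := projT1 (cid (ex N)).
have xP N : K (x_ N) /\ N%:R < `|f (x_ N)| by exact: (projT2 (cid (ex N))).
have [V [UV ooV]] := @ultraFilterLemma nat \oo _.
have PV : ProperFilter V by exact: ultra_proper.
have Kx N : K (x_ N) by have [] := xP N.
have [p Kp xp] := compact_ultra_cvg cK UV Kx.
have fx := continuous_on_cvg cf Kx Kp xp.
have nfx : `|f (x_ N)| @[N --> V] --> `|f p| by apply: cvg_norm; exact: fx.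
have near1 : \forall N \near V, `|f (x_ N)| < `|f p| + 1.
  by apply: (cvgr_lt _ nfx); rewrite ltrDl.
have near2 : \forall N \near V, (Num.bound (`|f p| + 1) <= N)%N.
  by apply: ooV; exists (Num.bound (`|f p| + 1)).
have [N [/= h1 h2]] := filter_ex (filterI near1 near2).
have [_ h3] := xP N.
have := lt_trans h3 h1; rewrite ltNge => /negP; apply.
apply: (le_trans (ltW (archi_boundP _))); first by rewrite addr_ge0.
by rewrite ler_nat.
Qed.

End continuity_on_sets.

Section parameters.
Context (R : realType) (d : nat).
Implicit Types theta : 'rV[R]_(d + symdim d).

Lemma sorted_pairC (i j : 'I_d) : sorted_pair i j = sorted_pair j i.
Proof.
by apply: val_inj => /=; case: ltngtP => // /val_inj ->.
Qed.

Lemma cov_sym theta : (cov theta)^T = cov theta.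
Proof. by apply/matrixP => i j; rewrite !mxE sorted_pairC. Qed.

Lemma standard_parameter : exists theta, mean theta = 0 :> 'rV[R]_d /\ cov theta = 1%:M.
Proof.
pose sigma : 'rV[R]_(symdim d) :=
  \row_k (((val (enum_val k : upper_pair d)).1 == (val (enum_val k : upper_pair d)).2)%:R).
exists (row_mx 0 sigma); rewrite /mean /cov row_mxKl row_mxKr; split => //.
apply/matrixP => i j; rewrite !mxE enum_rankK /=.
by case: (leqP i j); rewrite //= eq_sym.
Qed.

Lemma mean_coord theta i : mean theta ord0 i = theta ord0 (lshift _ i).
Proof. by rewrite mxE. Qed.

Lemma cov_coord theta i j : cov theta i j =
  theta ord0 (rshift d (enum_rank (sorted_pair i j))).
Proof. by rewrite !mxE. Qed.

(** The mass is the moment of order zero, hence given by a polynomial of degree at most 0 wherever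
    Sigma is positive definite. Being constant, it equals its value at the standard Gaussian, whose
    density is a product of one-dimensional ones. *)
Lemma gaussian_mass (p0 : mpoly (d + symdim d) R) theta :
  gaussian_moment_poly (fun=> 0%N) p0 -> pd (cov theta) ->
  gaussian (mean theta) (cov theta) setT = 1%E.
Proof.
move=> [szp pE] pdt.
have mass t : pd (cov t) -> (peval p0 t)%:E = gaussian (mean t) (cov t) setT.
  move=> pt; rewrite pE//; under eq_integral do rewrite /monomial big1//.
  by rewrite integral_cst// mul1e.
have [t0 [m0 c0]] := standard_parameter.
rewrite -mass//.
have : (mmeasure mdeg p0 <= 1)%N by move: szp; rewrite big1.
move=> /msize1_polyC ->; rewrite /peval mevalC.
have := mass t0; rewrite c0 m0 gaussian_standard => /(_ (pd_scalar _ ltr01)).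
have : (mmeasure mdeg p0 <= 1)%N by move: szp; rewrite big1.
by move=> /msize1_polyC {1}->; rewrite /peval mevalC.
Qed.

End parameters.

(** * Uniform estimates for Gaussians with parameters in S *)

Section gaussian_family.
Context (R : realType) (d : nat) (S : set 'rV[R]_(d + symdim d)).
Implicit Types theta : 'rV[R]_(d + symdim d).
Variables (a b rad : R) (p0 : mpoly (d + symdim d) R).
Hypotheses (mS : measurable S) (cS : compact S) (a_gt0 : 0 < a) (b_gt0 : 0 < b).
Hypothesis S_cov : forall theta, S theta ->
  loewner_le a%:M (cov theta) /\ loewner_le (cov theta) b%:M.
Hypothesis S_ball : forall theta, S theta -> sqnorm theta <= rad ^+ 2.
Hypothesis p0_moment : gaussian_moment_poly (fun=> 0%N) p0.

Lemma S_pd theta : S theta -> pd (cov theta).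
Proof. by move=> /S_cov[aS _]; apply: pd_loewner aS => //; exact: cov_sym. Qed.

Lemma S_mass theta : S theta -> gaussian (mean theta) (cov theta) setT = 1%E.
Proof. by move=> St; apply: gaussian_mass (S_pd St); exact: p0_moment. Qed.

Lemma measurable_pdf_x theta :
  measurable_fun setT (gaussian_pdf (mean theta) (cov theta)).
Proof. by apply: measurable_gaussian_pdf => // i j; exact: measurable_coord. Qed.

Definition gauss_norm theta : R := (Num.sqrt ((pi *+ 2) ^+ d * \det (cov theta)))^-1.

Let cvg_cov (x_ : nat -> 'rV[R]_(d + symdim d)) p : x_ @ \oo --> p ->
  forall i j, cov (x_ N) i j @[N --> \oo] --> cov p i j.
Proof.
by move=> xp i j; rewrite cov_coord; under eq_fun do rewrite cov_coord; exact: cvg_coord xp.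
Qed.

Let cvg_mean (x_ : nat -> 'rV[R]_(d + symdim d)) p : x_ @ \oo --> p ->
  forall i, mean (x_ N) ord0 i @[N --> \oo] --> mean p ord0 i.
Proof.
by move=> xp i; rewrite mean_coord; under eq_fun do rewrite mean_coord; exact: cvg_coord xp.
Qed.

Let sqrt_arg_gt0 theta : S theta -> 0 < Num.sqrt ((pi *+ 2) ^+ d * \det (cov theta)).
Proof.
move=> St; rewrite sqrtr_gt0; apply: mulr_gt0; last by apply: pd_det_gt0; exact: S_pd.
by apply: exprn_gt0; rewrite mulrn_wgt0// pi_gt0.
Qed.

Let cvg_gauss_norm (x_ : nat -> 'rV[R]_(d + symdim d)) p : S p -> x_ @ \oo --> p ->
  gauss_norm (x_ N) @[N --> \oo] --> gauss_norm p.
Proof.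
move=> Sp xp; apply: cvgV; first by rewrite gt_eqF// sqrt_arg_gt0.
apply: (continuous_cvg _ (@sqrt_continuous R _)).
by apply: cvgM; [exact: cvg_cst|apply: cvg_det; exact: cvg_cov].
Qed.

Lemma cvg_gaussian_pdf (x_ : nat -> 'rV[R]_(d + symdim d)) p y :
  S p -> (forall N, S (x_ N)) -> x_ @ \oo --> p ->
  gaussian_pdf (mean (x_ N)) (cov (x_ N)) y @[N --> \oo] --> gaussian_pdf (mean p) (cov p) y.
Proof.
move=> Sp Sx xp; apply: cvgM; first exact: (cvg_gauss_norm Sp xp).
apply: (continuous_cvg _ (@continuous_expR R _)).
apply: cvgM; last exact: cvg_cst.
apply: cvgN.
have cym i j : (y - mean (x_ N)) i j @[N --> \oo] --> (y - mean p) i j.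
  rewrite ord1 !mxE; under eq_fun do rewrite !mxE -mean_coord.
  by rewrite -mean_coord; apply: cvgB; [exact: cvg_cst|exact: cvg_mean].
apply: cvg_mulmx.
  apply: cvg_mulmx => //; apply: cvg_invmx; first exact: cvg_cov.
    by move=> N; apply: pd_det_neq0; exact: S_pd.
  by apply: pd_det_neq0; exact: S_pd.
by move=> i j; rewrite mxE; under eq_fun do rewrite mxE; exact: cym.
Qed.

Lemma sqnorm_mean theta : sqnorm (mean theta) <= sqnorm theta.
Proof.
rewrite /sqnorm big_split_ord/= -[leLHS]addr0; apply: lerD.
  by apply: ler_sum => i _; rewrite mean_coord.
by apply: sumr_ge0 => i _; exact: sqr_ge0.
Qed.

(* [|x - m|^2 >= |x|^2 / 2 - |m|^2], and [m] is bounded on [S]. *)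
Lemma gaussian_pdf_le : exists2 C, 0 <= C &
  forall theta x, S theta -> gaussian_pdf (mean theta) (cov theta) x <=
    C * gauss_envelope (b *+ 4)^-1 x.
Proof.
(* The normalising factor is bounded on S by continuity and compactness, instead of by a lower bound
   on the determinant. *)
have [|C C0 CP] := @continuous_on_bounded R _ S gauss_norm cS.
  by apply: continuous_on_seq => p x_ Sp Sx xp; exact: cvg_gauss_norm.
(* From half the quadratic form, at least |x - m|^2/(2b) >= |x|^2/(4b) - rad^2/(2b). *)
exists (C * expR (rad ^+ 2 / (b *+ 2))); first by rewrite mulr_ge0// expR_ge0.
move=> theta x St; rewrite /gaussian_pdf /gauss_envelope -mulrA -expRD.
apply: ler_pM; rewrite ?expR_ge0 ?invr_ge0//.
  by apply: le_trans (CP _ St); exact: ler_norm.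
rewrite ler_expR mulNr.
have h1 := pd_inv_quad (x - mean theta) (S_pd St) b_gt0 (proj2 (S_cov St)).
have h2 : sqnorm (mean theta) <= rad ^+ 2 by apply: le_trans (sqnorm_mean _) (S_ball St).
have h3 : sqnorm x / 2 - sqnorm (mean theta) <= sqnorm (x - mean theta).
  rewrite /sqnorm mulr_suml -sumrB; apply: ler_sum => i _; rewrite [in leRHS]mxE [in leRHS]mxE.
  have := sqr_ge0 (x ord0 i / 2 - mean theta ord0 i); nra.
set q := (_ *m _) _ _ in h1 *.
have -> : rad ^+ 2 / (b *+ 2) + - ((b *+ 4)^-1 * sqnorm x) =
    - ((sqnorm x / 2 - rad ^+ 2) / b / 2) by field; rewrite gt_eqF.
rewrite lerN2 ler_pM2r//; apply: le_trans h1.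
by rewrite ler_pM2r ?invr_gt0//; lra.
Qed.

Local Notation N_ theta := (gaussian (mean theta) (cov theta)).

Lemma ge0_integral_gaussian (f : 'rV[R]_d -> \bar R) theta : measurable_fun setT f ->
  (forall x, 0 <= f x)%E ->
  (\int[N_ theta]_x f x =
   \int[lebesgue_rV R d]_x (f x * (gaussian_pdf (mean theta) (cov theta) x)%:E))%E.
Proof.
move=> mf f0; apply: ge0_integral_density => //; first exact: measurable_pdf_x.
by move=> x; exact: gaussian_pdf_ge0.
Qed.

Lemma measurable_integral_gaussian (f : 'rV[R]_d -> \bar R) : measurable_fun setT f ->
  (forall x, 0 <= f x)%E ->
  measurable_fun setT (fun theta => \int[N_ theta]_x f x)%E.
Proof.
move=> mf f0; under eq_fun do rewrite ge0_integral_gaussian//.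
apply: (@measurable_fun_fubini_tonelli_F _ _ _ _ _ (lebesgue_rV R d)
  (fun p : 'rV[R]_(d + symdim d) * 'rV[R]_d =>
     (f p.2 * (gaussian_pdf (mean p.1) (cov p.1) p.2)%:E)%E)).
- apply: emeasurable_funM; first exact: (measurableT_comp mf measurable_snd).
  apply/measurable_EFinP; apply: measurable_gaussian_pdf => i j.
  + under eq_fun do rewrite mxE.
    exact: (measurableT_comp (measurable_coord _ _) measurable_fst).
  + exact: (measurableT_comp (measurable_coord _ _) measurable_snd).
  + under eq_fun do rewrite cov_coord.
    exact: (measurableT_comp (measurable_coord _ _) measurable_fst).
- by move=> p; rewrite mule_ge0// lee_fin gaussian_pdf_ge0.
Qed.

Lemma S_probability (f : 'rV[R]_d -> R) (M : R) theta : S theta -> measurable_fun setT f ->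
  (forall x, 0 <= f x <= M) -> (0 <= \int[N_ theta]_x (f x)%:E <= M%:E)%E.
Proof.
move=> St mf fM; apply/andP; split.
  by apply: integral_ge0 => x _; rewrite lee_fin; have /andP[] := fM x.
apply: (@le_trans _ _ (\int[N_ theta]_x (cst M%:E x))%E).
  apply: ge0_le_integral => //.
  - by move=> x _; rewrite lee_fin; have /andP[] := fM x.
  - exact/measurable_EFinP.
  - by move=> x _; rewrite lee_fin; have /andP[] := fM x.
by rewrite integral_cst// -[X in (_ * X)%E]/(N_ theta setT) S_mass// mule1.
Qed.

(** Regularity in theta comes from the density and not from f, by dominated convergence under M C
    exp(-|x|^2/(4b)). *)
Lemma continuous_integral_gaussian (f : 'rV[R]_d -> R) (M : R) : measurable_fun setT f ->
  (forall x, 0 <= f x <= M) -> continuous_on S (fun theta => \int[N_ theta]_x f x).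
Proof.
move=> mf fM; apply: continuous_on_seq => p x_ Sp Sx xp.
have f0 x : 0 <= f x by have /andP[] := fM x.
have mfE : measurable_fun setT (EFin \o f) by exact/measurable_EFinP.
have [C C0 CP] := gaussian_pdf_le.
have k0 : 0 < (b *+ 4)^-1 by rewrite invr_gt0 mulrn_wgt0.
have fin theta : S theta -> (\int[N_ theta]_x (f x)%:E)%E \is a fin_num.
  move=> St; have /andP[h1 h2] := S_probability St mf fM.
  by rewrite ge0_fin_numE// (le_lt_trans h2)// ltry.
have f0E x : (0 <= (EFin \o f) x)%E by rewrite lee_fin.
have E theta := ge0_integral_gaussian theta mfE f0E.
suff L : ((\int[lebesgue_rV R d]_x ((f x)%:E * (gaussian_pdf (mean (x_ N)) (cov (x_ N)) x)%:E))%E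
    @[N --> \oo] --> (\int[lebesgue_rV R d]_x ((f x)%:E * (gaussian_pdf (mean p) (cov p) x)%:E))%E).
  apply: fine_cvg; rewrite fineK; last exact: fin.
  have -> : (fun N => (\int[N_ (x_ N)]_x (f x)%:E)%E) = fun N =>
      (\int[lebesgue_rV R d]_x ((f x)%:E * (gaussian_pdf (mean (x_ N)) (cov (x_ N)) x)%:E))%E.
    by apply/funext => N; exact: E.
  by have -> := E p.
apply: (@dominated_cvg _ _ _ (lebesgue_rV R d) setT measurableT
  (fun N x => ((f x)%:E * (gaussian_pdf (mean (x_ N)) (cov (x_ N)) x)%:E)%E)
  (fun x => ((f x)%:E * (gaussian_pdf (mean p) (cov p) x)%:E)%E)
  (fun x => (M * C)%:E * (gauss_envelope (b *+ 4)^-1 x)%:E)%E).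
- move=> N; apply/measurable_EFinP; apply: measurable_funM => //; exact: measurable_pdf_x.
- move=> x _; rewrite -EFinM; apply: cvg_EFin; first exact: nearW.
  by apply: cvgM; [exact: cvg_cst|exact: cvg_gaussian_pdf].
- by [].
- by apply: integrableZl => //; exact: integrable_gauss_envelope.
- move=> N x _; rewrite -!EFinM abse_EFin lee_fin ger0_norm; last first.
    by rewrite mulr_ge0// gaussian_pdf_ge0.
  rewrite -mulrA; apply: ler_pM => //; first exact: gaussian_pdf_ge0.
    by have /andP[] := fM x.
  exact: CP.
Qed.

(** Completing the square, c|x_i| <= c^2/(2k) + (k/2) x_i^2 spends half of the Gaussian decay k =
    1/(4b); the other half remains integrable. *)
Lemma gaussian_exp_bound (c : R) : 0 <= c -> exists2 C : R, 0 <= C &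
  forall theta i, S theta -> (\int[N_ theta]_x (expR (c * `|x ord0 i|))%:E <= C%:E)%E.
Proof.
move=> c0; have [C C0 CP] := gaussian_pdf_le.
pose k := (b *+ 4)^-1; have k0 : 0 < k by rewrite invr_gt0 mulrn_wgt0.
have k20 : 0 < k / 2 by rewrite divr_gt0.
have ienv := integrable_gauss_envelope d k20.
have ifin := integrable_fin_num measurableT ienv.
pose D := fine (\int[lebesgue_rV R d]_x (gauss_envelope (k / 2) x)%:E)%E.
exists (C * expR (c ^+ 2 / (k *+ 2)) * D).
  rewrite !mulr_ge0// ?expR_ge0// fine_ge0// integral_ge0// => x _.
  by rewrite lee_fin expR_ge0.
move=> theta i St; rewrite ge0_integral_gaussian//; last first.
  by apply/measurable_EFinP; exact: measurable_exp_coord.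
rewrite EFinM /D fineK// -ge0_integralZl//; last 3 first.
- by apply/measurable_EFinP; exact: measurable_gauss_envelope.
- by move=> x _; rewrite lee_fin expR_ge0.
- by rewrite lee_fin mulr_ge0// expR_ge0.
apply: ge0_le_integral => //.
- by move=> x _; rewrite mule_ge0// lee_fin ?expR_ge0// gaussian_pdf_ge0.
- apply: emeasurable_funM; apply/measurable_EFinP; first exact: measurable_exp_coord.
  exact: measurable_pdf_x.
- apply: emeasurable_funM => //; apply/measurable_EFinP; exact: measurable_gauss_envelope.
move=> x _; rewrite -!EFinM lee_fin.
apply: (@le_trans _ _ (expR (c * `|x ord0 i|) * (C * gauss_envelope k x))).
  by rewrite ler_wpM2l ?expR_ge0// CP.
rewrite mulrCA -mulrA ler_wpM2l// /gauss_envelope -!expRD ler_expR.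
have xi : `|x ord0 i| ^+ 2 <= sqnorm x.
  by rewrite real_normK ?num_real// /sqnorm (bigD1 i)//= lerDl sumr_ge0// => j _; exact: sqr_ge0.
have h : c * `|x ord0 i| <= c ^+ 2 / (k *+ 2) + k / 2 * `|x ord0 i| ^+ 2.
  rewrite -subr_ge0.
  have -> : c ^+ 2 / (k *+ 2) + k / 2 * `|x ord0 i| ^+ 2 - c * `|x ord0 i| =
      (k *+ 2)^-1 * (c - k * `|x ord0 i|) ^+ 2 by field; rewrite gt_eqF.
  by rewrite mulr_ge0 ?sqr_ge0// invr_ge0 mulrn_wge0// ltW.
have : k / 2 * `|x ord0 i| ^+ 2 <= k / 2 * sqnorm x by rewrite ler_wpM2l// ltW.
move: h; move: (c * _) (c ^+ 2 / _) (_ * `|x ord0 i| ^+ 2) => u v w.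
have -> : k * sqnorm x = k / 2 * sqnorm x + k / 2 * sqnorm x by field.
move: (k / 2 * _) => z; lra.
Qed.

Lemma ge0_integral_mixture (phi : probability 'rV[R]_(d + symdim d) R)
    (f : 'rV[R]_d -> \bar R) : measurable_fun setT f -> (forall x, 0 <= f x)%E ->
  (\int[mixture phi mS]_x f x = \int[phi]_(theta in S) \int[N_ theta]_x f x)%E.
Proof.
move: f; apply: ge0_measurable_ind.
- move=> A mA; rewrite integral_indic// setIT; apply: eq_integral => theta _.
  by rewrite integral_indic// setIT.
- move=> k f k0 mf f0 fE; rewrite ge0_integralZl// fE.
  under [RHS]eq_integral do rewrite ge0_integralZl//.
  rewrite ge0_integralZl//.
  + by apply: measurable_funTS; exact: measurable_integral_gaussian.
  + by move=> theta _; exact: integral_ge0.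
- move=> f g mf f0 mg g0 fE gE; rewrite ge0_integralD// fE gE.
  rewrite -(@ge0_integralD _ _ _ phi S mS (fun theta => \int[N_ theta]_x f x)%E
    (fun theta => \int[N_ theta]_x g x)%E).
  + by apply: eq_integral => theta _; rewrite ge0_integralD.
  + by move=> theta _; exact: integral_ge0.
  + by apply: measurable_funTS; exact: measurable_integral_gaussian.
  + by move=> theta _; exact: integral_ge0.
  + by apply: measurable_funTS; exact: measurable_integral_gaussian.
- move=> g mg g0 ndg gE; rewrite monotone_convergence//.
  under eq_fun do rewrite gE.
  rewrite -monotone_convergence//.
  + by apply: eq_integral => theta _; rewrite monotone_convergence.
  + by move=> n; apply: measurable_funTS; exact: measurable_integral_gaussian.
  + by move=> n theta _; exact: integral_ge0.
  + by move=> theta _ n m nm; apply: ge0_le_integral => // x _; exact: ndg.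
Qed.

End gaussian_family.

(** * Ramps and the regularised cost *)

Section unit_mass.
Context d (T : measurableType d) (R : realType) (m : {measure set T -> \bar R}).
Hypothesis m1 : m setT = 1%E.

(** The proof of mass one is an argument so that a probability structure can be attached to the
    name. *)
Definition unit_mass of m setT = 1%E : set T -> \bar R := m.

Let unit_mass0 : unit_mass m1 set0 = 0%E. Proof. exact: measure0. Qed.
Let unit_mass_ge0 A : (0 <= unit_mass m1 A)%E. Proof. exact: measure_ge0. Qed.
Let unit_mass_sigma_additive : semi_sigma_additive (unit_mass m1).
Proof. exact: measure_semi_sigma_additive. Qed.

HB.instance Definition _ := isMeasure.Build _ _ _ (unit_mass m1)
  unit_mass0 unit_mass_ge0 unit_mass_sigma_additive.
HB.instance Definition _ := Measure_isProbability.Build _ _ _ (unit_mass m1) m1.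

Lemma probability_of_measure : exists P : probability T R, forall A, P A = m A.
Proof. by exists (unit_mass m1). Qed.

End unit_mass.

Section ramps.
Context (R : realType) (n : nat).
Implicit Types (t u x : 'rV[R]_n).

Definition ramp1 (k : nat) (s : R) : R := Order.max 0 (Order.min 1 (1 - k%:R * s)).

Lemma ramp1_01 k s : 0 <= ramp1 k s <= 1.
Proof. by rewrite /ramp1 le_max lexx/= ge_max ler01 ge_min lexx. Qed.

Lemma continuous_ramp1 k : continuous (ramp1 k).
Proof.
move=> s; apply: (@continuous_max R R (cst 0) (fun s => Order.min 1 (1 - k%:R * s))).
  exact: cst_continuous.
apply: (@continuous_min R R (cst 1) (fun s => 1 - k%:R * s)); first exact: cst_continuous.
apply: cvgB; first exact: cvg_cst.
by apply: cvgM; [exact: cvg_cst|exact: cvg_id].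
Qed.

Lemma cvg_ramp1 s : ramp1 k s @[k --> \oo] --> ((s <= 0)%R%:R : R).
Proof.
case: (leP s 0) => s0.
  apply: cvg_near_cst; apply: nearW => k; rewrite /ramp1 (min_idPl _) ?(max_idPr _)//.
  by rewrite lerBrDr gerDl mulr_ge0_le0.
apply: cvg_near_cst; exists (Num.bound s^-1) => // k /= bk.
have ks : 1 <= k%:R * s.
  rewrite -ler_pdivrMr// div1r; apply: (le_trans (ltW (archi_boundP _))).
    by rewrite invr_ge0 ltW.
  by rewrite ler_nat.
rewrite /ramp1; apply/max_idPl; rewrite ge_min; apply/orP; right.
by rewrite subr_le0.
Qed.

(** Built in the squashed variable, with the threshold squashed too: it is continuous up to the
    boundary of the cube, and since squashing is monotone it tends, along squashed points, to the
    indicator of an orthant. *)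
Definition ramp k t u : R := \prod_i ramp1 k (u ord0 i - squash (t ord0 i)).

Lemma ramp01 k t u : 0 <= ramp k t u <= 1.
Proof.
rewrite prodr_ge0/=; last by move=> i _; have /andP[] := ramp1_01 k (u ord0 i - squash (t ord0 i)).
have <- : \prod_(i < n) (1 : R) = 1 by rewrite big1.
by apply: ler_prod => i _; exact: ramp1_01.
Qed.

Lemma measurable_ramp1 k : measurable_fun setT (ramp1 k).
Proof. by apply: continuous_measurable_fun; exact: continuous_ramp1. Qed.

Lemma measurable_ramp k t : measurable_fun setT (ramp k t).
Proof.
apply: measurable_prod => i _.
apply: (measurableT_comp (measurable_ramp1 k)); apply: measurable_funB => //.
exact: measurable_coord.
Qed.

Lemma cvg_ramp k t (T : Type) (F : set_system T) (FF : Filter F) (u_ : T -> 'rV[R]_n) u :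
  (forall i, u_ s ord0 i @[s --> F] --> u ord0 i) -> ramp k t (u_ s) @[s --> F] --> ramp k t u.
Proof.
move=> cu; apply: cvg_prodr => i.
apply: (continuous_cvg _ (@continuous_ramp1 k _)).
by apply: cvgB; [exact: cu|exact: cvg_cst].
Qed.

Lemma cvg_ramp_orthant t x :
  ramp k t (squash_rV x) @[k --> \oo] --> (\1_(orthant t) x : R).
Proof.
have -> : \1_(orthant t) x = \prod_i (squash (x ord0 i) - squash (t ord0 i) <= 0)%R%:R :> R.
  rewrite indicE; have [|] := boolP (x \in orthant t); rewrite ?inE ?notin_setE => h.
    by rewrite big1// => i _; rewrite subr_le0 squash_le h.
  have /existsNP[i /negP xi] : ~ forall i, x ord0 i <= t ord0 i by [].
  by rewrite (bigD1 i)//= subr_le0 squash_le (negbTE xi) mul0r.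
by apply: cvg_prodr => i; rewrite mxE; exact: cvg_ramp1.
Qed.

Lemma measurable_ramp_squash k t : measurable_fun setT (fun x => ramp k t (squash_rV x)).
Proof. exact: (measurableT_comp (measurable_ramp k t) (@measurable_squash_rV R n)). Qed.

Lemma eq_measure_ramps (m1 m2 : {measure set 'rV[R]_n -> \bar R}) :
  (m1 setT < +oo)%E -> (m2 setT < +oo)%E ->
  (forall k t, \int[m1]_x (ramp k t (squash_rV x))%:E =
               \int[m2]_x (ramp k t (squash_rV x))%:E)%E ->
  forall B, measurable B -> m1 B = m2 B.
Proof.
move=> m1oo m2oo eqr; apply: eq_measure_orthants => // t.
have mt := @measurable_orthant R n t.
have b1 k x : `|ramp k t (squash_rV x)| <= 1.
  by have /andP[? ?] := ramp01 k t (squash_rV x); rewrite ger0_norm.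
have mr k := measurable_ramp_squash k t.
have c1 := bounded_cvg_integral m1oo mr b1 (fun x => @cvg_ramp_orthant t x).
have c2 := bounded_cvg_integral m2oo mr b1 (fun x => @cvg_ramp_orthant t x).
have e (m : {measure set 'rV[R]_n -> \bar R}) :
    (\int[m]_x (\1_(orthant t) x)%:E = m (orthant t))%E by rewrite integral_indic// setIT.
rewrite -(e m1) -(e m2) -(cvg_lim _ c1)// -(cvg_lim _ c2)//.
by congr (limn _); apply/funext => k; exact: eqr.
Qed.

End ramps.

Section regularised_cost.
Context (R : realType) (d : nat).

(* In the variable [u = squash x] this is x / (1 + e + e |x|): a contraction that
   is continuous up to the boundary of the cube and tends to x as e -> 0. *)
Definition reg (e u : R) : R := u / (1 - `|u| + e).

Lemma reg_squash e x : 0 < e -> reg e (squash x) = x / (1 + e + e * `|x|).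
Proof.
move=> e0; have p : 0 < 1 + `|x| by rewrite ltr_pwDl.
rewrite /reg normr_squash /squash.
have ex : 0 <= e * `|x| by rewrite mulr_ge0// ltW.
have h : 0 < 1 + e + e * `|x| by lra.
have -> : 1 - `|x| / (1 + `|x|) + e = (1 + e + e * `|x|) / (1 + `|x|).
  by field; rewrite gt_eqF.
by rewrite invf_div mulrA mulfVK ?gt_eqF.
Qed.

(** Over the common denominator A B the numerator is (1 + e)(x - y) + e(x|y| - y|x|). The cross term
    vanishes when x and y have the same sign; otherwise |x - y| = |x| + |y|. In both cases it is at
    most |x - y|(|x| + |y|), and 1 + e + e|x| + e|y| <= A B. *)
Lemma reg_contraction e x y : 0 < e ->
  (reg e (squash x) - reg e (squash y)) ^+ 2 <= (x - y) ^+ 2.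
Proof.
move=> e0; rewrite !reg_squash//.
set A := 1 + e + e * `|x|; set B := 1 + e + e * `|y|.
have ex : 0 <= e * `|x| by rewrite mulr_ge0// ltW.
have ey : 0 <= e * `|y| by rewrite mulr_ge0// ltW.
have A1 : 0 < A by rewrite /A; lra.
have B1 : 0 < B by rewrite /B; lra.
have AB : 0 < A * B by rewrite mulr_gt0.
have num : `|x * B - y * A| <= `|x - y| * (A * B).
  have -> : x * B - y * A = (1 + e) * (x - y) + e * (x * `|y| - y * `|x|).
    by rewrite /A /B; ring.
  have cross : `|x * `|y| - y * `|x| | <= `|x - y| * (`|x| + `|y|).
    case: (ger0P x) => x0; case: (ger0P y) => y0.
    - by rewrite [y * x]mulrC subrr normr0 mulr_ge0// addr_ge0.
    - rewrite [leLHS]ger0_norm; last by nra.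
      rewrite ger0_norm; last by lra.
      nra.
    - rewrite [leLHS]ler0_norm; last by nra.
      rewrite ler0_norm; last by lra.
      nra.
    - have -> : x * - y - y * - x = 0 by ring.
      by rewrite normr0 mulr_ge0//; lra.
  apply: (le_trans (ler_normD _ _)).
  rewrite !normrM (gtr0_norm e0) [`|1 + e|]gtr0_norm; last by lra.
  apply: (@le_trans _ _ ((1 + e) * `|x - y| + e * (`|x - y| * (`|x| + `|y|)))).
    by rewrite lerD2l ler_wpM2l// ltW.
  rewrite [leLHS](_ : _ = `|x - y| * (1 + e + e * `|x| + e * `|y|)); last by ring.
  rewrite ler_wpM2l// /A /B; nra.
have -> : x / A - y / B = (x * B - y * A) / (A * B).
  by field; rewrite !gt_eqF.
rewrite -[leRHS]real_normK ?num_real// -[leLHS]real_normK ?num_real//.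
rewrite ler_sqr ?nnegrE// normrM normfV (gtr0_norm AB) ler_pdivrMr//.
Qed.

Definition reg_cost e (u : 'rV[R]_(d + d)) : R :=
  \sum_i (reg e (lsubmx u ord0 i) - reg e (rsubmx u ord0 i)) ^+ 2.

Lemma squash_lsubmx (z : 'rV[R]_(d + d)) : lsubmx (squash_rV z) = squash_rV (lsubmx z).
Proof. by apply/rowP => i; rewrite !mxE. Qed.

Lemma squash_rsubmx (z : 'rV[R]_(d + d)) : rsubmx (squash_rV z) = squash_rV (rsubmx z).
Proof. by apply/rowP => i; rewrite !mxE. Qed.

Lemma measurable_lsubmx : measurable_fun setT (@lsubmx R 1 d d).
Proof.
by apply: measurable_mxP => i j; under eq_fun do rewrite mxE; exact: measurable_coord.
Qed.

Lemma measurable_rsubmx : measurable_fun setT (@rsubmx R 1 d d).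
Proof.
by apply: measurable_mxP => i j; under eq_fun do rewrite mxE; exact: measurable_coord.
Qed.

Lemma measurable_reg e : measurable_fun setT (reg e).
Proof.
apply: measurable_funM => //; apply: measurable_inv; apply: measurable_funD => //.
by apply: measurable_funB.
Qed.

Lemma measurable_reg_cost e : measurable_fun setT (reg_cost e).
Proof.
apply: measurable_sum => i; apply: measurable_funX; apply: measurable_funB.
  apply: (measurableT_comp (measurable_reg e)); under eq_fun do rewrite mxE.
  exact: measurable_coord.
apply: (measurableT_comp (measurable_reg e)); under eq_fun do rewrite mxE.
exact: measurable_coord.
Qed.

Lemma reg_cost_ge0 e u : 0 <= reg_cost e u.
Proof. by apply: sumr_ge0 => i _; exact: sqr_ge0. Qed.

Lemma reg_cost_le e z : 0 < e -> reg_cost e (squash_rV z) <= sqnorm (lsubmx z - rsubmx z).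
Proof.
move=> e0; apply: ler_sum => i _; rewrite squash_lsubmx squash_rsubmx.
have sqE x : squash_rV x ord0 i = squash (x ord0 i) :> R by rewrite mxE.
have subE (x y : 'rV[R]_d) : (x - y) ord0 i = x ord0 i - y ord0 i by rewrite !mxE.
by rewrite !sqE subE; exact: reg_contraction.
Qed.

Lemma continuous_on_reg_cost e : 0 < e -> continuous_on (@cube R (d + d)) (reg_cost e).
Proof.
move=> e0; apply: continuous_on_seq => p u_ Kp Ku up.
apply: cvg_sumr => i.
have creg j : reg e (u_ N ord0 j) @[N --> \oo] --> reg e (p ord0 j).
  have uj := cvg_coord (i := j) up.
  apply: cvgM; first exact: uj.
  apply: cvgV.
    have := Kp j; rewrite in_itv/= -ler_norml => pj.
    by rewrite gt_eqF//; lra.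
  apply: cvgD; last exact: cvg_cst.
  by apply: cvgB; [exact: cvg_cst|apply: cvg_norm; exact: uj].
rewrite expr2; under eq_fun do rewrite expr2.
by apply: cvgM; apply: cvgB; rewrite mxE; under eq_fun do rewrite mxE; exact: creg.
Qed.

Lemma cvg_reg_cost z :
  reg_cost k.+1%:R^-1 (squash_rV z) @[k --> \oo] --> sqnorm (lsubmx z - rsubmx z).
Proof.
have creg x : reg k.+1%:R^-1 (squash x) @[k --> \oo] --> x.
  have -> : (fun k => reg k.+1%:R^-1 (squash x)) =
      fun k => x / (1 + harmonic k + harmonic k * `|x|).
    by apply/funext => k; rewrite reg_squash ?invr_gt0.
  rewrite -[X in _ --> X]divr1; apply: cvgM; first exact: cvg_cst.
  apply: cvgV; first exact: oner_neq0.
  rewrite [X in _ --> X](_ : 1 = 1 + 0 + 0 * `|x| :> R); last by rewrite mul0r !addr0.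
  apply: cvgD.
    by apply: cvgD; [exact: cvg_cst|exact: cvg_harmonic].
  by apply: cvgM; [exact: cvg_harmonic|exact: cvg_cst].
apply: cvg_sumr => i.
rewrite expr2; under eq_fun do rewrite expr2.
have sqE x : squash_rV x ord0 i = squash (x ord0 i) :> R by rewrite mxE.
have subE (x y : 'rV[R]_d) : (x - y) ord0 i = x ord0 i - y ord0 i by rewrite !mxE.
by rewrite subE squash_lsubmx squash_rsubmx !sqE; apply: cvgM; apply: cvgB; exact: creg.
Qed.

End regularised_cost.

(** * The transport problem *)

Lemma Rintegral_fineK d (T : measurableType d) (R : realType) (m : {measure set T -> \bar R})
    D (f : T -> R) : measurable D -> m.-integrable D (EFin \o f) ->
  (\int[m]_(x in D) f x)%:E = (\int[m]_(x in D) (f x)%:E)%E.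
Proof. by move=> mD fi; rewrite /Rintegral fineK//; exact: integrable_fin_num. Qed.

Lemma bounded_integrable01 d (T : measurableType d) (R : realType) (m : {measure set T -> \bar R})
    (f : T -> R) : (m setT < +oo)%E -> measurable_fun setT f -> (forall x, 0 <= f x <= 1) ->
  m.-integrable setT (EFin \o f).
Proof.
move=> moo mf f01; apply: (bounded_integrable moo mf (M := 1)) => x.
by have /andP[? ?] := f01 x; rewrite ger0_norm.
Qed.

Section transport.
Context (R : realType) (d : nat) (mu : probability 'rV[R]_d R).
Variables (S : set 'rV[R]_(d + symdim d)) (mS : measurable S).
Implicit Types (theta : 'rV[R]_(d + symdim d)) (z : 'rV[R]_(d + d)).
Variables (a b rad c : R).
Hypotheses (cS : compact S) (a_gt0 : 0 < a) (b_gt0 : 0 < b) (c_gt0 : 0 < c).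
Hypothesis S_cov : forall theta, S theta ->
  loewner_le a%:M (cov theta) /\ loewner_le (cov theta) b%:M.
Hypothesis S_ball : forall theta, S theta -> sqnorm theta <= rad ^+ 2.
Hypothesis S_neq0 : S !=set0.
Variable p : ('I_d -> nat) -> mpoly (d + symdim d) R.
Hypothesis p_moment : forall alpha, gaussian_moment_poly alpha (p alpha).
Hypothesis mu_exp : exp_moments c mu.

Local Notation N_ theta := (gaussian (mean theta) (cov theta)).
Local Notation mixing := (probability 'rV[R]_(d + symdim d) R).
Local Notation coupling := (probability 'rV[R]_(d + d) R).
Local Notation feasible := (OT_feasible mu mS).

Let Spd theta : S theta -> pd (cov theta). Proof. exact: S_pd a_gt0 S_cov _. Qed.

Let Smass theta : S theta -> N_ theta setT = 1%E.
Proof. exact: S_mass a_gt0 S_cov (p_moment _) _. Qed.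

Lemma mixture_mass (phi : mixing) : phi S = 1%E -> mixture phi mS setT = 1%E.
Proof.
move=> phiS; rewrite /mixture (eq_integral (cst 1%E)); last first.
  by move=> theta; rewrite inE => St; exact: Smass.
by rewrite integral_cst// mul1e.
Qed.

Lemma mixture_exp_bound : exists2 C : R, 0 <= C & forall phi : mixing, phi S = 1%E ->
  forall i, (\int[mixture phi mS]_x (expR (c * `|x ord0 i|))%:E <= C%:E)%E.
Proof.
have [C C0 CP] := gaussian_exp_bound cS a_gt0 b_gt0 S_cov S_ball (ltW c_gt0).
exists C => // phi phiS i.
have mexp : measurable_fun setT (fun x : 'rV[R]_d => (expR (c * `|x ord0 i|))%:E).
  by apply/measurable_EFinP; exact: measurable_exp_coord.
have exp0 (x : 'rV[R]_d) : (0 <= (expR (c * `|x ord0 i|))%:E)%E by rewrite lee_fin expR_ge0.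
rewrite (ge0_integral_mixture mS phi mexp exp0).
apply: (@le_trans _ _ (\int[phi]_(theta in S) (cst C%:E theta))%E).
  apply: ge0_le_integral => //.
  - by move=> theta _; exact: integral_ge0.
  - by apply: measurable_funTS; exact: measurable_integral_gaussian.
  - by move=> theta St; exact: CP.
by rewrite integral_cst// [X in (_ * X)%E]phiS mule1.
Qed.

Lemma mixture_determinate (phi : mixing) : phi S = 1%E -> moment_determinate (mixture phi mS).
Proof.
move=> phiS.
have moo : (mixture phi mS setT < +oo)%E by rewrite mixture_mass// ltry.
apply: (exp_moments_determinate c_gt0 moo).
move=> i; have [C C0 CP] := mixture_exp_bound.
by rewrite (le_lt_trans (CP _ phiS i))// ltry.
Qed.

(** Monomials change sign, so Tonelli is applied to their positive and negative parts; the finite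
    moments of the mixture allow the subtraction. *)
Lemma mixture_moment (phi : mixing) alpha : phi S = 1%E ->
  (\int[mixture phi mS]_x (monomial alpha x)%:E =
   \int[phi]_(theta in S) (peval (p alpha) theta)%:E)%E.
Proof.
move=> phiS; have [fin _] := mixture_determinate phiS; have ialpha := fin alpha.
have mal : measurable_fun setT (EFin \o @monomial R d alpha).
  by apply/measurable_EFinP; exact: measurable_monomial.
have mp := measurable_funepos mal; have mn := measurable_funeneg mal.
pose A theta := (\int[N_ theta]_x (EFin \o monomial alpha)^\+ x)%E.
pose B theta := (\int[N_ theta]_x (EFin \o monomial alpha)^\- x)%E.
have mA : measurable_fun S A by apply: measurable_funTS; exact: measurable_integral_gaussian.
have mB : measurable_fun S B by apply: measurable_funTS; exact: measurable_integral_gaussian.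
have EA := ge0_integral_mixture mS phi mp (fun x => funepos_ge0 _ x).
have EB := ge0_integral_mixture mS phi mn (fun x => funeneg_ge0 _ x).
have A0 theta : (0 <= A theta)%E by apply: integral_ge0 => x _; exact: funepos_ge0.
have B0 theta : (0 <= B theta)%E by apply: integral_ge0 => x _; exact: funeneg_ge0.
have iA : phi.-integrable S A.
  apply/integrableP; split => //; under eq_integral do rewrite gee0_abs//.
  by rewrite -EA; exact: integral_funepos_lt_pinfty.
have iB : phi.-integrable S B.
  apply/integrableP; split => //; under eq_integral do rewrite gee0_abs//.
  by rewrite -EB; exact: integral_funeneg_lt_pinfty.
rewrite [LHS]integralE EA EB -integralB//.
apply: eq_integral => theta; rewrite inE => St.
by rewrite (proj2 (p_moment alpha) _ (Spd St)) [RHS]integralE.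
Qed.

Lemma feasible_marginal_x (phi : mixing) (lam : coupling) : feasible phi lam ->
  forall A, measurable A -> mu A = lam (@lsubmx R 1 d d @^-1` A).
Proof. by move=> [_ h _] A mA; rewrite -h. Qed.

Lemma feasible_marginal_y (phi : mixing) (lam : coupling) : feasible phi lam ->
  forall A, measurable A -> mixture phi mS A = lam (@rsubmx R 1 d d @^-1` A).
Proof. by move=> [_ _ h] A mA; rewrite -h. Qed.

Lemma feasible_exp_bound : exists C : R, forall phi lam, feasible phi lam ->
  forall i, (\int[lam]_z (expR (c * `|z ord0 i|))%:E <= C%:E)%E.
Proof.
have [C C0 CP] := mixture_exp_bound.
exists (C + \sum_i fine (\int[mu]_x (expR (c * `|x ord0 i|))%:E)) => phi lam fea i.
have mexp (j : 'I_d) : measurable_fun setT (fun x : 'rV[R]_d => (expR (c * `|x ord0 j|))%:E).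
  by apply/measurable_EFinP; exact: measurable_exp_coord.
have exp0 (j : 'I_d) (x : 'rV[R]_d) : (0 <= (expR (c * `|x ord0 j|))%:E)%E.
  by rewrite lee_fin expR_ge0.
have mu0 (j : 'I_d) : 0 <= fine (\int[mu]_x (expR (c * `|x ord0 j|))%:E)%E.
  by rewrite fine_ge0// integral_ge0.
case: (split_ordP i) => j ->.
  have := ge0_integral_preimage (@measurable_lsubmx R d) (feasible_marginal_x fea) measurableT
    (mexp j) (exp0 j).
  rewrite preimage_setT => E.
  rewrite [X in (X <= _)%E](_ : _ = \int[mu]_x (expR (c * `|x ord0 j|))%:E)%E.
    rewrite -[X in (X <= _)%E]fineK; last by rewrite ge0_fin_numE ?integral_ge0//; exact: mu_exp.
    by rewrite lee_fin (bigD1 j)//= addrCA lerDl addr_ge0// sumr_ge0.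
  by rewrite E; apply: eq_integral => z _; rewrite !mxE.
have := ge0_integral_preimage (@measurable_rsubmx R d) (feasible_marginal_y fea) measurableT
  (mexp j) (exp0 j).
rewrite preimage_setT => E.
rewrite [X in (X <= _)%E](_ : _ = \int[mixture phi mS]_x (expR (c * `|x ord0 j|))%:E)%E.
  apply: (le_trans (CP phi _ j)); first by case: fea.
  by rewrite lee_fin lerDl sumr_ge0.
by rewrite E; apply: eq_integral => z _; rewrite !mxE.
Qed.

Lemma feasible_determinate phi lam : feasible phi lam -> moment_determinate lam.
Proof.
move=> fea; apply: (@exp_moments_determinate _ _ c) => //.
  by rewrite (le_lt_trans (probability_le1 _ _))// ltry.
have [C CP] := feasible_exp_bound.
by move=> i; rewrite (le_lt_trans (CP _ _ fea i))// ltry.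
Qed.

Lemma feasible_tight (phi_ : nat -> mixing) (lam_ : nat -> coupling) :
  (forall j, feasible (phi_ j) (lam_ j)) -> forall e : R, 0 < e ->
  exists k : nat, forall j i, (lam_ j [set z | (k%:R < `|z ord0 i|)%R] <= e%:E)%E.
Proof.
move=> fea e e0; have [C CP] := feasible_exp_bound.
(* Markov's inequality with exp(c t) >= 1 + c t: the tail is at most C/(1 + c k), and this k gives
   |C| <= c k e. The absolute value is there because no sign of C is recorded. *)
pose k := Num.bound (`|C| / (c * e)).
have ck : `|C| <= c * k%:R * e.
  rewrite mulrAC -ler_pdivrMl ?mulr_gt0// mulrC; apply: (le_trans (ltW (archi_boundP _))) => //.
  by rewrite divr_ge0// mulr_ge0// ltW.
exists k => j i; pose A : set 'rV[R]_(d + d) := [set z : 'rV[R]_(d + d) | k%:R < `|z ord0 i|].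
change (lam_ j A <= e%:E)%E.
have mA : measurable A.
  rewrite -[X in measurable X]setTI; apply: measurable_fun_ltr => //.
  by apply: (measurableT_comp (f := @Num.norm _ R)) => //; exact: measurable_coord.
have mexp : measurable_fun setT (fun z => (expR (c * `|z ord0 i|))%:E).
  by apply/measurable_EFinP; exact: measurable_exp_coord.
have exp_gt (z : 'rV[R]_(d + d)) : A z -> 1 + c * k%:R <= expR (c * `|z ord0 i|).
  move=> /ltW zk; apply: le_trans (expR_ge1Dx _).
  by rewrite lerD2l ler_wpM2l// ltW.
have q0 : 0 < 1 + c * k%:R by rewrite ltr_pwDl// mulr_ge0// ltW.
have : ((1 + c * k%:R)%:E * lam_ j A <= C%:E)%E.
  apply: le_trans (CP _ _ (fea j) i).
  have <- : (\int[lam_ j]_z (\1_A z)%:E = lam_ j A)%E by rewrite integral_indic// setIT.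
  rewrite -ge0_integralZl//; last 2 first.
  - by apply/measurable_EFinP; exact: measurable_indic.
  - by rewrite lee_fin ltW.
  apply: ge0_le_integral => //.
  - by move=> z _; rewrite mule_ge0// lee_fin ltW.
  - by apply: measurable_funeM; apply/measurable_EFinP; exact: measurable_indic.
  - move=> z _; rewrite -EFinM lee_fin indicE.
    have [|_] := boolP (z \in A); last by rewrite mulr0 expR_ge0.
    by rewrite inE mulr1; exact: exp_gt.
have fA : lam_ j A \is a fin_num by rewrite fin_num_measure.
rewrite -(fineK fA) -EFinM !lee_fin => h.
have fA0 : 0 <= fine (lam_ j A) by rewrite fine_ge0.
rewrite -(ler_pM2l q0); apply: (le_trans h); apply: (le_trans (ler_norm _)).
by apply: (le_trans ck); rewrite ler_pM2r// lerDr.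
Qed.

(** The independent coupling of [mu] with a single Gaussian whose parameter lies in S. *)
Lemma feasible_nonempty : exists phi lam, feasible phi lam.
Proof.
have [theta0 S0] := S_neq0.
pose phi : mixing := dirac theta0.
have phiS : phi S = 1%E by rewrite /phi/= diracE mem_set.
have [nu nuE] := probability_of_measure (mixture_mass phiS).
have mrow : measurable_fun setT (fun q : 'rV[R]_d * 'rV[R]_d => row_mx q.1 q.2 : 'rV[R]_(d + d)).
  apply: measurable_mxP => i j; case: (split_ordP j) => k ->.
    under eq_fun do rewrite row_mxEl.
    exact: (measurableT_comp (measurable_coord _ _) measurable_fst).
  under eq_fun do rewrite row_mxEr.
  exact: (measurableT_comp (measurable_coord _ _) measurable_snd).
have prodXE (A B : set 'rV[R]_d) : measurable A -> measurable B ->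
    (mu \x nu)%E (A `*` B) = (mu A * nu B)%E by move=> mA mB; exact: product_measure1E.
have mass1 : (mu \x nu)%E setT = 1%E.
  by rewrite -setXTT prodXE// !probability_setT mule1.
have [prod prodE] := probability_of_measure mass1.
have [lam lamE] := probability_pushforward prod mrow.
exists phi, lam; split => // B mB; rewrite /pushforward lamE prodE.
  rewrite (_ : _ @^-1` _ = B `*` setT); last first.
    apply/seteqP; split => q /=; first by rewrite row_mxKl.
    by rewrite row_mxKl => -[].
  by apply: etrans (prodXE B setT mB measurableT) _; rewrite probability_setT mule1.
rewrite (_ : _ @^-1` _ = setT `*` B); last first.
  apply/seteqP; split => q /=; first by rewrite row_mxKr.
  by rewrite row_mxKr => -[].
by apply: etrans (prodXE setT B measurableT mB) _; rewrite probability_setT mul1e nuE.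
Qed.

(** Determinacy is applied to each marginal separately, [mu] and the mixture being the determinate
    measures and the images of [lam] the competitors. *)
Lemma MOM_feasibleP (phi : mixing) (lam : coupling) :
  MOM_feasible mu S p phi lam <-> feasible phi lam.
Proof.
have mmon alpha : measurable_fun setT (EFin \o @monomial R d alpha).
  by apply/measurable_EFinP; exact: measurable_monomial.
have muoo : (mu setT < +oo)%E by rewrite (le_lt_trans (probability_le1 _ _))// ltry.
have [mufin mudet] := exp_moments_determinate c_gt0 muoo mu_exp.
split=> [[phiS mom]|fea]; last first.
  have [phiS _ _] := fea; split => // alpha.
  have [nufin _] := mixture_determinate phiS.
  have lE := feasible_marginal_x fea; have rE := feasible_marginal_y fea.
  split.
  - exact/(integrable_preimage (@measurable_lsubmx R d) lE (mmon alpha)).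
  - exact/(integrable_preimage (@measurable_rsubmx R d) rE (mmon alpha)).
  - by rewrite (integral_preimage (@measurable_lsubmx R d) lE measurableT (mmon alpha)) preimage_setT.
  - rewrite -mixture_moment//.
    by rewrite (integral_preimage (@measurable_rsubmx R d) rE measurableT (mmon alpha)) preimage_setT.
have [nufin nudet] := mixture_determinate phiS.
have [lx lxE] := probability_pushforward lam (@measurable_lsubmx R d).
have [ly lyE] := probability_pushforward lam (@measurable_rsubmx R d).
split=> // B mB; rewrite /pushforward.
  rewrite -lxE; apply: mudet => // alpha.
    by apply/(integrable_preimage (@measurable_lsubmx R d) (fun A _ => lxE A) (mmon alpha)); have [] := mom alpha.
  rewrite (integral_preimage (@measurable_lsubmx R d) (fun A _ => lxE A) measurableT (mmon alpha)).
  by rewrite preimage_setT; have [] := mom alpha.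
rewrite -lyE; apply: nudet => // alpha.
  by apply/(integrable_preimage (@measurable_rsubmx R d) (fun A _ => lyE A) (mmon alpha)); have [] := mom alpha.
rewrite (integral_preimage (@measurable_rsubmx R d) (fun A _ => lyE A) measurableT (mmon alpha)).
by rewrite preimage_setT mixture_moment//; have [] := mom alpha.
Qed.

(** [s] stands for either block projection, which commutes with squashing; [m_] is then the constant
    sequence [mu] or the sequence of mixtures. *)
Let ramp_lim (phi_ : nat -> mixing) (lam_ : nat -> coupling) (U : set_system nat) (lam : coupling)
    (s : 'rV[R]_(d + d) -> 'rV[R]_d) (m_ : nat -> {measure set 'rV[R]_d -> \bar R}) :
  measurable_fun setT s ->
  (forall z, s (squash_rV z) = squash_rV (s z)) ->
  (forall (u_ : nat -> 'rV[R]_(d + d)) (u : 'rV[R]_(d + d)), u_ @ \oo --> u ->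
     forall i, s (u_ N) ord0 i @[N --> \oo] --> s u ord0 i) ->
  (forall j A, measurable A -> m_ j A = lam_ j (s @^-1` A)) ->
  (forall G, measurable_fun setT G -> continuous_on (@cube R (d + d)) G ->
    \int[lam_ j]_z G (squash_rV z) @[j --> U] --> \int[lam]_z G (squash_rV z)) ->
  forall k t, \int[m_ j]_x ramp k t (squash_rV x) @[j --> U] -->
    \int[lam]_z ramp k t (squash_rV (s z)).
Proof.
move=> ms sq cs mE lim k t.
have mG : measurable_fun setT (fun u => ramp k t (s u)).
  exact: (measurableT_comp (measurable_ramp k t) ms).
have cG : continuous_on (@cube R (d + d)) (fun u => ramp k t (s u)).
  apply: continuous_on_seq => u u_ Ku Ku_ uu.
  by apply: cvg_ramp => i; exact: cs uu i.
have E : (fun z => ramp k t (squash_rV (s z))) = (fun z => ramp k t (s (squash_rV z))).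
  by apply/funext => z; rewrite sq.
have -> : (fun j => \int[m_ j]_x ramp k t (squash_rV x)) =
    (fun j => \int[lam_ j]_z ramp k t (s (squash_rV z))).
  apply/funext => j; rewrite -E /Rintegral (integral_preimage ms (mE j) measurableT) ?preimage_setT//.
  by apply/measurable_EFinP; exact: measurable_ramp_squash.
by rewrite E; exact: (lim _ mG cG).
Qed.

Let Rintegral_mixture (phi : mixing) (f : 'rV[R]_d -> R) : phi S = 1%E ->
  measurable_fun setT f -> (forall x, 0 <= f x <= 1) ->
  \int[mixture phi mS]_x f x = \int[phi]_(theta in S) (\int[N_ theta]_x f x).
Proof.
move=> phiS mf f01; rewrite {1}/Rintegral (ge0_integral_mixture mS phi (f := EFin \o f)).
- rewrite [RHS]/Rintegral; congr fine; apply: eq_integral => theta; rewrite inE => St.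
  have moo : (N_ theta setT < +oo)%E by rewrite Smass// ltry.
  by rewrite Rintegral_fineK//; exact: (bounded_integrable01 moo).
- exact/measurable_EFinP.
- by move=> x; rewrite lee_fin; have /andP[] := f01 x.
Qed.

Let cost_measurable : measurable_fun setT (fun z => sqnorm (lsubmx z - rsubmx z)).
Proof.
apply: measurable_sum => i; apply: measurable_funX.
by under eq_fun do rewrite !mxE; apply: measurable_funB; exact: measurable_coord.
Qed.

Lemma OT_limit (t : R) (phi_ : nat -> mixing) (lam_ : nat -> coupling) :
  (forall j, feasible (phi_ j) (lam_ j)) ->
  (forall j, (cost (lam_ j) <= (t + harmonic j)%:E)%E) ->
  exists phi lam, feasible phi lam /\ (cost lam <= t%:E)%E.
Proof.
move=> fea le_cost.
have [U [UU ooU]] := @ultraFilterLemma nat \oo _.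
have PU : ProperFilter U by exact: ultra_proper.
have phi_S j : phi_ j S = 1%E by have [] := fea j.
have [phi [phiS philim]] := compact_limit mS cS phi_S UU.
have [lam lamlim] := tight_limit (feasible_tight fea) UU.
have lam1 : (lam setT < +oo)%E by rewrite (le_lt_trans (probability_le1 _ _))// ltry.
have intr k t' (m : {measure set 'rV[R]_d -> \bar R}) : (m setT < +oo)%E ->
    m.-integrable setT (EFin \o (fun x => ramp k t' (squash_rV x))).
  move=> moo; apply: bounded_integrable01 => //; first exact: measurable_ramp_squash.
  by move=> x; exact: ramp01.
have marginal (s : 'rV[R]_(d + d) -> 'rV[R]_d) (m : {measure set 'rV[R]_d -> \bar R}) :
    measurable_fun setT s -> (m setT < +oo)%E ->
    (forall k t', \int[lam]_z ramp k t' (squash_rV (s z)) = \int[m]_x ramp k t' (squash_rV x)) ->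
    forall B, measurable B -> lam (s @^-1` B) = m B.
  move=> ms moo e B mB; have [Q QE] := probability_pushforward lam ms.
  rewrite -QE; apply: eq_measure_ramps => // [|k t'].
    by rewrite (le_lt_trans (probability_le1 _ _))// ltry.
  rewrite -!Rintegral_fineK ?intr//; last by rewrite (le_lt_trans (probability_le1 _ _))// ltry.
  rewrite -e /Rintegral (integral_preimage ms (fun A _ => QE A) measurableT) ?preimage_setT//.
  by apply/measurable_EFinP; exact: measurable_ramp_squash.
have sub_cvg (f : 'I_d -> 'I_(d + d)) (u_ : nat -> 'rV[R]_(d + d)) (u : 'rV[R]_(d + d)) :
    u_ @ \oo --> u ->
    forall i, u_ N ord0 (f i) @[N --> \oo] --> u ord0 (f i).
  by move=> uu i; exact: cvg_coord uu.
exists phi, lam; split.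
  split => //.
    apply: marginal => //; first exact: measurable_lsubmx.
      by rewrite (le_lt_trans (probability_le1 _ _))// ltry.
    move=> k t'; have L := @ramp_lim phi_ lam_ U lam (@lsubmx R 1 d d) (fun=> mu)
      (@measurable_lsubmx R d) (@squash_lsubmx R d) _
      (fun j => feasible_marginal_x (fea j)) lamlim k t'.
    apply: (eq_limits PU (L _) (cvg_cst _)) => //.
    move=> u_ u uu i; rewrite mxE; under eq_fun do rewrite mxE.
    exact: (sub_cvg (lshift d) _ _ uu).
  have moo : (mixture phi mS setT < +oo)%E by rewrite mixture_mass// ltry.
  apply: marginal => //; first exact: measurable_rsubmx.
  move=> k t'; have L := @ramp_lim phi_ lam_ U lam (@rsubmx R 1 d d) (fun j => mixture (phi_ j) mS)
    (@measurable_rsubmx R d) (@squash_rsubmx R d) _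
    (fun j => feasible_marginal_y (fea j)) lamlim k t'.
  have mr := measurable_ramp_squash k t'.
  have r01 x : 0 <= ramp k t' (squash_rV x) <= 1 by exact: ramp01.
  rewrite (Rintegral_mixture phiS mr r01).
  (* The same ultrafilter limit is computed twice: through the couplings it is the integral over the
     second marginal of [lam], through the mixing measures it is the integral of [G] against
     [phi]. *)
  pose G theta := \int[N_ theta]_x ramp k t' (squash_rV x).
  have mG : measurable_fun setT G.
    apply: (measurableT_comp (@fine_measurable R setT measurableT)).
    apply: measurable_integral_gaussian; first exact/measurable_EFinP.
    by move=> x; rewrite lee_fin; have /andP[] := r01 x.
  have cG : continuous_on S G.
    exact: (continuous_integral_gaussian cS a_gt0 b_gt0 S_cov S_ball (p_moment (fun=> 0%N)) mr r01).
  apply: (eq_limits PU (L _) (philim G mG cG)).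
    move=> u_ u uu i; rewrite mxE; under eq_fun do rewrite mxE.
    exact: (sub_cvg (@rshift d d) _ _ uu).
  by move=> j; rewrite Rintegral_mixture.
have e0 k : 0 < k.+1%:R^-1 :> R by rewrite invr_gt0.
have mreg k : measurable_fun setT (fun z => reg_cost k.+1%:R^-1 (squash_rV z)).
  exact: (measurableT_comp (@measurable_reg_cost R d _) (@measurable_squash_rV R (d + d))).
have regE k (P : coupling) :
    P.-integrable setT (EFin \o (fun z => reg_cost k.+1%:R^-1 (squash_rV z))).
  have [C C0 CP] := continuous_on_bounded (@compact_cube R (d + d)) (continuous_on_reg_cost (e0 k)).
  apply: (@bounded_integrable _ _ _ P _ _ C) => //.
    by rewrite (le_lt_trans (probability_le1 _ _))// ltry.
  by move=> z; apply: CP; exact: squash_cube.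
have RE k P := Rintegral_fineK measurableT (regE k P).
(* At fixed k the regularised cost is an admissible test function below the true cost, so the bound
   t + 1/(j+1) passes to the limit in j. Only afterwards does k tend to infinity. *)
have reg_le k : (\int[lam]_z (reg_cost k.+1%:R^-1 (squash_rV z))%:E <= t%:E)%E.
  rewrite -RE lee_fin; apply/ler_addgt0Pr => e e_gt0.
  have L := lamlim _ (@measurable_reg_cost R d _) (continuous_on_reg_cost (e0 k)).
  rewrite -(cvg_lim _ L)//; apply: limr_le; first by apply/cvg_ex; eexists; exact: L.
  have near_e : \forall j \near U, harmonic j <= e.
    apply: ooU; have /cvgrPdist_le /(_ e e_gt0) := @cvg_harmonic R.
    apply: filterS => j; rewrite sub0r normrN => h; apply: le_trans h; exact: ler_norm.
  apply: filterS near_e => j je; rewrite -lee_fin RE.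
  apply: (@le_trans _ _ (cost (lam_ j))).
    apply: ge0_le_integral => //.
    - by move=> z _; rewrite lee_fin reg_cost_ge0.
    - exact/measurable_EFinP.
    - exact/measurable_EFinP.
    - by move=> z _; rewrite lee_fin reg_cost_le.
  by apply: (le_trans (le_cost j)); rewrite lee_fin lerD2l.
rewrite /cost.
(* The limit is written as a lower limit, the form in which Fatou's lemma takes it. *)
have limE z : (sqnorm (lsubmx z - rsubmx z))%:E =
    limn_einf (fun k => (reg_cost k.+1%:R^-1 (squash_rV z))%:E).
  have cz : (reg_cost k.+1%:R^-1 (squash_rV z))%:E @[k --> \oo] -->
      (sqnorm (lsubmx z - rsubmx z))%:E.
    by apply: cvg_EFin; [exact: nearW|exact: cvg_reg_cost].
  rewrite is_cvg_limn_einfE; first by rewrite (cvg_lim _ cz).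
  by apply/cvg_ex; eexists; exact: cz.
under eq_integral do rewrite limE.
apply: (le_trans (fatou lam measurableT _ _)).
- by move=> k; exact/measurable_EFinP.
- by move=> k z _; rewrite lee_fin reg_cost_ge0.
rewrite limn_einf_lim; apply: lime_le; first exact: is_cvg_einfs.
apply: nearW => k; apply: le_trans (reg_le k).
by apply: ereal_inf_lbound; exists k => /=.
Qed.

Lemma cost_ge0 (lam : coupling) : (0 <= cost lam)%E.
Proof. by apply: integral_ge0 => z _; rewrite lee_fin sqnorm_ge0. Qed.

Lemma OT_optimal : exists phi lam, optimal feasible phi lam.
Proof.
have [phi0 [lam0 fea0]] := feasible_nonempty.
have le_value phi lam : feasible phi lam -> (value feasible <= cost lam)%E.
  by move=> fea; apply: ereal_inf_lbound; exists phi, lam.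
have value0 : (0 <= value feasible)%E.
  by apply: le_ereal_inf_tmp => _ [phi [lam [_ ->]]]; exact: cost_ge0.
have opt phi lam : feasible phi lam -> (cost lam <= value feasible)%E -> optimal feasible phi lam.
  by move=> fea le_v; split => //; apply/eqP; rewrite eq_le le_v (le_value _ _ fea).
(* If the value were infinite, any feasible pair would attain it; this settles the case without
   estimating the cost of a coupling. *)
have := leey (value feasible); rewrite le_eqVlt => /predU1P[voo|vfin].
  by exists phi0, lam0; apply: opt => //; rewrite voo leey.
have vf : value feasible \is a fin_num by rewrite ge0_fin_numE.
have ex (j : nat) : exists q : mixing * coupling, feasible q.1 q.2 /\
    (cost q.2 <= (fine (value feasible) + harmonic j)%:E)%E.
  have h0 : 0 < harmonic j :> R by rewrite /harmonic/= invr_gt0.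
  have [_ [phi [lam [fea ->]]] lt_v] := lb_ereal_inf_adherent h0 vf.
  by exists (phi, lam); split => //=; rewrite EFinD fineK//; exact: ltW.
pose q j := projT1 (cid (ex j)).
have qP j : feasible (q j).1 (q j).2 /\
    (cost (q j).2 <= (fine (value feasible) + harmonic j)%:E)%E.
  exact: (projT2 (cid (ex j))).
have [phi [lam [fea le_v]]] := OT_limit (fun j => proj1 (qP j)) (fun j => proj2 (qP j)).
by exists phi, lam; apply: opt => //; rewrite fineK in le_v.
Qed.

Lemma MOM_value : value (MOM_feasible mu S p) = value feasible.
Proof.
congr ereal_inf; apply/seteqP; split => x [phi [lam [fea ->]]]; exists phi, lam;
  by split => //; apply/MOM_feasibleP.
Qed.

(** Zero cost means that [lam] is concentrated on the diagonal, so both marginals coincide and [lam]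
    is the image of [mu] under x -> (x, x). This is the coupling that (ii) characterises: the
    independent one costs twice the trace of the covariance of [mu], which vanishes only for a point
    mass. *)
Lemma optimal_zero phi lam : optimal feasible phi lam ->
  value feasible = 0%E <->
  (forall C, measurable C -> lam C = pushforward mu (fun x : 'rV[R]_d => row_mx x x) C) /\
  (forall B, measurable B -> mu B = mixture phi mS B).
Proof.
move=> [fea <-].
have mdiag : measurable_fun setT (fun x : 'rV[R]_d => row_mx x x : 'rV[R]_(d + d)).
  apply: measurable_mxP => i j; case: (split_ordP j) => k ->.
    by under eq_fun do rewrite row_mxEl; exact: measurable_coord.
  by under eq_fun do rewrite row_mxEr; exact: measurable_coord.
have mcost : measurable_fun setT (fun z => (sqnorm (lsubmx z - rsubmx z))%:E).
  exact/measurable_EFinP.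
have cost_pos z : (0 <= (sqnorm (lsubmx z - rsubmx z))%:E)%E by rewrite lee_fin sqnorm_ge0.
split=> [c0|[lamE _]]; last first.
  rewrite /cost (ge0_integral_preimage mdiag lamE measurableT mcost cost_pos) preimage_setT.
  by apply: integral0_eq => x _; rewrite row_mxKl row_mxKr subrr /sqnorm big1// => i _;
     rewrite mxE expr0n.
(* The diagonal, written as a zero set of the cost so that its measurability and its full mass are
   immediate from those of the integrand. *)
pose D : set 'rV[R]_(d + d) := [set z | sqnorm (lsubmx z - rsubmx z) == 0].
have mD : measurable D.
  by rewrite -[X in measurable X]setTI; apply: measurable_fun_eqr.
have lamD : lam D = 1%E.
  have : (\int[lam]_z `|(sqnorm (lsubmx z - rsubmx z))%:E| = 0)%E.
    by rewrite -c0 /cost; apply: eq_integral => z _; rewrite gee0_abs.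
  move=> /(ae_eq_integral_abs lam measurableT mcost) [N [mN N0 subN]].
  have DN : ~` D `<=` N.
    move=> z zD; apply: subN => /= h; apply: zD; rewrite /D/=.
    by have := h Logic.I => -[] ->.
  have DC0 : lam (~` D) = 0%E.
    apply/eqP; rewrite eq_le measure_ge0 andbT -N0.
    by apply: le_measure; rewrite ?inE//; exact: measurableC.
  by have := probability_setC lam (measurableC mD); rewrite setCK DC0 sube0.
have diag z : D z -> lsubmx z = rsubmx z.
  move=> /eqP s0; apply/eqP; rewrite -subr_eq0; apply/negPn/negP => /sqnorm_gt0.
  by rewrite s0 ltxx.
have lE := feasible_marginal_x fea; have rE := feasible_marginal_y fea.
have mpre (s : 'rV[R]_(d + d) -> 'rV[R]_d) B : measurable_fun setT s -> measurable B ->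
    measurable (s @^-1` B).
  by move=> ms mB; rewrite -[X in measurable X]setTI; exact: ms.
split=> [C mC|B mB].
  have mC' : measurable ((fun x : 'rV[R]_d => row_mx x x) @^-1` C).
    by rewrite -[X in measurable X]setTI; exact: mdiag.
  rewrite /pushforward lE// (probability_full mC mD lamD).
  rewrite [RHS](probability_full _ mD lamD); last exact: (mpre _ _ (@measurable_lsubmx R d)).
  have zE z : D z -> row_mx (lsubmx z) (lsubmx z) = z.
    by move=> Dz; rewrite [X in row_mx _ X]diag// hsubmxK.
  congr (lam _); apply/seteqP; split => z /= [Cz Dz]; split => //.
    by rewrite zE.
  by rewrite -(zE z Dz).
rewrite lE// rE// (probability_full _ mD lamD); last exact: (mpre _ _ (@measurable_lsubmx R d)).
rewrite [RHS](probability_full _ mD lamD); last exact: (mpre _ _ (@measurable_rsubmx R d)).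
by congr (lam _); apply/seteqP; split => z [Bz Dz]; split => //=; move: Bz; rewrite /= (diag z Dz).
Qed.

End transport.

Theorem theorem4p2 (R : realType) (d : nat) (d_gt0 : (0 < d)%N)
  (mu : probability 'rV[R]_d R)
  (mu_exp : exists2 c : R, 0 < c &
    (ereal_sup [set \int[mu]_x (expR (c * `|x ord0 i|))%:E
               | i in [set: 'I_d]] < +oo)%E)
  (a b rad : R) (a_gt0 : 0 < a) (ab : a < b) (rad_gt0 : 0 < rad)
  (s : nat) (g : 'I_s -> mpoly d R) (q : 'I_(2 * d) -> mpoly (symdim d) R)
  (q_loewner : forall sigma : 'rV[R]_(symdim d),
    (forall k, 0 <= peval (q k) sigma) <->
    loewner_le a%:M (symmx sigma) /\ loewner_le (symmx sigma) b%:M)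
  (rad_redundant : forall (m : 'rV[R]_d) (sigma : 'rV[R]_(symdim d)),
    (forall j, 0 <= peval (g j) m) -> (forall k, 0 <= peval (q k) sigma) ->
    0 <= rad ^+ 2 - sqnorm m - sqnorm sigma)
  (S_compact : compact (param_set g q rad))
  (S_interior : interior (param_set g q rad) !=set0)
  (Q_archimedean : archimedean g q rad)
  (p : ('I_d -> nat) -> mpoly (d + symdim d) R)
  (p_moment : forall alpha, gaussian_moment_poly alpha (p alpha)) :
  let mS := measurable_param_set g q rad in
  let tau := value (OT_feasible mu mS) in
  exists (phi : probability 'rV[R]_(d + symdim d) R)
         (lambda : probability 'rV[R]_(d + d) R),
    [/\ optimal (OT_feasible mu mS) phi lambda,
        optimal (MOM_feasible mu (param_set g q rad) p) phi lambda,
        moment_determinate lambda,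
        moment_determinate (mixture phi mS) &
        tau = 0%E <->
        (forall C, measurable C ->
           lambda C = pushforward mu (fun x : 'rV[R]_d => row_mx x x) C) /\
        (forall B, measurable B -> mu B = mixture phi mS B)].
Proof.
move=> mS tau.
have S_cov theta : param_set g q rad theta ->
    loewner_le a%:M (cov theta) /\ loewner_le (cov theta) b%:M.
  by move=> /param_setP[_ q_ge0 _]; exact/q_loewner.
have S_ball theta : param_set g q rad theta -> sqnorm theta <= rad ^+ 2.
  by move=> /param_setP[].
have S_neq0 : param_set g q rad !=set0.
  by have [theta /interior_subset] := S_interior; exists theta.
have b_gt0 := lt_trans a_gt0 ab.
have [c c_gt0 mu_sup] := mu_exp.
have mu_c : exp_moments c mu.
  by move=> i; apply: le_lt_trans mu_sup; apply: ereal_sup_ubound; exists i.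
have [phi [lam opt]] :=
  OT_optimal mS S_compact a_gt0 b_gt0 c_gt0 S_cov S_ball S_neq0 p_moment mu_c.
have fea := proj1 opt; have [phiS _ _] := fea.
exists phi, lam; split => //.
- split; first exact/(MOM_feasibleP mS S_compact a_gt0 b_gt0 c_gt0 S_cov S_ball p_moment mu_c).
  by rewrite (MOM_value mS S_compact a_gt0 b_gt0 c_gt0 S_cov S_ball p_moment mu_c) (proj2 opt).
- exact: (feasible_determinate S_compact a_gt0 b_gt0 c_gt0 S_cov S_ball mu_c fea).
- exact: (mixture_determinate mS S_compact a_gt0 b_gt0 c_gt0 S_cov S_ball p_moment phiS).
- exact: optimal_zero opt.
Qed.
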